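(* Let $f:\mathbb{T}^2\to\mathbb{T}^2$ be the Cat Map induced by $\begin{pmatrix}2&1\\1&1\end{pmatrix}$, and let $\mu=\frac{3-\sqrt5}{2}$, $\lambda=\frac{3+\sqrt5}{2}$. Let $\epsilon,b,\beta,\sigma>0$, $a=\frac{\epsilon}{1-\mu}$ and $0<\varphi<\pi/2$ satisfy (B1) $\epsilon>3\Big(\sigma\sqrt{\tfrac{4\ln\lambda}{1-\mu^2}}+b\Big)$; (B2) $\beta<\frac{\epsilon}{7}$ and $\beta\le(\lambda-1)b$; (B3) $\frac14\beta>\frac{\epsilon\sin\varphi}{1-\mu}+(b+\beta)\exp\{-\frac{(a+\beta)^2}{2\sigma^2}\}\tan\varphi$. Let $V$ be a unit $C^\infty$ vector field on $\mathbb{T}^2$ that is tangent in $W$ to the curves $y=Ke^{-x^2/(2\sigma^2)}$ and forms the constant angle $\varphi$ with the unstable direction outside $U'$ (with $W,U'$ as defined in the context), and let $\mathcal F$ be the random perturbation of $f$ of size $\epsilon$ along $V$. Then: 1. There is exactly one $\mathcal F$-invariant Borel probability measure $\mu_0$ on $\mathbb{T}^2$; it is singular with respect to the Riemannian measure and is supported on the segment $[-a,a]\times\{0\}$ of the local stable manifold of the fixed point (in the stable–unstable coordinate frame). 2. If $\nu$ is any Borel probability measure on $\mathbb{T}^2$, then every weak limit point of $\mathcal F^n_*\nu$ is supported on $[-a,a]\times\{0\}$. In particular, $\frac1n\sum_{i=0}^{n-1}\mathcal F^i_*\nu\to\mu_0$ weakly.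
   Context: $\mathbb{T}^2=\mathbb{R}^2/\mathbb{Z}^2$ carries the flat metric. Around the fixed point of the Cat Map $f$ use orthonormal coordinates $(x,y)$ with $(0,0)$ the fixed point, the $x$-axis in the stable direction and the $y$-axis in the unstable direction, so that locally $f(x,y)=(\mu x,\lambda y)$. Regions (the parameters are assumed such that $U$ embeds in $\mathbb{T}^2$ via these coordinates): - $W$ is the neighborhood of the fixed point bounded by $x=\pm a$ and $y=\pm b\,e^{-x^2/(2\sigma^2)}$. - $U'$ is bounded by $y=\pm(b+\beta)e^{-x^2/(2\sigma^2)}$ and $x=\pm(a+\frac12\beta)$. - $U$ is bounded by $y=\pm(b+\beta)e^{-x^2/(2\sigma^2)}$ and $x=\pm(a+\beta)$. So $W\subset U'\subset U$. In $U'\setminus W$ the field $V$ is a $C^\infty$ extension matching the two prescriptions. Random perturbation: for $p\in\mathbb{T}^2$, $Q_p$ is the uniform distribution (with respect to arc length) on the piece of the integral curve of $V$ of points at distance along the curve at most $\epsilon$ from $p$. The random perturbation $\mathcal F$ of $f$ of size $\epsilon$ along $V$ is the Markov chain on $\mathbb{T}^2$ with transition probabilities $P(A|p)=Q_{f(p)}(A)$. For a finite Borel measure $\nu$, $(\mathcal F_*\nu)(A)=\int P(A|p)\,d\nu(p)$. A probability measure $\nu$ is $\mathcal F$-invariant if $\mathcal F_*\nu=\nu$. *)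

(* Defs.v *)
From HB Require Import structures.
From mathcomp Require Import all_boot all_order all_algebra.
From mathcomp Require Import all_classical all_reals all_analysis.
From mathcomp Require Import ring lra.

Set Implicit Arguments.
Unset Strict Implicit.
Unset Printing Implicit Defensive.

Import Order.TTheory GRing.Theory Num.Theory.
Import numFieldNormedType.Exports.

Local Open Scope classical_set_scope.
Local Open Scope ring_scope.
Local Open Scope quotient_scope.

Section Torus.
Variable R : realType.

Definition lattice_rel : rel (R * R) := fun p q =>
  (p.1 - q.1 \is a Num.int) && (p.2 - q.2 \is a Num.int).

Lemma lattice_refl : reflexive lattice_rel.
Proof. by move=> p; rewrite /lattice_rel !subrr !rpred0. Qed.

Lemma lattice_sym : symmetric lattice_rel.
Proof.
move=> p q; rewrite /lattice_rel -(opprB q.1) -(opprB q.2).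
by rewrite !rpredN.
Qed.

Lemma lattice_trans : transitive lattice_rel.
Proof.
move=> q p r /andP[h1 h2] /andP[h3 h4]; apply/andP; split.
- by rewrite -(subrKA q.1) rpredD.
- by rewrite -(subrKA q.2) rpredD.
Qed.

Canonical lattice_equiv :=
  EquivRel lattice_rel lattice_refl lattice_sym lattice_trans.

Definition torus : Type := quotient_topology {eq_quot lattice_equiv}.

HB.instance Definition _ := Topological.on torus.
HB.instance Definition _ := Quotient.on torus.
HB.instance Definition _ := isPointed.Build torus (\pi_torus (0, 0)).
HB.instance Definition _ :=
  Measurable.copy torus (g_sigma_algebraType (@open torus)).

Definition proj (z : R * R) : torus := \pi_torus z.

Lemma proj_eq z w : lattice_rel z w -> proj z = proj w.
Proof. by move=> zw; apply/eqmodP. Qed.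

Lemma proj_rel z w : proj z = proj w -> lattice_rel z w.
Proof. by move=> /eqmodP. Qed.

Definition cat_mx (z : R * R) : R * R := (2 * z.1 + z.2, z.1 + z.2).

Definition cat_map (p : torus) : torus := proj (cat_mx (repr p)).

Lemma cat_map_proj z : cat_map (proj z) = proj (cat_mx z).
Proof.
have /andP[h1 h2] : lattice_rel (repr (proj z)) z.
  by apply: proj_rel; rewrite [LHS]/proj reprK.
apply: proj_eq; apply/andP; split => /=.
- rewrite opprD addrACA -mulrBr rpredD// rpredM//; exact: rpred_nat.
- by rewrite opprD addrACA rpredD.
Qed.

Lemma proj_continuous : continuous proj.
Proof. exact: pi_continuous. Qed.

(* Push-forward to the torus of Lebesgue measure on the unit square. *)
Definition riemannian_volume (A : set torus) : \bar R :=
  (lebesgue_measure \x lebesgue_measure)%E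
    ((`[0, 1[ `*` `[0, 1[) `&` proj @^-1` A).

Definition cat_mu : R := (3 - Num.sqrt 5) / 2.
Definition cat_lambda : R := (3 + Num.sqrt 5) / 2.

Definition dot (u v : R * R) : R := u.1 * v.1 + u.2 * v.2.

(* The cat map matrix is symmetric, so its unit eigenvectors are orthogonal. *)
Definition norm_e : R := Num.sqrt (1 + (cat_lambda - 1) ^+ 2).
Definition e_s : R * R := norm_e^-1 *: (1, 1 - cat_lambda).
Definition e_u : R * R := norm_e^-1 *: (cat_lambda - 1, 1).

Let sqrt5 : Num.sqrt 5 ^+ 2 = 5 :> R.
Proof. by rewrite sqr_sqrtr. Qed.

Let lambdaE : cat_lambda ^+ 2 = 3 * cat_lambda - 1.
Proof. by rewrite /cat_lambda; have := sqrt5; lra. Qed.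

Let muE : cat_mu = 3 - cat_lambda.
Proof. by rewrite /cat_mu /cat_lambda; lra. Qed.

Let norm_eE : norm_e ^+ 2 = 1 + (cat_lambda - 1) ^+ 2.
Proof. by rewrite sqr_sqrtr// addr_ge0// sqr_ge0. Qed.

Let norm_e_neq0 : norm_e != 0.
Proof. by rewrite gt_eqF// sqrtr_gt0 ltr_wpDr// sqr_ge0. Qed.

Lemma dot_es_eu : dot e_s e_u = 0.
Proof. by rewrite /dot /= /GRing.scale /=; ring. Qed.

Lemma dot_es_es : dot e_s e_s = 1.
Proof.
rewrite /dot /= /GRing.scale /=.
transitivity ((1 + (cat_lambda - 1) ^+ 2) / norm_e ^+ 2); first by field.
by rewrite -norm_eE divff// expf_neq0.
Qed.

Lemma dot_eu_eu : dot e_u e_u = 1.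
Proof.
rewrite /dot /= /GRing.scale /=.
transitivity ((1 + (cat_lambda - 1) ^+ 2) / norm_e ^+ 2); first by field.
by rewrite -norm_eE divff// expf_neq0.
Qed.

(* The point with stable-unstable coordinates z. *)
Definition chart (z : R * R) : torus := proj (z.1 *: e_s + z.2 *: e_u).

Lemma cat_map_chart z : cat_map (chart z) = chart (cat_mu * z.1, cat_lambda * z.2).
Proof.
rewrite cat_map_proj; congr proj; rewrite /cat_mx /= /GRing.scale /= muE.
set n := norm_e^-1; set l := cat_lambda.
have lE : 3 * l - 1 - l ^+ 2 = 0 by rewrite /l lambdaE subrr.
congr pair; apply/subr0_eq; rewrite /scale_pair /e_s /e_u /= /GRing.scale /= -/n -/l.
- by transitivity (z.2 * n * (3 * l - 1 - l ^+ 2)); [ring | rewrite lE mulr0].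
- by transitivity (z.1 * n * (3 * l - 1 - l ^+ 2)); [ring | rewrite lE mulr0].
Qed.

Definition bump (K sigma x : R) : R := K * expR (- (x ^+ 2 / (2 * sigma ^+ 2))).

(* The closed region bounded by x = +-w and y = +-bump h sigma x. *)
Definition bump_region (w h sigma : R) : set (R * R) :=
  [set z | `|z.1| <= w /\ `|z.2| <= bump h sigma z.1].

Definition stable_segment (a : R) : set torus :=
  [set chart (x, 0) | x in `[- a, a]].

Fixpoint Cn (n : nat) (g : R * R -> R) : Prop :=
  continuous g /\
  if n is m.+1 then
    forall v, (forall z, derivable g z v) /\ Cn m (fun z => 'D_v g z)
  else True.

Definition smooth (g : R * R -> R) : Prop := forall n, Cn n g.

(* Tangent vectors of the torus are identified with R * R through the standard
   coordinates, so a vector field is a map torus -> R * R and the flat metric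
   is dot. *)
Definition smooth_field (V : torus -> R * R) : Prop :=
  smooth (fun z => (V (proj z)).1) /\ smooth (fun z => (V (proj z)).2).

Definition unit_field (V : torus -> R * R) : Prop :=
  forall p, dot (V p) (V p) = 1.

(* In the frame (e_s, e_u) the tangent line of y = bump K sigma x has slope
   derive1 (bump K sigma) x. *)
Definition tangent_to_bumps (V : torus -> R * R) (sigma : R)
    (W : set (R * R)) : Prop :=
  forall K x, W (x, bump K sigma x) ->
    let v := V (chart (x, bump K sigma x)) in
    dot v e_u = derive1 (bump K sigma) x * dot v e_s.

(* Only meant for unit fields: the angle, in [0, pi/2], between the lines
   spanned by V p and by e_u is phi. *)
Definition constant_unstable_angle (V : torus -> R * R) (phi : R)
    (D : set torus) : Prop :=
  forall p, D p -> `|dot (V p) e_u| = cos phi.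

(* c is a lift to the plane of the integral curve of V starting at p. *)
Definition integral_curve (V : torus -> R * R) (c : R -> R * R)
    (p : torus) : Prop :=
  proj (c 0) = p /\
  forall t : R, is_derive t (1 : R) c (V (proj (c t))).

(* The parameters in [-eps, eps] at which gamma visits a point for the first
   time: an integral curve may be periodic with period smaller than 2 * eps,
   and then each point of the arc gamma @` [-eps, eps] is to be counted once. *)
Definition first_visits (eps : R) (gamma : R -> torus) : set R :=
  [set t | t \in `[- eps, eps] /\
           forall s, - eps <= s -> s < t -> gamma s <> gamma t].

(* The uniform distribution, with respect to arc length, on the set
   gamma @` [-eps, eps], for gamma parametrized by arc length. *)
Definition arc_uniform (eps : R) (gamma : R -> torus) (A : set torus) : \bar R :=
  let D := first_visits eps gamma in
  (lebesgue_measure (D `&` gamma @^-1` A) *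
   ((fine (lebesgue_measure D))^-1)%:E)%E.

(* Transition probabilities P(A|p) = Q_(f p)(A), where Q_q is uniform on the
   piece of the integral curve of the unit field V at distance at most eps
   from q. *)
Definition random_perturbation (f : torus -> torus) (V : torus -> R * R)
    (eps : R) (k : R.-pker torus ~> torus) : Prop :=
  forall p, exists2 c, integral_curve V c (f p) &
    forall A, measurable A -> k p A = arc_uniform eps (proj \o c) A.

End Torus.

Section MarkovChain.
Context d (T : measurableType d) (R : realType).
Variable k : R.-pker T ~> T.

Section transfer.
Variable nu : probability T R.

Definition transfer (A : set T) : \bar R := (\int[nu]_p k p A)%E.

Let transfer0 : transfer set0 = 0%E.
Proof. by rewrite /transfer integral0_eq// => p _; rewrite measure0. Qed.

Let transfer_ge0 A : (0 <= transfer A)%E.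
Proof. by apply: integral_ge0 => p _; exact: measure_ge0. Qed.

Let transfer_sigma_additive : semi_sigma_additive transfer.
Proof.
move=> F mF tF mUF; rewrite [X in _ --> X](_ : _ =
  (\int[nu]_p (\sum_(n <oo) k p (F n))))%E; last first.
  apply: eq_integral => p _.
  by apply/esym/cvg_lim => //; exact: measure_semi_sigma_additive.
rewrite integral_nneseries//; last first.
  by move=> n; exact: measurable_kernel.
by apply/is_cvg_nneseries => n _ _; exact: integral_ge0.
Qed.

HB.instance Definition _ := isMeasure.Build _ _ _ transfer
  transfer0 transfer_ge0 transfer_sigma_additive.

Let transferT : transfer setT = 1%E.
Proof.
rewrite /transfer; under eq_integral do rewrite prob_kernel.
by rewrite integral_cst// mul1e; exact: probability_setT.
Qed.

HB.instance Definition _ :=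
  Measure_isProbability.Build _ _ _ transfer transferT.

End transfer.

Definition push (nu : probability T R) : probability T R := transfer nu.

Definition invariant_law (nu : probability T R) : Prop :=
  forall A, measurable A -> push nu A = nu A.

(* The mean of the first n.+1 iterates. *)
Definition cesaro_mean (nu : probability T R) (n : nat) :
    {measure set T -> \bar R} :=
  mscale (n.+1%:R^-1)%:nng (msum (fun i => iter i push nu) n.+1).

End MarkovChain.

Section Conclusions.
Variable R : realType.

(* For closed S this says that the topological support of m lies in S. *)
Definition supported_on (m : probability (torus R) R) (S : set (torus R)) :
  Prop := m (~` S) = 0%E.

Definition singular_to_volume (m : probability (torus R) R) : Prop :=
  exists2 N : set (torus R), measurable N &
    riemannian_volume N = 0%E /\ m (~` N) = 0%E.

Definition weak_cvg (m_ : nat -> {measure set (torus R) -> \bar R})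
    (m : probability (torus R) R) : Prop :=
  forall g : torus R -> R, continuous g ->
    (\int[m_ n]_p g p)%R @[n --> \oo] --> (\int[m]_p g p)%R.

Definition weak_limit_point (m_ : nat -> probability (torus R) R)
    (m : probability (torus R) R) : Prop :=
  exists2 h : nat -> nat, {homo h : i j / (i < j)%N} &
    weak_cvg (fun i => m_ (h i)) m.

End Conclusions.

(* Main.v *)
From Pilot Require Import Defs.
From HB Require Import structures.
From mathcomp Require Import all_boot all_order all_algebra.
From mathcomp Require Import all_classical all_reals all_analysis.
From mathcomp Require Import measurable_realfun.
From mathcomp Require Import ring lra zify.
Import Order.TTheory GRing.Theory Num.Theory.
Import numFieldNormedType.Exports.
Import Pilot.Defs.
Local Open Scope classical_set_scope.
Local Open Scope ring_scope.

Set Implicit Arguments.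
Unset Strict Implicit.
Unset Printing Implicit Defensive.

(* The height |y| above the segment, raised to a small power, is a Lyapunov
   function: along an arc in W the curve y = K exp(-x^2/(2 sigma^2)) is followed,
   so that in one step log |y| changes by ln lambda + ((mu x)^2 - xi^2)/(2 sigma^2),
   whose mean is about ln lambda - eps^2/(6 sigma^2) < 0 by (B1). From any other
   point the chain reaches this neighbourhood with a probability bounded below: if
   the unstable coordinate is not constant along an arc, the arc meets the stable
   manifold of the fixed point, because the lattice has dense unstable components;
   if it is constant, the arc is a stable segment of length 2 eps, hence lies in U'
   by the angle condition, and then the slope of V in W forces it onto the
   x-axis. So all mass tends to the segment at a geometric rate. On the segment the
   chain is x |-> uniform on [mu x - eps, mu x + eps], and these intervals share
   the core [-(1 - 2 mu) a, (1 - 2 mu) a], which is a Doeblin condition. *)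

(** * Bounded measurable functions and their integrals *)

Section BoundedMeasurable.
Context d (T : measurableType d) (R : realType).
Implicit Types (g h : T -> R) (m : {finite_measure set T -> \bar R}).

(** A power of the height is used because [log |y|] is unbounded at the segment, whereas [|y|^s] is
    bounded near it and vanishes exactly on it; for small [s] its mean factor in one step is
    [1 + s m + O(s^2)], with [m] the mean growth of [log |y|], so [m < 0] is enough. (B1) enters as
    [6 sigma^2 ln lambda < eps^2], the threshold at which [m] becomes negative. The obstacle away
    from the segment is that an arc may be a closed curve, run through several times within
    [[-eps, eps]]: its law then counts first visits only and need not vary continuously with the
    starting point. No Feller property is therefore relied on. Far from the segment only lower
    bounds for probabilities are used; continuity of the iterated operator is proved at the points
    of the segment alone; and the invariant law is built from the returns to the core rather than as
    a limit of averages. The outcome is stronger than convergence of averages: the iterates of every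
    initial law converge weakly to the invariant law. *)

Definition bmf g := measurable_fun setT g /\ exists M, forall x, `|g x| <= M.

Lemma bmf_integrable m D g : measurable D -> bmf g ->
  m.-integrable D (EFin \o g).
Proof.
move=> mD [mg [M gM]]; apply: measurable_bounded_integrable => //.
- by rewrite -ge0_fin_numE// fin_num_measure.
- exact: measurable_funS mg.
- exists M; split; first exact: num_real.
  by move=> x Mx y _; exact: (le_trans (gM y) (ltW Mx)).
Qed.

Lemma bmf_cst c : bmf (fun=> c).
Proof. by split; [exact: measurable_cst | exists `|c|]. Qed.

Lemma bmfD g h : bmf g -> bmf h -> bmf (fun x => g x + h x).
Proof.
move=> [mg [M gM]] [mh [N hN]]; split; first exact: measurable_funD.
by exists (M + N) => x; rewrite (le_trans (ler_normD _ _))// lerD.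
Qed.

Lemma bmfZ c g : bmf g -> bmf (fun x => c * g x).
Proof.
move=> [mg [M gM]]; split; first exact: measurable_funM.
by exists (`|c| * M) => x; rewrite normrM ler_wpM2l.
Qed.

Lemma bmfB g h : bmf g -> bmf h -> bmf (fun x => g x - h x).
Proof.
move=> bg bh; have := bmfD bg (bmfZ (-1) bh).
by under eq_fun do rewrite mulN1r.
Qed.

Lemma bmf_indic A : measurable A -> bmf (\1_A : T -> R).
Proof.
move=> mA; split; first exact: measurable_indic.
by exists 1 => x; rewrite indicE; case: (x \in A); rewrite /= ?normr1 ?normr0.
Qed.

Lemma Rintegral_bounds m D g l u : measurable D -> bmf g ->
  (forall x, D x -> l <= g x <= u) ->
  l * fine (m D) <= \int[m]_(x in D) g x <= u * fine (m D).
Proof.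
move=> mD bg lgu; rewrite -!Rintegral_cst//; apply/andP; split;
  apply: le_Rintegral => //; try exact: bmf_integrable;
  try (exact: bmf_integrable mD (bmf_cst _));
  by move=> x /lgu /andP[].
Qed.

Lemma Rintegral_indic m A : measurable A ->
  \int[m]_x (\1_A x : R) = fine (m A).
Proof. by move=> mA; rewrite /Rintegral integral_indic// setIT. Qed.

Lemma Rintegral_null m D N g : measurable D -> measurable N -> bmf g ->
  m N = 0%E -> \int[m]_(x in D) g x = \int[m]_(x in D `\` N) g x.
Proof.
move=> mD mN bg N0; rewrite /Rintegral (negligible_integral mN)//.
exact: bmf_integrable.
Qed.

Lemma Rintegral_ge0_eq0 m g : bmf g -> (forall x, 0 <= g x) ->
  \int[m]_x g x <= 0 -> m [set x | g x != 0] = 0%E.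
Proof.
move=> bg g0 le0; have ig := bmf_integrable m measurableT bg.
have i0 : (\int[m]_x (g x)%:E = 0)%E.
  apply/eqP; rewrite eq_le integral_ge0 ?andbT; last first.
    by move=> x _; rewrite lee_fin.
  rewrite -[leLHS]fineK ?lee_fin//; exact: integrable_fin_num.
have : (\int[m]_x `|(g x)%:E| = 0)%E.
  by rewrite -[RHS]i0; apply: eq_integral => x _; rewrite gee0_abs// lee_fin.
move=> /(ae_eq_integral_abs m measurableT (measurable_int _ ig)) [N [mN N0 sN]].
apply: (subset_measure0 _ mN _ N0).
  rewrite [X in measurable X](_ : _ = setT `&` g @^-1` (~` [set 0])).
    by apply: bg.1 => //; exact: measurableC.
  by rewrite setTI; apply/seteqP; split=> x /eqP.
move=> x /= gx; apply: sN => /= h; move: (h Logic.I) => [] gx0.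
by rewrite gx0 eqxx in gx.
Qed.

End BoundedMeasurable.

(** * The Markov operator on functions, dual to the transfer of measures *)

Section KernelOperator.
Context d (T : measurableType d) (R : realType).
Variable k : R.-pker T ~> T.
Implicit Types (g h : T -> R) (nu : probability T R).

(** A named copy of [k x] on which the probability structure is registered, so that facts about
    probabilities apply to each transition law. *)
Definition kmeas (x : T) : set T -> \bar R := k x.

HB.instance Definition _ x := Measure.on (kmeas x).
HB.instance Definition _ x :=
  Measure_isProbability.Build _ _ _ (kmeas x) (prob_kernel x).

Definition kint g : T -> R := fun x => \int[kmeas x]_y g y.

Lemma fine_kT x : fine (kmeas x setT) = 1.
Proof. by rewrite probability_setT. Qed.

Lemma kint_cst c x : kint (fun=> c) x = c.
Proof. by rewrite /kint Rintegral_cst// fine_kT mulr1. Qed.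

Lemma kintD g h x : bmf g -> bmf h ->
  kint (fun y => g y + h y) x = kint g x + kint h x.
Proof. by move=> bg bh; rewrite /kint RintegralD//; exact: (bmf_integrable _ measurableT). Qed.

Lemma kintB g h x : bmf g -> bmf h ->
  kint (fun y => g y - h y) x = kint g x - kint h x.
Proof. by move=> bg bh; rewrite /kint RintegralB//; exact: (bmf_integrable _ measurableT). Qed.

Lemma kintZ c g x : bmf g -> kint (fun y => c * g y) x = c * kint g x.
Proof. by move=> bg; rewrite /kint RintegralZl//; exact: (bmf_integrable _ measurableT bg). Qed.

Lemma le_kint g h x : bmf g -> bmf h -> (forall y, g y <= h y) ->
  kint g x <= kint h x.
Proof.
by move=> bg bh gh; apply: le_Rintegral => //; exact: bmf_integrable.
Qed.

Lemma kint_bounds g l u x : bmf g -> (forall y, l <= g y <= u) ->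
  l <= kint g x <= u.
Proof.
move=> bg lgu; have := @Rintegral_bounds _ _ _ (kmeas x) setT g l u measurableT bg.
by rewrite fine_kT !mulr1; apply.
Qed.

Lemma bmf_kint g : bmf g -> bmf (kint g).
Proof.
move=> bg; have [mg [M gM]] := bg; split; last first.
  by exists M => x; rewrite ler_norml kint_bounds// => y; rewrite -ler_norml.
have -> : kint g = fun x => kint (fun y => g y + M) x - M.
  by apply/funext => x; rewrite kintD// ?kint_cst ?addrK//; exact: bmf_cst.
apply: measurable_funB; last exact: measurable_cst.
have gM0 y : 0 <= g y + M by have := gM y; rewrite ler_norml; lra.
rewrite /kint /Rintegral.
apply: (measurableT_comp (f := fine)) => //.
apply: measurable_fun_integral_kernel.
- by move=> U mU; exact: measurable_kernel.
- by move=> y; rewrite lee_fin.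
- by apply/measurable_EFinP; apply: measurable_funD => //; exact: measurable_cst.
Qed.

Lemma iter_bmf_kint n g : bmf g -> bmf (iter n kint g).
Proof. by move=> bg; elim: n => //= n; exact: bmf_kint. Qed.

Let cst_meas nu : measurable_fun [set: unit] (fun=> nu : pprobability T R).
Proof. exact: measurable_cst. Qed.

(** Seen as a constant kernel out of a one-point space, [nu] composes with [k], and [push k nu] is
    the composite kernel. *)
Lemma ge0_integral_push nu (g : T -> \bar R) : (forall x, 0 <= g x)%E ->
  measurable_fun setT g ->
  (\int[push k nu]_x g x = \int[nu]_x \int[k x]_y g y)%E.
Proof.
move=> g0 mg.
have := @integral_kcomp _ _ _ _ _ _ _ (kprobability (cst_meas nu))
  (kernel.kernel_snd k) tt g g0 mg.
move=> <-; apply: eq_measure_integral => A mA _.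
by [].
Qed.

Lemma Rintegral_push nu g : bmf g ->
  \int[push k nu]_x g x = \int[nu]_x kint g x.
Proof.
move=> bg; have [mg [M gM]] := bg.
have gM0 y : 0 <= g y + M by have := gM y; rewrite ler_norml; lra.
have bgM : bmf (fun y => g y + M) by apply: bmfD => //; exact: bmf_cst.
suff: \int[push k nu]_x (g x + M) = \int[nu]_x kint (fun y => g y + M) x.
  rewrite RintegralD//; [|exact: bmf_integrable|]; last first.
    exact: bmf_integrable measurableT (bmf_cst _ M).
  have -> : kint (fun y => g y + M) = fun x => kint g x + M.
    by apply/funext => x; rewrite kintD// ?kint_cst//; exact: bmf_cst.
  rewrite RintegralD//;
    try exact: (bmf_integrable _ measurableT (bmf_cst _ M));
    try exact: (bmf_integrable _ measurableT (bmf_kint bg)).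
  have E (nu' : probability T R) : \int[nu']_x M = M.
    by rewrite Rintegral_cst// (congr1 fine (probability_setT nu')) mulr1.
  by rewrite !E; move/addIr.
rewrite /Rintegral ge0_integral_push.
- congr fine; apply: eq_integral => x _; rewrite /kint /Rintegral fineK//.
  by apply: integrable_fin_num => //; exact: bmf_integrable.
- by move=> x; rewrite lee_fin.
- by apply/measurable_EFinP; case: bgM.
Qed.

Lemma Rintegral_iter_push n nu g : bmf g ->
  \int[iter n (push k) nu]_x g x = \int[nu]_x iter n kint g x.
Proof.
elim: n g => //= n IH g bg; rewrite Rintegral_push// IH; last exact: bmf_kint.
by rewrite -iterSr.
Qed.

Lemma Rintegral_prob_bounds nu g l u : bmf g -> (forall y, l <= g y <= u) ->
  l <= \int[nu]_x g x <= u.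
Proof.
move=> bg lgu; have := @Rintegral_bounds _ _ _ nu setT g l u measurableT bg.
by rewrite (congr1 fine (probability_setT nu)) !mulr1; apply.
Qed.

End KernelOperator.

(** * One step of the chain, killed outside a set *)

Section RestrictedTransfer.
Context d (T : measurableType d) (R : realType).
Variable k : R.-pker T ~> T.
Variables (D : set T) (nu : {measure set T -> \bar R}).
Hypothesis mD : measurable D.

(** The proof of measurability is an argument so that the measure structure below, which depends on
    it, can be inferred from the term. *)
Definition rtransfer of measurable D := fun A => (\int[nu]_p k p (A `&` D))%E.

Let rtransfer0 : rtransfer mD set0 = 0%E.
Proof. by rewrite /rtransfer integral0_eq// => p _; rewrite set0I measure0. Qed.

Let rtransfer_ge0 A : (0 <= rtransfer mD A)%E.
Proof. by apply: integral_ge0 => p _; exact: measure_ge0. Qed.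

Let rtransfer_sigma_additive : semi_sigma_additive (rtransfer mD).
Proof.
move=> F mF tF mUF; rewrite [X in _ --> X](_ : _ =
  (\int[nu]_p (\sum_(n <oo) k p (F n `&` D)))%E); last first.
  apply: eq_integral => p _; rewrite setI_bigcupl.
  apply/esym/cvg_lim => //; apply: measure_semi_sigma_additive.
  - by move=> i; exact: measurableI.
  - exact: trivIset_setIr.
  - by apply: bigcupT_measurable => i; exact: measurableI.
rewrite integral_nneseries//; last first.
  by move=> n; apply: measurable_kernel; exact: measurableI.
by apply/is_cvg_nneseries => n _ _; exact: integral_ge0.
Qed.

HB.instance Definition _ := isMeasure.Build _ _ _ (rtransfer mD)
  rtransfer0 rtransfer_ge0 rtransfer_sigma_additive.

End RestrictedTransfer.

Lemma expr_small (R : realType) (q w e : R) : 0 <= q < 1 -> 0 < e ->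
  exists n, q ^+ n * w < e.
Proof.
move=> /andP[q0 q1] e0.
have /cvgrPdist_lt/(_ e e0) [n _ /(_ n (leqnn n))] :
    geometric w q @ \oo --> (0 : R) by apply: cvg_geometric; rewrite ger0_norm.
rewrite /= sub0r normrN mulrC => h; exists n.
exact: le_lt_trans (ler_norm _) h.
Qed.

(** * Ergodicity from a Lyapunov function [L] and a Doeblin set [J] *)

Section Mixing.
Context d (T : measurableType d) (R : realType).
Variable k : R.-pker T ~> T.
Variables (L : T -> R) (J : set T) (p0 : T) (alpha rho : R) (n0 : nat).
Hypothesis bL : bmf L.
Hypothesis L01 : forall p, 0 <= L p <= 1.
Hypothesis kL : forall p, kint k L p <= L p.
Hypothesis rho01 : 0 <= rho < 1.
Hypothesis knL : forall p, iter n0 (kint k) L p <= rho * L p.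
Let S : set T := [set p | L p = 0].
Hypothesis Sp0 : S p0.
Hypothesis mJ : measurable J.
Hypothesis alpha01 : 0 < alpha <= 1.
Hypothesis kJ : forall p, S p -> k p J = alpha%:E.
Hypothesis kJS : forall p A, S p -> measurable A -> A `<=` J -> k p A = k p0 A.

Let SE : ~` S = [set p | L p != 0].
Proof. by apply/seteqP; split=> p /eqP. Qed.

Let mS : measurable S.
Proof.
rewrite (_ : S = setT `&` L @^-1` [set 0]); first exact: bL.1.
by rewrite setTI.
Qed.

Let mSC : measurable (~` S). Proof. exact: measurableC. Qed.

(** [S] is absorbing: from a point of [S] the mean of the nonnegative [L] after one step is at most
    0. *)
Let kSC p : S p -> kmeas k p (~` S) = 0%E.
Proof.
move=> Sp; rewrite SE; apply: Rintegral_ge0_eq0 => //.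
  by move=> x; case/andP: (L01 x).
by have := kL p; rewrite /kint (_ : L p = 0).
Qed.

(* The part of [k p] on [J] does not depend on [p] in [S]; only the remaining
   mass [1 - alpha] sees the oscillation of [g]. *)
Lemma oscillation_step g m w : bmf g ->
  (forall p, S p -> m <= g p <= m + w) ->
  exists m', forall p, S p -> m' <= kint k g p <= m' + (1 - alpha) * w.
Proof.
move=> bg gm.
exists (\int[kmeas k p0]_(x in J) g x + m * (1 - alpha)) => p Sp.
have ig : (kmeas k p).-integrable setT (EFin \o g) by exact: bmf_integrable.
have mJC : measurable (~` J) by exact: measurableC.
have -> : kint k g p = \int[kmeas k p]_(x in J) g x
                      + \int[kmeas k p]_(x in ~` J) g x.
  rewrite /kint -Rintegral_setU//; first by rewrite setUv.
  - by rewrite setUv.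
  - by apply/disj_setPS; rewrite setICr.
have -> : \int[kmeas k p]_(x in J) g x = \int[kmeas k p0]_(x in J) g x.
  rewrite /Rintegral; congr fine; apply: eq_measure_integral => A mA AJ.
  exact: kJS.
rewrite (Rintegral_null mJC mSC bg (kSC Sp)).
have mD : measurable (~` J `\` ~` S) by exact: measurableD.
have kD : fine (kmeas k p (~` J `\` ~` S)) = 1 - alpha.
  have h1 : kmeas k p (~` J) = (1 - alpha)%:E.
    rewrite EFinB -(kJ Sp).
    exact: (@probability_setC _ _ _ (kmeas k p)).
  suff : kmeas k p (~` J `\` ~` S) = kmeas k p (~` J) by move=> ->; rewrite h1.
  rewrite measureD//; last by rewrite -ge0_fin_numE ?fin_num_measure.
  rewrite (_ : _ (_ `&` _) = 0%E) ?sube0//.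
  by apply: (subset_measure0 _ mSC _ (kSC Sp)) => //; exact: measurableI.
have := @Rintegral_bounds _ _ _ (kmeas k p) _ g m (m + w) mD bg.
rewrite kD => /(_ _)/andP[|l u].
  by move=> x [_ nSx]; apply: gm; apply: contrapT.
by apply/andP; split; lra.
Qed.

Lemma oscillation_iter n g m w : bmf g ->
  (forall p, S p -> m <= g p <= m + w) ->
  exists m', forall p, S p ->
    m' <= iter n (kint k) g p <= m' + (1 - alpha) ^+ n * w.
Proof.
move=> bg gm; elim: n => [|n [m' IH]].
  by exists m => p Sp; rewrite expr0 mul1r /= gm.
have [m'' h] := oscillation_step (iter_bmf_kint k n bg) IH.
by exists m'' => p Sp; rewrite exprS -mulrA; exact: h.
Qed.

Lemma Rintegral_concentrated (nu : probability T R) g m u : bmf g ->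
  nu (~` S) = 0%E -> (forall p, S p -> m <= g p <= u) ->
  m <= \int[nu]_x g x <= u.
Proof.
move=> bg nS gm; rewrite (Rintegral_null measurableT mSC bg nS) setTD setCK.
have := @Rintegral_bounds _ _ _ nu _ g m u mS bg gm.
suff -> : fine (nu S) = 1 by rewrite !mulr1.
have := @probability_setC _ _ _ nu S mS.
rewrite nS => /eqP; rewrite -(@fineK _ (nu S)) ?fin_num_measure// -EFinB eqe.
by rewrite eq_sym subr_eq0 => /eqP <-.
Qed.

Lemma invariant_Rintegral (m : probability T R) g : invariant_law k m ->
  bmf g -> \int[m]_x kint k g x = \int[m]_x g x.
Proof.
move=> mi bg; rewrite -Rintegral_push// /Rintegral; congr fine.
by apply: eq_measure_integral => A mA _; exact: mi.
Qed.

Lemma invariant_Rintegral_iter n (m : probability T R) g : invariant_law k m ->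
  bmf g -> \int[m]_x iter n (kint k) g x = \int[m]_x g x.
Proof.
move=> mi bg; elim: n => //= n IH.
by rewrite invariant_Rintegral//; exact: iter_bmf_kint.
Qed.

(** The mean of [L] under an invariant law is at most [rho < 1] times itself, hence 0. *)
Lemma invariant_concentrated (m : probability T R) :
  invariant_law k m -> m (~` S) = 0%E.
Proof.
move=> mi; rewrite SE; apply: Rintegral_ge0_eq0 => //.
  by move=> x; case/andP: (L01 x).
have : \int[m]_x L x <= rho * \int[m]_x L x.
  rewrite -{1}(invariant_Rintegral_iter n0 mi bL) -RintegralZl//.
    by apply: le_Rintegral => //; apply: bmf_integrable => //;
      [exact: iter_bmf_kint|exact: bmfZ].
  exact: bmf_integrable.
by case/andP: rho01 => ? ?; nra.
Qed.

(** The invariant mean of [g] is also that of its [n]-th iterate, so it lies in the shrinking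
    interval that contains the values of the iterate on [S]. *)
Lemma invariant_iter_dist n g m0 w (m : probability T R) p : bmf g ->
  (forall q, S q -> m0 <= g q <= m0 + w) ->
  invariant_law k m -> S p ->
  `|iter n (kint k) g p - \int[m]_x g x| <= (1 - alpha) ^+ n * w.
Proof.
move=> bg gm mi Sp; have [m' h] := oscillation_iter n bg gm.
have := Rintegral_concentrated (iter_bmf_kint k n bg) (invariant_concentrated mi) h.
rewrite invariant_Rintegral_iter// => /andP[? ?].
by have /andP[? ?] := h _ Sp; rewrite ler_norml; apply/andP; split; lra.
Qed.

Let q : R := 1 - alpha.

Let q01 : 0 <= q < 1.
Proof. by rewrite /q; case/andP: alpha01 => ? ?; apply/andP; split; lra. Qed.

Let mJC : measurable (~` J). Proof. exact: measurableC. Qed.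

(* The regenerations of the chain at its visits to [J] split the invariant law
   into the laws of the successive steps of an excursion that avoids [J]. *)
Fixpoint excursion (n : nat) : {measure set T -> \bar R} :=
  if n is n'.+1 then rtransfer k (excursion n') mJC
  else mrestr (kmeas k p0) mJ.

Let eae n : excursion n (~` S) = 0%E ->
  forall f : T -> \bar R, measurable_fun setT f -> (forall x, 0 <= f x)%E ->
  (\int[excursion n]_x f x = \int[excursion n]_(x in S) f x)%E.
Proof.
move=> eS f mf f0.
by rewrite (ge0_negligible_integral mSC measurableT mf _ eS)// setTD setCK.
Qed.

Let mkI A B : measurable A -> measurable B -> measurable_fun setT (k ^~ (A `&` B)).
Proof. by move=> mA mB; apply: measurable_kernel; exact: measurableI. Qed.

Let kJC p : S p -> k p (~` J) = q%:E.
Proof.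
move=> Sp; rewrite /q EFinB -(kJ Sp).
exact: (@probability_setC _ _ _ (kmeas k p)).
Qed.

(** From every point of [S] the chain stays in [S] and misses [J] with the same probability [q], so
    each step of an excursion multiplies the mass by [q]. *)
Let excursion_mass n :
  excursion n (~` S) = 0%E /\ excursion n setT = (alpha * q ^+ n)%:E.
Proof.
elim: n => [|n [IHS IHT]].
  split; rewrite /= /mrestr.
    by apply: (subset_measure0 _ mSC _ (kSC Sp0)) => //; exact: measurableI.
  by rewrite setTI expr0 mulr1; exact: kJ.
split; rewrite /= /rtransfer eae//; try exact: mkI.
  rewrite integral0_eq// => p Sp.
  by apply: (subset_measure0 _ mSC _ (kSC Sp)) => //; exact: measurableI.
rewrite setTI (eq_integral (fun=> q%:E)); last first.
  by move=> p /set_mem; exact: kJC.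
rewrite integral_cst// -[X in (_ * X)%E](_ : excursion n setT = _).
  by rewrite IHT -EFinM exprS; congr EFin; ring.
have := @integral_cst _ _ _ (excursion n) _ measurableT 1.
have := @integral_cst _ _ _ (excursion n) _ mS 1.
by rewrite !mul1e => <- <-; rewrite eae.
Qed.

Definition regeneration_law : set T -> \bar R := mseries excursion 0.

Let regeneration_setT : regeneration_law setT = 1%E.
Proof.
rewrite /regeneration_law /= /mseries.
under eq_eseriesr do rewrite (excursion_mass _).2.
apply/cvg_lim => //.
have := @cvg_geometric_series R alpha q.
case/andP: q01 => q0 q1; rewrite ger0_norm// => /(_ q1).
have -> : alpha * (1 - q)^-1 = 1.
  by rewrite /q opprB addrCA subrr addr0 divff// gt_eqF//; case/andP: alpha01.
move=> h; apply: cvg_EFin; first by apply: nearW => n; rewrite sumEFin.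
by apply: cvg_trans h; apply: near_eq_cvg; apply: nearW => n /=; rewrite sumEFin.
Qed.

HB.instance Definition _ := Measure.on regeneration_law.
HB.instance Definition _ :=
  Measure_isProbability.Build _ _ _ regeneration_law regeneration_setT.

(** One step from the [n]-th piece returns to [J] with law [excursion 0], weighted by the mass of
    the piece, and otherwise gives the piece [n.+1]. The weights sum to 1, so the returns restore
    [excursion 0], and the rest is the shifted series. *)
Lemma regeneration_invariant :
  invariant_law k (regeneration_law : probability T R).
Proof.
move=> A mA; rewrite /= /transfer.
have mk : measurable_fun setT (k ^~ A) by exact: measurable_kernel.
rewrite ge0_integral_measure_series//.
have -> : (\sum_(n <oo) \int[excursion n]_p k p A = \sum_(n <oo)
    (excursion 0 A * (alpha * q ^+ n)%:E + excursion n.+1 A))%E.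
  apply: eq_eseriesr => n _; rewrite /= /rtransfer.
  have [eS eT] := excursion_mass n.
  rewrite -eT -[X in (X * _)%E]fineK; last first.
    by rewrite /mrestr fin_num_measure//; exact: measurableI.
  rewrite -integral_cst// -ge0_integralD//; last 2 first.
  - by move=> p _; rewrite /= lee_fin fine_ge0.
  - exact: mkI.
  rewrite [RHS]eae//; last 2 first.
  - apply: emeasurable_funD; [exact: measurable_cst | exact: mkI].
  - by move=> p; rewrite adde_ge0//= lee_fin fine_ge0.
  rewrite eae//; apply: eq_integral => p /set_mem Sp.
  rewrite /= fineK; last by rewrite /mrestr fin_num_measure//; exact: measurableI.
  rewrite /mrestr /kmeas -(kJS Sp)//; last exact: measurableI.
  rewrite -measureU//; try exact: measurableI.
    by rewrite -setIUr setUv setIT.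
  by rewrite setIACA setICr setI0.
rewrite nneseriesD//; last first.
  by move=> n _ _; rewrite mule_ge0// -(excursion_mass n).2.
rewrite [RHS]/regeneration_law /= /mseries.
rewrite [RHS](@nneseries_split _ _ 0 1)//; congr (_ + _)%E.
  rewrite /index_iota /= big_seq1 /mrestr.
  have fA : kmeas k p0 (A `&` J) \is a fin_num.
    by rewrite fin_num_measure//; exact: measurableI.
  rewrite -(fineK fA).
  rewrite nneseriesZl; last by move=> n _; rewrite -(excursion_mass n).2.
  rewrite (_ : (\sum_(i <oo) (alpha * q ^+ i)%:E)%E = 1%E) ?mule1//.
    by rewrite fineK.
  transitivity (regeneration_law setT); last exact: regeneration_setT.
  rewrite /regeneration_law /= /mseries; apply: eq_eseriesr => n _.
  by rewrite (excursion_mass n).2.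
rewrite add0n -nneseries_addn//.
by apply: eq_eseriesr => n _; rewrite addn1.
Qed.

(** Both values are within [2 q^n] of each other, through the [n]-th iterate of the indicator of [A]
    at [p0]. *)
Lemma invariant_unique (m1 m2 : probability T R) A :
  invariant_law k m1 -> invariant_law k m2 -> measurable A -> m1 A = m2 A.
Proof.
move=> i1 i2 mA.
rewrite -(@fineK _ (m1 A)) ?fin_num_measure// -(@fineK _ (m2 A)) ?fin_num_measure//.
rewrite -!(Rintegral_indic _ mA); congr EFin.
have bA := bmf_indic R mA.
have i01 p : S p -> 0 <= (\1_A p : R) <= 0 + 1.
  by rewrite add0r indicE; case: (p \in A); rewrite /= ?lexx ?ler01.
apply/subr0_eq/normr0_eq0/eqP; rewrite eq_le normr_ge0 andbT.
apply/ler_addgt0Pr => e e0; rewrite add0r.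
have [n hn] := expr_small 2 q01 e0.
have := invariant_iter_dist n bA i01 i1 Sp0.
have := invariant_iter_dist n bA i01 i2 Sp0.
set u := iter n _ _ _; set a1 := \int[m1]_x _; set a2 := \int[m2]_x _ => h2 h1.
have -> : a1 - a2 = (u - a2) - (u - a1) by ring.
by rewrite (le_trans (ler_normB _ _))//; move: h1 h2 hn; rewrite /q; lra.
Qed.

Let mass nu n : R := \int[iter n (push k) nu]_x L x.

Let mass_le nu n : mass nu n.+1 <= mass nu n.
Proof.
rewrite /mass /= Rintegral_push//; apply: le_Rintegral => //.
- by apply: bmf_integrable => //; exact: bmf_kint.
- exact: bmf_integrable.
Qed.

Let mass_leD nu n r : mass nu (n + r) <= mass nu n.
Proof.
elim: r => [|r IH]; first by rewrite addn0.
by rewrite addnS (le_trans (mass_le _ _)).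
Qed.

Let mass_small nu i r : mass nu (n0 * i + r) <= rho ^+ i.
Proof.
apply: le_trans (mass_leD _ _ _) _; case/andP: rho01 => r0 r1.
elim: i => [|i IH].
  rewrite muln0 expr0 /mass /=.
  by have /andP[] := Rintegral_prob_bounds nu bL L01.
rewrite exprS mulnS; apply: le_trans (ler_wpM2l r0 IH).
rewrite /mass iterD Rintegral_iter_push// -RintegralZl//; last first.
  exact: bmf_integrable.
apply: le_Rintegral => //; apply: bmf_integrable => //.
- exact: iter_bmf_kint.
- exact: bmfZ.
Qed.

(** Time is split into [n0 * i + r] steps, after which the mean of [L] is at most [rho^i], and [j]
    last steps, which make the iterate of [g] almost constant on [S]. The hypothesis [near_S]
    carries this from [S] to all points at a cost [K L]. As [K] depends on [j], the number [j] is
    fixed before [i]. *)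
Lemma push_iter_cvg g (nu m : probability T R) : bmf g ->
  (forall j e, 0 < e -> exists2 K, 0 <= K & forall p, exists2 s, S s &
    `|iter j (kint k) g p - iter j (kint k) g s| <= e + K * L p) ->
  invariant_law k m ->
  \int[iter n (push k) nu]_x g x @[n --> \oo] --> \int[m]_x g x.
Proof.
move=> bg near_S mi; apply/cvgrPdist_le => e e0.
have [mg [M gM]] := bg; set c := \int[m]_x g x.
have e30 : 0 < e / 3 by rewrite divr_gt0.
have [j hj] := expr_small (M + M) q01 e30.
have [K K0 hK] := near_S j _ e30.
have [i hi] := expr_small K rho01 e30.
exists (j + n0 * i)%N => // n /= hn.
have -> : n = (j + (n0 * i + (n - (j + n0 * i))))%N by rewrite addnA subnKC.
set r := (n - _)%N; set nu' := iter (n0 * i + r) (push k) nu.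
rewrite iterD -/nu' Rintegral_iter_push//.
have bG := iter_bmf_kint k j bg.
have cE : c = \int[nu']_x c.
  by rewrite Rintegral_cst// (congr1 fine (probability_setT nu')) mulr1.
rewrite distrC {1}cE -RintegralB//; first last.
- exact: (bmf_integrable _ measurableT (bmf_cst _ c)).
- exact: bmf_integrable.
have bR : bmf (fun x => 2 * (e / 3) + K * L x).
  by apply: bmfD; [exact: bmf_cst | exact: bmfZ].
have bGc : bmf (fun x => iter j (kint k) g x - c).
  by apply: bmfB => //; exact: bmf_cst.
apply: le_trans (le_normr_Rintegral measurableT (bmf_integrable _ measurableT bGc)) _.
apply: (@le_trans _ _ (\int[nu']_x (2 * (e / 3) + K * L x))).
  apply: le_Rintegral => //.
  - apply: bmf_integrable => //; case: bGc => [? [N hN]]; split.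
      exact: measurableT_comp.
    by exists N => x; rewrite normr_id.
  - exact: bmf_integrable.
  move=> p _; have [s Ss hs] := hK p.
  have gM' q' : S q' -> - M <= g q' <= - M + (M + M).
    by move=> _; have := gM q'; rewrite addKr ler_norml.
  have := invariant_iter_dist j bg gM' mi Ss; rewrite -/c => h.
  have -> : iter j (kint k) g p - c =
    (iter j (kint k) g p - iter j (kint k) g s) + (iter j (kint k) g s - c) by ring.
  by rewrite (le_trans (ler_normD _ _))//; move: h hs hj; rewrite /q; lra.
rewrite RintegralD//; first last.
- by apply: bmf_integrable => //; exact: bmfZ.
- exact: (bmf_integrable _ measurableT (bmf_cst _ _)).
rewrite Rintegral_cst// (congr1 fine (probability_setT nu')) mulr1.
rewrite RintegralZl//; last exact: bmf_integrable.
have := ler_wpM2l K0 (mass_small nu i r); rewrite /mass -/nu'.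
by move: hi; rewrite mulrC; lra.
Qed.

End Mixing.

(** * Stable-unstable coordinates, the lattice, and a distance on the torus *)

Section Plane.
Variable R : realType.
Implicit Types (z w u : R * R).

Local Notation mu := (cat_mu R).
Local Notation lambda := (cat_lambda R).

Lemma cat_muE : mu = 3 - lambda.
Proof. by rewrite /cat_mu /cat_lambda; lra. Qed.

Lemma cat_lambda_sqr : lambda ^+ 2 = 3 * lambda - 1.
Proof.
have : Num.sqrt 5 ^+ 2 = 5 :> R by rewrite sqr_sqrtr.
by rewrite /cat_lambda; lra.
Qed.

Lemma cat_lambda_bounds : 13 / 5 < lambda < 27 / 10.
Proof.
have s0 : 0 <= Num.sqrt 5 :> R by exact: sqrtr_ge0.
have : Num.sqrt 5 ^+ 2 = 5 :> R by rewrite sqr_sqrtr.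
by rewrite /cat_lambda => s5; apply/andP; split; nra.
Qed.

Lemma cat_mu_bounds : 3 / 10 < mu < 2 / 5.
Proof. by rewrite cat_muE; case/andP: cat_lambda_bounds => *; lra. Qed.

Lemma norm_e_gt0 : 0 < norm_e R.
Proof. by rewrite sqrtr_gt0 ltr_wpDr// sqr_ge0. Qed.

Lemma e_uE : e_u R = ((lambda - 1) / norm_e R, (norm_e R)^-1).
Proof. by rewrite /e_u; congr pair; rewrite /= /GRing.scale /= mulrC ?mul1r. Qed.

Lemma e_sE : e_s R = ((norm_e R)^-1, (1 - lambda) / norm_e R).
Proof. by rewrite /e_s; congr pair; rewrite /= /GRing.scale /= mulrC ?mul1r. Qed.

Lemma dotDl z w u : dot (z + w) u = dot z u + dot w u.
Proof. by rewrite /dot /=; ring. Qed.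

Lemma dotNl z u : dot (- z) u = - dot z u.
Proof. by rewrite /dot /=; ring. Qed.

Lemma dotBl z w u : dot (z - w) u = dot z u - dot w u.
Proof. by rewrite dotDl dotNl. Qed.

Lemma dotZl c z u : dot (c *: z) u = c * dot z u.
Proof. by rewrite /dot /= /GRing.scale /=; ring. Qed.

Lemma dotC z w : dot z w = dot w z.
Proof. by rewrite /dot /=; ring. Qed.

(** The planar lift of [chart]; working with it keeps track of lattice translates. *)
Definition frame z : R * R := z.1 *: e_s R + z.2 *: e_u R.

Lemma dot_frame_es z : dot (frame z) (e_s R) = z.1.
Proof.
rewrite /frame dotDl (dotZl _ (e_s R)) (dotZl _ (e_u R)) dot_es_es.
by rewrite (dotC (e_u R)) dot_es_eu; ring.
Qed.

Lemma dot_frame_eu z : dot (frame z) (e_u R) = z.2.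
Proof.
rewrite /frame dotDl (dotZl _ (e_s R)) (dotZl _ (e_u R)) dot_es_eu dot_eu_eu.
by ring.
Qed.

Lemma frame_dot w : frame (dot w (e_s R), dot w (e_u R)) = w.
Proof.
have n0 := norm_e_gt0; have nE : norm_e R ^+ 2 = 1 + (lambda - 1) ^+ 2.
  by rewrite sqr_sqrtr// addr_ge0// sqr_ge0.
rewrite /frame /dot e_uE e_sE; case: w => x y; congr pair;
  rewrite /= /GRing.scale /=.
- transitivity (x * ((1 + (lambda - 1) ^+ 2) / norm_e R ^+ 2)).
    by field; rewrite gt_eqF.
  by rewrite -nE divff ?mulr1// expf_neq0// gt_eqF.
- transitivity (y * ((1 + (lambda - 1) ^+ 2) / norm_e R ^+ 2)).
    by field; rewrite gt_eqF.
  by rewrite -nE divff ?mulr1// expf_neq0// gt_eqF.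
Qed.

Lemma dot_sqr_frame w : dot w w = dot w (e_s R) ^+ 2 + dot w (e_u R) ^+ 2.
Proof.
rewrite -{1}(frame_dot w) /frame dotDl (dotZl _ (e_s R)) (dotZl _ (e_u R)).
by rewrite (dotC (e_s R)) (dotC (e_u R)) !expr2.
Qed.

Lemma frameD z w : frame (z + w) = frame z + frame w.
Proof. by rewrite /frame /= !scalerDl addrACA. Qed.

Definition lat (m n : int) : R * R := (m%:~R, n%:~R).

Lemma proj_lat w m n : proj (w + lat m n) = proj w.
Proof.
by apply: proj_eq; apply/andP; split; rewrite /= addrAC subrr add0r intr_int.
Qed.

Lemma proj_eq_lat z w : proj z = proj w -> exists m n, z = w + lat m n.
Proof.
move=> /proj_rel/andP[/intrP[m hm] /intrP[n hn]]; exists m, n.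
by case: z w hm hn => [x y] [x' y'] /= h1 h2; congr pair; rewrite /= -?h1 -?h2 addrC subrK.
Qed.

Lemma proj_repr (p : torus R) : proj (repr p) = p.
Proof. by rewrite /proj reprK. Qed.

(* The inverse of the cat map matrix preserves the lattice and contracts its
   unstable components by the factor [mu]. *)
Lemma lattice_unstable_dense (x y : R) : x < y ->
  exists m n, x < dot (lat m n) (e_u R) < y.
Proof.
move=> xy.
have /andP[m0 m1] := cat_mu_bounds.
have h k : exists m n, dot (lat m n) (e_u R) = mu ^+ k * (e_u R).1.
  elim: k => [|k [m [n IH]]].
    by exists 1, 0; rewrite /dot /= expr0; ring.
  exists (m - n), (2 * n - m); rewrite exprS -mulrA -IH /dot e_uE /=.
  rewrite !rmorphB rmorphM /= cat_muE.
  have ne : norm_e R != 0 by rewrite gt_eqF// norm_e_gt0.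
  apply/subr0_eq.
  rewrite [LHS](_ : _ = m%:~R / norm_e R * (lambda ^+ 2 - (3 * lambda - 1))).
    by rewrite cat_lambda_sqr subrr mulr0.
  by field.
have e0 : 0 < (e_u R).1.
  rewrite e_uE divr_gt0 ?norm_e_gt0//.
  by case/andP: cat_lambda_bounds; lra.
have [k hk] : exists k, mu ^+ k * (e_u R).1 < y - x.
  by apply: expr_small; [apply/andP; split; lra | rewrite subr_gt0].
have [m [n hmn]] := h k; set d := mu ^+ k * _ in hk hmn.
have d0 : 0 < d by rewrite mulr_gt0// exprn_gt0//; lra.
have /andP[f1 f2] := real_floor_itv (num_real (x / d)).
set j := Num.floor (x / d) in f1 f2.
exists ((j + 1) * m), ((j + 1) * n).
have -> : dot (lat ((j + 1) * m) ((j + 1) * n)) (e_u R) = (j + 1)%:~R * d.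
  by rewrite -hmn /dot /= !rmorphM /=; ring.
rewrite -ltr_pdivrMr// f2 /=.
move: f1; rewrite ler_pdivlMr// => f1.
by rewrite intrD mulrDl mul1r; lra.
Qed.

(** A smooth periodic substitute for the distance to the nearest integer: it vanishes exactly on the
    integers, and needs no triangle inequality. *)
Definition circle_dist (x : R) := 1 - cos (2 * pi * x).

Lemma circle_dist_ge0 x : 0 <= circle_dist x.
Proof. by rewrite subr_ge0 cos_le1. Qed.

Lemma circle_distDint x (m : int) : circle_dist (x + m%:~R) = circle_dist x.
Proof.
have hn y (n : nat) : circle_dist (y + n%:R) = circle_dist y.
  rewrite /circle_dist mulrDr mulr_natr mulr2n mulrDl mul1r.
  by rewrite (periodicn (@cosD2pi R)).
case: m => n; first exact: hn.
by rewrite NegzE mulrNz -{2}(subrK (n.+1%:R) x) hn.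
Qed.

Lemma circle_dist_eq0 x : circle_dist x = 0 -> x \is a Num.int.
Proof.
have /andP[f1 f2] := real_floor_itv (num_real x); set j := Num.floor x in f1 f2.
rewrite -(subrK j%:~R x) circle_distDint; set y := x - _ => y0.
have y01 : 0 <= y < 1.
  by rewrite /y; move: f2; rewrite intrD => f2; apply/andP; split; lra.
suff -> : y = 0 by rewrite add0r intr_int.
apply/eqP; rewrite eq_le; case/andP: y01 => -> y1; rewrite andbT leNgt.
apply/negP => yp.
have : 0 < sin (pi * y).
  apply: sin_gt0_pi; have p0 := pi_gt0 R.
  by rewrite mulr_gt0//= -[ltRHS]mulr1 ltr_pM2l.
move: y0; rewrite /circle_dist -mulrA mulr_natl cos_mulr2n cos2sin2 => h s.
have : 0 < sin (pi * y) ^+ 2 by rewrite exprn_gt0.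
by move: h; rewrite mulr2n; lra.
Qed.

Lemma circle_dist_lip x y : `|circle_dist x - circle_dist y| <= 2 * pi * `|x - y|.
Proof.
have p0 := pi_gt0 R.
wlog xy : x y / x <= y => [H|].
  by have [/H//|/ltW/H] := leP x y; rewrite distrC (distrC x).
have cosd t : is_derive t (1 : R) (@cos R) (- sin t) by exact: is_derive_cos.
have xy' : 2 * pi * x <= 2 * pi * y by rewrite ler_pM2l// mulr_gt0.
have ccos : {within `[2 * pi * x, 2 * pi * y], continuous (@cos R)}.
  by apply: continuous_subspaceT => t; exact: continuous_cos.
have [c _ hc] := MVT_segment xy' (fun t _ => cosd t) ccos.
have -> : circle_dist x - circle_dist y = cos (2 * pi * y) - cos (2 * pi * x).
  by rewrite /circle_dist; ring.
rewrite hc normrM normrN -mulrBr normrM distrC.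
rewrite (ger0_norm (_ : 0 <= 2 * pi)); last by rewrite mulr_ge0// ltW.
rewrite -[leRHS]mul1r ler_wpM2r ?sin_max// mulr_ge0//.
by rewrite mulr_ge0// ltW.
Qed.

Definition Tdist z w := circle_dist (z.1 - w.1) + circle_dist (z.2 - w.2).

Lemma Tdist_ge0 z w : 0 <= Tdist z w.
Proof. by rewrite addr_ge0// circle_dist_ge0. Qed.

Lemma Tdist_lat z w m n : Tdist (z + lat m n) w = Tdist z w.
Proof. by rewrite /Tdist /= ![_ + _%:~R - _]addrAC !circle_distDint. Qed.

Lemma Tdist_refl z : Tdist z z = 0.
Proof. by rewrite /Tdist !subrr /circle_dist mulr0 cos0 subrr addr0. Qed.

Lemma Tdist_eq0 z w : Tdist z w = 0 -> proj z = proj w.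
Proof.
move=> h; apply: proj_eq.
have h1 := circle_dist_ge0 (z.1 - w.1); have h2 := circle_dist_ge0 (z.2 - w.2).
by rewrite /lattice_rel; apply/andP; split; apply: circle_dist_eq0;
  move: h; rewrite /Tdist; lra.
Qed.

Lemma Tdist_lip z z' w w' : `|Tdist z w - Tdist z' w'| <=
  2 * pi * (`|z.1 - z'.1| + `|w.1 - w'.1| + (`|z.2 - z'.2| + `|w.2 - w'.2|)).
Proof.
have hB (a b c d : R) : `|circle_dist (a - b) - circle_dist (c - d)| <=
    2 * pi * (`|a - c| + `|b - d|).
  apply: le_trans (circle_dist_lip _ _) _.
  apply: ler_wpM2l; first by rewrite mulr_ge0// ltW// pi_gt0.
  have -> : a - b - (c - d) = (a - c) - (b - d) by ring.
  exact: ler_normB.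
rewrite /Tdist opprD addrACA mulrDr.
by rewrite (le_trans (ler_normD _ _))// lerD.
Qed.

End Plane.

(** * Calculus on the line: mean value and Gronwall inequalities *)

Section RealFacts.
Variable R : realType.

Lemma is_derive_congr (f g : R -> R) t d e : is_derive t (1 : R) f d ->
  f =1 g -> d = e -> is_derive t (1 : R) g e.
Proof. by move=> fd /funext <- <-. Qed.

Lemma derive_bounded_lipschitz (f df : R -> R) (K : R) :
  (forall t, is_derive t (1 : R) f (df t)) -> (forall t, `|df t| <= K) ->
  forall x y, `|f x - f y| <= K * `|x - y|.
Proof.
move=> fdf dfK x y.
wlog xy : x y / x <= y => [H|].
  by have [/H//|/ltW/H] := leP x y; rewrite distrC (distrC x).
have cf : {within `[x, y], continuous f}.
  apply: continuous_subspaceT => t.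
  by apply: differentiable_continuous; apply/derivable1_diffP; exact: ex_derive.
have [c _ hc] := MVT_segment xy (fun t _ => fdf t) cf.
by rewrite distrC hc normrM (distrC x) ler_wpM2r.
Qed.

Lemma is_derive_continuous (f : R -> R) t (d : R) :
  is_derive t (1 : R) f d -> {for t, continuous f}.
Proof.
move=> h; apply: differentiable_continuous; apply/derivable1_diffP.
exact: ex_derive.
Qed.

Lemma gronwall_scalar (f df : R -> R) (K : R) :
  (forall t, is_derive t (1 : R) f (df t)) -> (forall t, df t <= K * f t) ->
  forall t, 0 <= t -> f t <= expR (K * t) * f 0.
Proof.
move=> fdf h t t0.
pose g s := f s * expR (- K * s).
have hlin s : is_derive s (1 : R) (fun r => - K * r) (- K).
  apply: is_derive_congr
    (is_deriveM (is_derive_cst (- K) s (1 : R)) (is_derive_id s (1 : R))) _ _ => //.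
  by rewrite /cst /GRing.scale /=; ring.
have hexp s : is_derive s (1 : R) (fun r => expR (- K * r)) (expR (- K * s) * - K).
  exact: (is_derive1_comp (f := expR) (g := fun r => - K * r)).
have gd s : is_derive s (1 : R) g ((df s - K * f s) * expR (- K * s)).
  apply: is_derive_congr (is_deriveM (fdf s) (hexp s)) _ _ => //.
  by rewrite /GRing.scale /=; ring.
have : g t <= g 0.
  apply: (@ler0_derive1_nincr _ g 0 t) => //.
  - move=> s _; rewrite derive1E (@derive_val _ _ _ _ _ _ _ (gd s)).
    by rewrite pmulr_lle0 ?expR_gt0// subr_le0.
  - apply: continuous_subspaceT => s; exact: is_derive_continuous (gd s).
rewrite /g mulr0 expR0 mulr1 => hg.
rewrite -[leLHS]mulr1 -[X in _ * X](expRxMexpNx_1 (K * t)) mulrCA.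
by rewrite ler_wpM2l ?expR_ge0// -mulNr.
Qed.

Lemma is_derive_fst (c : R -> R * R) (t : R) (u : R * R) :
  is_derive t (1 : R) c u -> is_derive t (1 : R) (fun s => (c s).1) u.1.
Proof.
move=> [dc <-].
have h : (fun h : R => h^-1 *: ((c (h *: 1 + t)).1 - (c t).1)) @ (0 : R)^'
    --> ('D_1 c t).1.
  exact: (cvg_comp _ _ dc (@cvg_fst _ _ _ _ _)).
by split; [exact: cvgP h | exact: cvg_lim].
Qed.

Lemma is_derive_snd (c : R -> R * R) (t : R) (u : R * R) :
  is_derive t (1 : R) c u -> is_derive t (1 : R) (fun s => (c s).2) u.2.
Proof.
move=> [dc <-].
have h : (fun h : R => h^-1 *: ((c (h *: 1 + t)).2 - (c t).2)) @ (0 : R)^'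
    --> ('D_1 c t).2.
  exact: (cvg_comp _ _ dc (@cvg_snd _ _ _ _ _)).
by split; [exact: cvgP h | exact: cvg_lim].
Qed.

End RealFacts.

(** * Integral curves of Lipschitz fields in the plane *)

Section PlaneODE.
Variable R : realType.
Implicit Types (v : R * R -> R * R) (c d : R -> R * R).

(** Stated by components so that calculus of one real variable applies. *)
Definition solution v c := forall t,
  is_derive t (1 : R) (fun s => (c s).1) (v (c t)).1 /\
  is_derive t (1 : R) (fun s => (c s).2) (v (c t)).2.

Definition lipschitz_field (K : R) v := forall z w,
  `|(v z).1 - (v w).1| <= K * (`|z.1 - w.1| + `|z.2 - w.2|) /\
  `|(v z).2 - (v w).2| <= K * (`|z.1 - w.1| + `|z.2 - w.2|).

(** The square of the Euclidean distance, which unlike the distance is differentiable along curves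
    that meet. *)
Definition dist2 (z w : R * R) := (z.1 - w.1) ^+ 2 + (z.2 - w.2) ^+ 2.

Lemma is_derive_affine (s a b : R) :
  is_derive s (1 : R) (fun r => a * r + b) a.
Proof.
apply: is_derive_congr (is_deriveD
  (is_deriveM (is_derive_cst a s (1 : R)) (is_derive_id s (1 : R)))
  (is_derive_cst b s (1 : R))) _ _ => //.
by rewrite /cst /GRing.scale /=; ring.
Qed.

Lemma solution_affine v c (a b : R) : solution v c ->
  solution (fun z => a *: v z) (fun t => c (a * t + b)).
Proof.
move=> sc t; have [h1 h2] := sc (a * t + b); split.
- apply: is_derive_congr (is_derive1_comp (f := fun s => (c s).1)
    (g := fun r => a * r + b) h1 (is_derive_affine t a b)) _ _ => //.
  by rewrite mulrC.
- apply: is_derive_congr (is_derive1_comp (f := fun s => (c s).2)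
    (g := fun r => a * r + b) h2 (is_derive_affine t a b)) _ _ => //.
  by rewrite mulrC.
Qed.

(** The derivative of the squared distance is at most [2 K (|a| + |b|)^2 <= 4 K (a^2 + b^2)], with
    [a], [b] the coordinate differences; this is the origin of the rate [4 K]. *)
Lemma solution_gronwall_ge0 K v c d : lipschitz_field K v -> 0 <= K ->
  solution v c -> solution v d -> forall t, 0 <= t ->
  dist2 (c t) (d t) <= expR (4 * K * t) * dist2 (c 0) (d 0).
Proof.
move=> lv K0 sc sd.
pose a t := (c t).1 - (d t).1; pose b t := (c t).2 - (d t).2.
pose da t := (v (c t)).1 - (v (d t)).1; pose db t := (v (c t)).2 - (v (d t)).2.
apply: (gronwall_scalar (f := fun t => dist2 (c t) (d t))
  (df := fun t => 2 * (a t * da t + b t * db t))) => t.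
- have [c1 c2] := sc t; have [d1 d2] := sd t.
  have ha : is_derive t (1 : R) a (da t) by exact: is_deriveB.
  have hb : is_derive t (1 : R) b (db t) by exact: is_deriveB.
  apply: is_derive_congr (is_deriveD (is_deriveM ha ha) (is_deriveM hb hb)) _ _.
    by move=> s; rewrite /dist2 !expr2.
  by rewrite /GRing.scale /=; ring.
- have [l1 l2] := lv (c t) (d t).
  rewrite -/(a t) -/(b t) -/(da t) -/(db t) in l1 l2.
  have -> : dist2 (c t) (d t) = `|a t| ^+ 2 + `|b t| ^+ 2.
    by rewrite !real_normK ?num_real.
  have h1 : a t * da t <= `|a t| * (K * (`|a t| + `|b t|)).
    by rewrite (le_trans (ler_norm _))// normrM ler_wpM2l.
  have h2 : b t * db t <= `|b t| * (K * (`|a t| + `|b t|)).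
    by rewrite (le_trans (ler_norm _))// normrM ler_wpM2l.
  have h3 : 0 <= K * (`|a t| - `|b t|) ^+ 2 by rewrite mulr_ge0// sqr_ge0.
  nra.
Qed.

Lemma lipschitz_fieldN K v : lipschitz_field K v ->
  lipschitz_field K (fun z => -1 *: v z).
Proof.
move=> lv z w; have [l1 l2] := lv z w.
by rewrite !scaleN1r /= -!opprD !normrN.
Qed.

Lemma solution_gronwall K v c d t : lipschitz_field K v -> 0 <= K ->
  solution v c -> solution v d ->
  dist2 (c t) (d t) <= expR (4 * K * `|t|) * dist2 (c 0) (d 0).
Proof.
move=> lv K0 sc sd; have [t0|t0] := leP 0 t.
  by rewrite ger0_norm//; exact: solution_gronwall_ge0 lv K0 sc sd _ t0.
have t0' : 0 <= - t by rewrite oppr_ge0 ltW.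
have := solution_gronwall_ge0 (lipschitz_fieldN lv) K0
  (solution_affine (-1) 0 sc) (solution_affine (-1) 0 sd) t0'.
by rewrite ltr0_norm// mulrNN mul1r !addr0 mulr0.
Qed.

End PlaneODE.

(** * Lifts to the plane of a smooth field on the torus *)

Section TorusField.
Variable R : realType.
Variable V : torus R -> R * R.
Implicit Types (g : R * R -> R) (c d : R -> R * R).

Definition periodic2 g := forall z m n, g (z + lat R m n) = g z.

Lemma unit_square_rep (z : R * R) : exists m n,
  (`[0, 1] `*` `[0, 1]) (z + lat R m n).
Proof.
exists (- Num.floor z.1), (- Num.floor z.2).
have /andP[f1 f2] := real_floor_itv (num_real z.1).
have /andP[f3 f4] := real_floor_itv (num_real z.2).
rewrite !intrD in f2 f4.
by split; rewrite /= in_itv /= mulrNz; apply/andP; split; lra.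
Qed.

Lemma compact_unit_square : compact (`[0, 1] `*` `[0, 1] : set (R * R)).
Proof. by apply: compact_setX; exact: segment_compact. Qed.

Lemma periodic_bounded g : continuous g -> periodic2 g ->
  exists K, 0 <= K /\ forall z, `|g z| <= K.
Proof.
move=> cg pg.
have : compact (g @` (`[0, 1] `*` `[0, 1])).
  apply: continuous_compact; last exact: compact_unit_square.
  exact: continuous_subspaceT.
move=> /compact_bounded [M [_ hM]]; exists (`|M| + 1); split.
  by rewrite addr_ge0.
move=> z; have [m [n hz]] := unit_square_rep z.
rewrite -(pg z m n); apply: (hM (`|M| + 1)).
  by rewrite (le_lt_trans (ler_norm M))// ltrDl.
by exists (z + lat R m n).
Qed.

Lemma periodic_derive g u : periodic2 g -> periodic2 (fun z => 'D_u g z).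
Proof.
move=> pg z m n; rewrite /derive.
suff -> : (fun h : R => h^-1 *: (g (h *: u + (z + lat R m n)) - g (z + lat R m n)))
  = (fun h : R => h^-1 *: (g (h *: u + z) - g z)) by [].
by apply/funext => h; rewrite addrA !pg.
Qed.

(** The partial derivatives are continuous and periodic, so they are bounded by their values on the
    unit square; two points are joined by a horizontal and a vertical segment. *)
Lemma periodic_smooth_lipschitz g : smooth g -> periodic2 g ->
  exists2 K, 0 <= K &
  forall z w, `|g z - g w| <= K * (`|z.1 - w.1| + `|z.2 - w.2|).
Proof.
move=> sg pg; have [_ h] := sg 1%N.
have [d1 [c1 _]] := h (1, 0); have [d2 [c2 _]] := h (0, 1).
have [K1 [K10 hK1]] := periodic_bounded c1 (periodic_derive _ pg).
have [K2 [K20 hK2]] := periodic_bounded c2 (periodic_derive _ pg).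
have h1 x x' y : `|g (x, y) - g (x', y)| <= K1 * `|x - x'|.
  apply: (derive_bounded_lipschitz (f := fun t => g (t, y))
    (df := fun t => 'D_(1, 0) g (t, y))) => // t.
  have e : (fun h : R => h^-1 *: (g (h *: 1 + t, y) - g (t, y))) =
      (fun h : R => h^-1 *: (g (h *: (1, 0) + (t, y)) - g (t, y))).
    apply/funext => k; congr (_ *: (g _ - _)); congr pair => /=.
    by rewrite /GRing.scale /= mulr0 add0r.
  split; first by rewrite /derivable e; exact: d1.
  by rewrite /derive e.
have h2 x y y' : `|g (x, y) - g (x, y')| <= K2 * `|y - y'|.
  apply: (derive_bounded_lipschitz (f := fun t => g (x, t))
    (df := fun t => 'D_(0, 1) g (x, t))) => // t.
  have e : (fun h : R => h^-1 *: (g (x, h *: 1 + t) - g (x, t))) =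
      (fun h : R => h^-1 *: (g (h *: (0, 1) + (x, t)) - g (x, t))).
    apply/funext => k; congr (_ *: (g _ - _)); congr pair => /=.
    by rewrite /GRing.scale /= mulr0 add0r.
  split; first by rewrite /derivable e; exact: d2.
  by rewrite /derive e.
exists (K1 + K2); first by rewrite addr_ge0.
move=> [x y] [x' y'] /=.
have -> : g (x, y) - g (x', y') =
  (g (x, y) - g (x', y)) + (g (x', y) - g (x', y')) by ring.
apply: le_trans (ler_normD _ _) _.
apply: le_trans (lerD (h1 x x' y) (h2 x' y y')) _.
have := mulr_ge0 K10 (normr_ge0 (y - y')).
have := mulr_ge0 K20 (normr_ge0 (x - x')).
lra.
Qed.

Hypothesis V_smooth : smooth_field V.

Definition lift_field (z : R * R) := V (proj z).

Lemma lift_field_lipschitz : exists2 K, 0 <= K & lipschitz_field K lift_field.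
Proof.
have [s1 s2] := V_smooth.
have p1 : periodic2 (fun z => (V (proj z)).1) by move=> z m n; rewrite proj_lat.
have p2 : periodic2 (fun z => (V (proj z)).2) by move=> z m n; rewrite proj_lat.
have [K1 K10 h1] := periodic_smooth_lipschitz s1 p1.
have [K2 K20 h2] := periodic_smooth_lipschitz s2 p2.
exists (K1 + K2); first by rewrite addr_ge0.
move=> z w; have d0 : 0 <= `|z.1 - w.1| + `|z.2 - w.2| by rewrite addr_ge0.
by split; [apply: le_trans (h1 z w) _ | apply: le_trans (h2 z w) _];
  rewrite ler_wpM2r// ?lerDl ?lerDr.
Qed.

Lemma integral_curve_solution c p : integral_curve V c p -> solution lift_field c.
Proof.
by move=> [_ h] t; split; [exact: is_derive_fst (h t) | exact: is_derive_snd (h t)].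
Qed.

Lemma dist2_eq0 (z w : R * R) : dist2 z w <= 0 -> z = w.
Proof.
move=> h; have h1 := sqr_ge0 (z.1 - w.1); have h2 := sqr_ge0 (z.2 - w.2).
rewrite /dist2 in h.
have /eqP : (z.1 - w.1) ^+ 2 = 0 by lra.
have /eqP : (z.2 - w.2) ^+ 2 = 0 by lra.
rewrite !sqrf_eq0 !subr_eq0 => /eqP e2 /eqP e1.
by case: z w e1 e2 {h h1 h2} => ? ? [? ?] /= -> ->.
Qed.

Lemma solution_unique c d t : solution lift_field c -> solution lift_field d ->
  c 0 = d 0 -> c t = d t.
Proof.
move=> sc sd cd0; have [K K0 lK] := lift_field_lipschitz.
apply: dist2_eq0; have := solution_gronwall t lK K0 sc sd.
by rewrite cd0 [dist2 (d 0) _]/dist2 !subrr expr0n /= addr0 mulr0.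
Qed.

Lemma solution_shift c s : solution lift_field c ->
  solution lift_field (fun t => c (t + s)).
Proof.
move=> sc; have := solution_affine 1 s sc.
rewrite (_ : (fun z => 1 *: lift_field z) = lift_field); last first.
  by apply/funext => z; rewrite scale1r.
by under eq_fun do rewrite mul1r.
Qed.

Lemma solution_lat c m n : solution lift_field c ->
  solution lift_field (fun t => c t + lat R m n).
Proof.
move=> sc t; have [h1 h2] := sc t; rewrite /lift_field proj_lat; split.
- apply: is_derive_congr
    (is_deriveD h1 (is_derive_cst (m%:~R : R) t (1 : R))) _ _ => //.
  by rewrite addr0.
- apply: is_derive_congr
    (is_deriveD h2 (is_derive_cst (n%:~R : R) t (1 : R))) _ _ => //.
  by rewrite addr0.
Qed.

(** Time shifts and lattice translates of solutions are solutions, so coincidence on the torus at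
    one pair of times reduces to uniqueness in the plane. *)
Lemma solution_proj_unique c d s t u : solution lift_field c ->
  solution lift_field d -> proj (c s) = proj (d t) ->
  proj (c (s + u)) = proj (d (t + u)).
Proof.
move=> sc sd /proj_eq_lat[m [n e]].
rewrite -(proj_lat (d (t + u)) m n); congr proj.
rewrite ![_ + u]addrC.
apply: (@solution_unique (fun r => c (r + s)) (fun r => d (r + t) + lat R m n)).
- exact: solution_shift.
- exact: (solution_lat m n (solution_shift t sd)).
- by rewrite !add0r.
Qed.

Lemma solution_continuous c : solution lift_field c ->
  continuous (fun t => (c t).1) /\ continuous (fun t => (c t).2).
Proof.
by move=> sc; split=> t; have [h1 h2] := sc t; exact: is_derive_continuous.
Qed.

End TorusField.

(** * The law of an arc that may close up *)

Section Arc.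
Variable R : realType.
Variable V : torus R -> R * R.
Hypothesis V_smooth : smooth_field V.
Variable c : R -> R * R.
Hypothesis sc : solution (lift_field V) c.

Local Notation gamma := (@proj R \o c).
Local Notation leb := (@lebesgue_measure R).

Lemma solution_curve_continuous : continuous c.
Proof.
have [c1 c2] := solution_continuous sc => t.
have -> : c = fun t => ((c t).1, (c t).2) by apply/funext => s; case: (c s).
exact: cvg_pair (c1 t) (c2 t).
Qed.

Lemma continuous_curve_measurable (g : R -> torus R) A : continuous g ->
  measurable A -> measurable (g @^-1` A).
Proof.
move=> cg mA; rewrite -[X in measurable X]setTI.
have mg : measurable_fun [set: R] g.
  apply: (@measurability _ _ _ _ _ _ (@open (torus R))) => //.
  move=> _ [B oB <-]; apply: measurableI => //.
  by apply: open_measurable; move/continuousP : cg; exact.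
exact: mg.
Qed.

Lemma gamma_measurable A : measurable A -> measurable (gamma @^-1` A).
Proof.
apply: continuous_curve_measurable => t.
by apply: continuous_comp; [exact: solution_curve_continuous | exact: proj_continuous].
Qed.

Definition curve_period (p : R) := 0 < p /\ forall t, gamma (t + p) = gamma t.

(** The equation is autonomous, so a curve that meets itself is periodic. *)
Lemma return_curve_period s t : s < t -> gamma s = gamma t -> curve_period (t - s).
Proof.
move=> st e; split; first by rewrite subr_gt0.
move=> u; have := solution_proj_unique V_smooth (u - s) sc sc e.
have -> : u + (t - s) = t + (u - s) by ring.
have e2 : s + (u - s) = u by ring.
rewrite e2.
by move=> h; exact: esym h.
Qed.

Variable eps : R.
Hypothesis eps0 : 0 < eps.

Local Notation D := (first_visits eps gamma).

(** In this form the parameters of first visits are visibly an interval with left end [- eps]. *)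
Lemma first_visitsE t : D t <->
  - eps <= t <= eps /\ forall p, curve_period p -> t - p < - eps.
Proof.
rewrite /first_visits /= in_itv /=; split => -[tI h]; split => //.
- move=> p [p0 hp]; rewrite ltNge; apply/negP => le.
  apply: (h (t - p)) => //; first by rewrite ltrBlDr ltrDl.
  by have e := hp (t - p); rewrite subrK in e; exact: esym e.
- move=> s se st e; have := h _ (return_curve_period st e).
  by rewrite opprB addrCA subrr addr0; lra.
Qed.

Lemma first_visits_measurable : measurable D.
Proof.
apply: is_interval_measurable => x y /first_visitsE[/andP[x1 x2] hx].
move=> /first_visitsE[/andP[y1 y2] hy] z /andP[xz zy].
apply/first_visitsE; split; first by apply/andP; split; lra.
by move=> p /hy; lra.
Qed.

Lemma first_visits_le : (leb D <= (2 * eps)%:E)%E.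
Proof.
have sD : D `<=` `[- eps, eps] by move=> t [].
apply: (@le_trans _ _ (leb `[- eps, eps])).
  by apply: le_measure => //; rewrite inE//; exact: first_visits_measurable.
rewrite lebesgue_measure_itv /= lte_fin gtrN// -EFinB lee_fin; lra.
Qed.

(** Satisfied by the curves of the chain, as transition laws are probabilities. It rules out
    arbitrarily small periods, for which [D] would be null and the quotient 0. *)
Hypothesis mass1 : arc_uniform eps gamma setT = 1%E.

Let leb_fin : leb D \is a fin_num.
Proof.
rewrite ge0_fin_numE; last exact: measure_ge0.
by rewrite (le_lt_trans first_visits_le)// ltry.
Qed.

Let leb_gt0 : 0 < fine (leb D).
Proof.
rewrite lt_neqAle fine_ge0 ?measure_ge0// andbT; apply/eqP => h.
move: mass1; rewrite /arc_uniform -h invr0 mule0 => /eqP.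
by rewrite eqe eq_sym oner_eq0.
Qed.

Let arc_lower x y l A : measurable A -> x < y -> fine (leb D) <= l ->
  (forall t, x < t < y -> D t /\ A (gamma t)) ->
  (((y - x) / l)%:E <= arc_uniform eps gamma A)%E.
Proof.
move=> mA xy Dl h.
have hle : (leb `]x, y[ <= leb (D `&` gamma @^-1` A))%E.
  have mDA : measurable (D `&` gamma @^-1` A).
    apply: measurableI; first exact: first_visits_measurable.
    exact: gamma_measurable.
  have sub : `]x, y[ `<=` D `&` gamma @^-1` A by move=> t; rewrite /= in_itv => /h.
  by apply: le_measure => //; rewrite inE.
move: hle; rewrite lebesgue_measure_itv /= lte_fin xy -EFinB => hle.
apply: (@le_trans _ _ ((y - x)%:E * ((fine (leb D))^-1)%:E)%E).
  rewrite -EFinM lee_fin; apply: ler_wpM2l; first by rewrite subr_ge0 ltW.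
  by rewrite lef_pV2 ?posrE// (lt_le_trans leb_gt0).
by apply: lee_wpmul2r => //; rewrite lee_fin invr_ge0 ltW.
Qed.

(** The infimum of the periods is positive, since otherwise [D] would be a point. It is attained,
    since otherwise two distinct periods would lie closer together than the infimum, and their
    difference is a period. *)
Let least_period p0 : curve_period p0 ->
  exists tau, curve_period tau /\ forall p, curve_period p -> tau <= p.
Proof.
move=> hp0; pose E := [set p | curve_period p].
have hE : has_inf E by split; [exists p0 | exists 0 => p [/ltW]].
have lE p : E p -> inf E <= p by move=> Ep; apply: ge_inf => //; exact: hE.2.
have tau0 : 0 < inf E.
  rewrite ltNge; apply/negP => le0.
  have sD : D `<=` [set - eps].
    move=> t /first_visitsE[/andP[t1 _] h]; apply/eqP; rewrite eq_le t1 andbT.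
    rewrite leNgt; apply/negP => lt.
    have d0 : 0 < t + eps by lra.
    by have [p Ep hp] := inf_adherent d0 hE; have := h _ Ep; lra.
  have : (leb D <= leb [set (- eps)%R])%E.
    by apply: le_measure => //; rewrite inE//; exact: first_visits_measurable.
  rewrite lebesgue_measure_set1 -(fineK leb_fin) lee_fin.
  by move: leb_gt0; lra.
exists (inf E); split; last exact: lE.
have [p Ep hp] := inf_adherent tau0 hE.
have [->//|np] := eqVneq (inf E) p.
have lp : inf E < p by rewrite lt_neqAle np lE.
have d0 : 0 < p - inf E by lra.
have [p' Ep' hp'] := inf_adherent d0 hE.
have pp : p' < p by lra.
suff : inf E <= p - p' by have := lE _ Ep'; lra.
apply: lE; split; first lra.
move=> t; have [_ h1] := Ep; have [_ h2] := Ep'.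
by rewrite -h2 -[RHS]h1; congr (gamma _); ring.
Qed.

Let periodZ tau (j : int) t : curve_period tau ->
  gamma (t + j%:~R * tau) = gamma t.
Proof.
move=> [_ h]; have hn (n : nat) s : gamma (s + n%:R * tau) = gamma s.
  elim: n s => [|n IH] s; first by rewrite mul0r addr0.
  by rewrite -[n.+1]addn1 natrD mulrDl mul1r addrA h IH.
case: j => n; first exact: hn.
by rewrite NegzE mulrNz mulNr -[RHS](hn n.+1) -(hn n.+1 (t - _)) subrK.
Qed.

(* Only a constant is lost: an interval of parameters shorter than the period
   meets two translates of the parameters of first visits, and the longer of
   the two pieces has at least half its length. *)
Lemma arc_uniform_lower A (t1 t2 : R) : measurable A ->
  - eps <= t1 -> t1 < t2 -> t2 <= eps -> (forall t, t1 < t < t2 -> A (gamma t)) ->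
  (((t2 - t1) / (4 * eps))%:E <= arc_uniform eps gamma A)%E.
Proof.
move=> mA e1 t12 e2 hA.
have Dle : fine (leb D) <= 2 * eps.
  by rewrite -lee_fin fineK// first_visits_le.
have weaken (x l : R) : (t2 - t1) / (4 * eps) <= x / l ->
    ((x / l)%:E <= arc_uniform eps gamma A)%E ->
    (((t2 - t1) / (4 * eps))%:E <= arc_uniform eps gamma A)%E.
  by move=> xl; apply: le_trans; rewrite lee_fin.
have e4 : 0 < 4 * eps by lra.
have [[p0 hp0]|noper] := pselect (exists p, curve_period p); last first.
  apply: (weaken (t2 - t1) (2 * eps)).
    by rewrite ler_pdivrMr// mulrAC ler_pdivlMr; [nra|lra].
  apply: arc_lower => // t tt; split; last exact: hA.
  apply/first_visitsE; case/andP: tt => *; split; first by apply/andP; split; lra.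
  by move=> p hp; case: noper; exists p.
have [tau [ht tmin]] := least_period hp0; have [tau0 _] := ht.
have [teps|tle] := ltP (2 * eps) tau.
  apply: (weaken (t2 - t1) (2 * eps)).
    by rewrite ler_pdivrMr// mulrAC ler_pdivlMr; [nra|lra].
  apply: arc_lower => // t tt; split; last exact: hA.
  apply/first_visitsE; case/andP: tt => *; split; first by apply/andP; split; lra.
  by move=> p /tmin; lra.
have Dtau : fine (leb D) <= tau.
  have sD : D `<=` `[- eps, tau - eps].
    move=> t /first_visitsE[/andP[h1 _] /(_ _ ht) h2].
    by rewrite /= in_itv /= h1 /=; lra.
  rewrite -lee_fin fineK//; apply: (@le_trans _ _ (leb `[- eps, tau - eps])).
    by apply: le_measure => //; rewrite inE//; exact: first_visits_measurable.
  by rewrite lebesgue_measure_itv /= lte_fin ifT ?lerBlDr -?EFinB ?lee_fin; lra.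
have inD t : - eps < t -> t < tau - eps -> D t.
  move=> h1 h2; apply/first_visitsE; split; first by apply/andP; split; lra.
  by move=> p /tmin; lra.
(* An interval longer than a period is cut down to one period. *)
pose s2 := Num.min t2 (t1 + tau).
have s2t2 : s2 <= t2 by rewrite ge_min lexx.
have s2tau : s2 <= t1 + tau by rewrite ge_min lexx orbT.
have s2E : s2 = t2 \/ s2 = t1 + tau.
  by rewrite /s2 /Order.min; case: ifP; [left|right].
have t1s2 : t1 < s2 by case: s2E; lra.
have piece (j : int) (x y : R) : x < y -> t1 <= x -> y <= s2 -> - eps + j%:~R * tau <= x ->
    y <= - eps + j%:~R * tau + tau ->
    (s2 - t1) / 2 <= y - x ->
    (((t2 - t1) / (4 * eps))%:E <= arc_uniform eps gamma A)%E.
  move=> xy t1x ys2 jx yj half.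
  apply: (weaken (y - x) tau).
    rewrite ler_pdivrMr// mulrAC ler_pdivlMr//.
    (* If [s2 = t2] the bound follows from [tau <= 2 eps]; if [s2 = t1 + tau] the proportion is at
       least [1 / 2], and [t2 - t1 <= 2 eps]. *)
    case: s2E => hs; nra.
  have -> : y - x = (y - j%:~R * tau) - (x - j%:~R * tau) by ring.
  apply: arc_lower => //; first lra.
  move=> t /andP[h1 h2]; split; first by apply: inD; lra.
  by rewrite -(periodZ j t ht); apply: hA; apply/andP; split; lra.
have /andP[f1 f2] := real_floor_itv (num_real ((t1 + eps) / tau)).
set j := Num.floor _ in f1 f2.
move: f1 f2; rewrite ler_pdivlMr// ltr_pdivrMr// intrD mulrDl mul1r => f1 f2.
(* The right end of the translate of [[- eps, tau - eps[] that contains [t1]; the interval from [t1]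
   to [s2] crosses no other such end. *)
set bd := - eps + (j%:~R * tau + tau).
have [big|small] := leP s2 bd.
  by apply: (piece j t1 s2) => //; rewrite /bd in big *; lra.
have [h|h] := leP ((s2 - t1) / 2) (bd - t1).
  by apply: (piece j t1 bd) => //; rewrite /bd in small h *; lra.
apply: (piece (j + 1) bd s2) => //; rewrite /bd ?intrD in small h *; lra.
Qed.

End Arc.

(** * Bootstrapped constancy, injectivity, and the bump curves *)

Section LocallyConstant.
Variable R : realType.

(** The derivative is known to vanish only while [|K| <= b], which is part of what has to be shown.
    At the infimum of the times where [K] differs from [K 0] continuity still gives [|K| < b], hence
    a zero derivative for a little longer. *)
Lemma constant_below_level (K dK : R -> R) (T b : R) :
  (forall t, is_derive t (1 : R) K (dK t)) ->
  (forall t, 0 <= t <= T -> `|K t| <= b -> dK t = 0) -> `|K 0| < b ->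
  forall t, 0 <= t <= T -> K t = K 0.
Proof.
move=> KdK dK0 K0b t1 t1T; apply: contrapT => Kt1.
have cK : continuous K by move=> t; exact: is_derive_continuous (KdK t).
pose E := [set t | 0 <= t <= T /\ K t <> K 0].
have hE : has_inf E by split; [exists t1 | exists 0 => t [/andP[]]].
have i0 : 0 <= inf E by apply: lb_le_inf; [exact: hE.1 | move=> t [/andP[]]].
have iE t : E t -> inf E <= t by move=> Et; apply: ge_inf => //; exact: hE.2.
set i := inf E in i0 iE.
have iT : i <= T by have /iE := conj t1T Kt1 : E t1; case/andP: t1T; lra.
have Ki : K i = K 0.
  apply: contrapT => Ki.
  have ip : 0 < i.
    by rewrite lt_neqAle i0 andbT; apply/eqP => e; apply: Ki; rewrite -e.
  have d0 : 0 < `|K i - K 0| by rewrite normr_gt0 subr_eq0; exact/eqP.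
  have /cvgrPdist_lt/(_ _ d0)/nbhs_ballP[r /= r0 hr] := cK i.
  pose s := Num.max 0 (i - r / 2).
  have s0 : 0 <= s by rewrite le_max lexx.
  have si : s < i by rewrite gt_max ip /=; lra.
  have sr : i - r / 2 <= s by rewrite le_max lexx orbT.
  have /hr : ball i r s by rewrite /ball /= ger0_norm ?subr_ge0 ?ltW//; lra.
  move=> h; have : E s.
    split; first by apply/andP; split; lra.
    by move=> e; move: h; rewrite /= e ltxx.
  by move=> /iE; lra.
have d0 : 0 < b - `|K i| by rewrite Ki; lra.
have /cvgrPdist_lt/(_ _ d0)/nbhs_ballP[r /= r0 hr] := cK i.
have [t2 Et2 t2r] := inf_adherent r0 hE; rewrite -/i in t2r.
have it2 := iE _ Et2.
have cKi : {within `[i, t2], continuous K} by exact: continuous_subspaceT.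
have [c /[!in_itv]/= /andP[c1 c2] hc] := MVT_segment it2 (fun t _ => KdK t) cKi.
case: Et2 => /andP[t20 t2T] []; rewrite -Ki.
apply/subr0_eq; rewrite hc (dK0 c) ?mul0r//; first by apply/andP; split; lra.
have /hr h : ball i r c by rewrite /ball /= distrC ger0_norm ?subr_ge0//; lra.
have := ler_normD (K i) (K c - K i); rewrite addrC subrK.
by move: h; rewrite /= distrC; lra.
Qed.

Lemma derive_bounded_segment (f df : R -> R) (K e : R) :
  (forall t, is_derive t (1 : R) f (df t)) ->
  (forall t, - e <= t <= e -> `|df t| <= K) ->
  forall s t, - e <= s <= e -> - e <= t <= e -> `|f s - f t| <= K * `|s - t|.
Proof.
move=> fdf dfK s t.
wlog st : s t / s <= t => [H|].
  have [/H//|/ltW/H h] := leP s t; rewrite distrC (distrC s) => hs ht.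
  exact: h.
move=> /andP[s1 s2] /andP[t1 t2].
have cf : {within `[s, t], continuous f}.
  apply: continuous_subspaceT => u; exact: is_derive_continuous (fdf u).
have [c /[!in_itv]/= /andP[c1 c2] hc] := MVT_segment st (fun u _ => fdf u) cf.
rewrite distrC hc normrM (distrC s) ler_wpM2r// dfK//.
by apply/andP; split; lra.
Qed.

Lemma derive_neq0_inj (f df : R -> R) (e : R) :
  (forall t, is_derive t (1 : R) f (df t)) ->
  (forall t, - e <= t <= e -> df t != 0) ->
  forall s t, - e <= s -> s < t -> t <= e -> f s <> f t.
Proof.
move=> fdf df0 s t s1 st t2 fst.
have cf : {within `[s, t], continuous f}.
  apply: continuous_subspaceT => u; exact: is_derive_continuous (fdf u).
have [c /[!in_itv]/= /andP[c1 c2] hc] := MVT_segment (ltW st) (fun u _ => fdf u) cf.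
move/eqP: hc; rewrite fst subrr eq_sym mulf_eq0 subr_eq0 (gt_eqF st) orbF.
by apply/negP/df0/andP; split; lra.
Qed.

Lemma uniform_probE (a b : R) (ab : a < b) (U : set R) : measurable U ->
  uniform_prob ab U = (lebesgue_measure (`[a, b] `&` U) * ((b - a)^-1)%:E)%E.
Proof.
move=> mU; rewrite /uniform_prob integral_uniform_pdf.
rewrite (eq_integral (fun=> (b - a)^-1%:E)); last first.
  by move=> x; rewrite inE /= in_itv /= /uniform_pdf => -[_ ->].
rewrite integral_cst; first by rewrite muleC setIC.
exact: measurableI.
Qed.

Lemma is_derive_bump (K sigma x : R) : sigma != 0 ->
  is_derive x (1 : R) (bump K sigma) (- (x / sigma ^+ 2) * bump K sigma x).
Proof.
move=> s0.
have h1 : is_derive x (1 : R) (fun t : R => - (t ^+ 2 / (2 * sigma ^+ 2)))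
    (- (x / sigma ^+ 2)).
  apply: is_derive_congr (is_deriveM (is_derive_cst (- (2 * sigma ^+ 2)^-1) x (1 : R))
    (is_deriveM (is_derive_id x (1 : R)) (is_derive_id x (1 : R)))) _ _.
    by move=> t; rewrite /cst /= mulNr mulrC expr2.
  by rewrite /cst /GRing.scale /=; field.
have h2 := is_derive1_comp (f := expR)
  (g := fun t : R => - (t ^+ 2 / (2 * sigma ^+ 2))) (is_derive_expR _) h1.
apply: is_derive_congr (is_deriveM (is_derive_cst K x (1 : R)) h2) _ _ => //.
by rewrite /bump /cst /GRing.scale /=; ring.
Qed.

Lemma derive1_bump (K sigma x : R) : sigma != 0 ->
  derive1 (bump K sigma) x = - (x / sigma ^+ 2) * bump K sigma x.
Proof.
by move=> /(is_derive_bump K x) h; rewrite derive1E; exact: derive_val.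
Qed.

End LocallyConstant.

(** * Arcs that start near the segment *)

Section NearSegment.
Variable R : realType.
Variables (eps b sigma a : R) (V : torus R -> R * R).
Hypothesis heps : 0 < eps.
Hypothesis hb : 0 < b.
Hypothesis hsigma : 0 < sigma.
Hypothesis V_smooth : smooth_field V.
Hypothesis V_unit : unit_field V.
Hypothesis V_W : tangent_to_bumps V sigma (bump_region a b sigma).

Local Notation W := (bump_region a b sigma).
Local Notation vf := (lift_field V).

Let sigma_neq0 : sigma != 0. Proof. by rewrite gt_eqF. Qed.

Lemma bump_scale (K c x : R) : bump (c * K) sigma x = c * bump K sigma x.
Proof. by rewrite /bump mulrA. Qed.

Lemma bump1_gt0 x : 0 < bump 1 sigma x.
Proof. by rewrite /bump mul1r expR_gt0. Qed.

Lemma bumpE K x : bump K sigma x = K * bump 1 sigma x.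
Proof. by rewrite -bump_scale mulr1. Qed.

(** Each point lies on the curve with [K = y / bump 1 sigma x], whose slope there is
    [- (x / sigma^2) y], an expression free of [K]. *)
Lemma field_slope z : W z ->
  dot (V (chart z)) (e_u R) =
    - (z.1 / sigma ^+ 2) * z.2 * dot (V (chart z)) (e_s R).
Proof.
case: z => x y Wz /=.
have zE : y = bump (y / bump 1 sigma x) sigma x.
  by rewrite bumpE divfK// gt_eqF// bump1_gt0.
have Wz' : W (x, bump (y / bump 1 sigma x) sigma x) by rewrite -zE.
have := V_W Wz'; rewrite derive1_bump//.
by rewrite /= -zE.
Qed.

Lemma field_sqr p : dot (V p) (e_s R) ^+ 2 + dot (V p) (e_u R) ^+ 2 = 1.
Proof. by rewrite -dot_sqr_frame V_unit. Qed.

(** A zero stable component would force a zero unstable one by the slope, against the unit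
    length. *)
Lemma field_es_neq0 z : W z -> dot (V (chart z)) (e_s R) != 0.
Proof.
move=> Wz; apply/eqP => e; have := field_sqr (chart z).
by rewrite (field_slope Wz) e mulr0 expr0n addr0 => /eqP; rewrite eq_sym oner_eq0.
Qed.

Section Coordinates.
Variable c : R -> R * R.
Hypothesis sc : solution vf c.

Let X t := dot (c t) (e_s R).
Let Y t := dot (c t) (e_u R).
Let dX t := dot (vf (c t)) (e_s R).
Let dY t := dot (vf (c t)) (e_u R).

Lemma solution_derive_dot (e : R * R) t :
  is_derive t (1 : R) (fun s => dot (c s) e) (dot (vf (c t)) e).
Proof.
have [h1 h2] := sc t.
apply: is_derive_congr (is_deriveD (is_deriveM h1 (is_derive_cst e.1 t (1 : R)))
  (is_deriveM h2 (is_derive_cst e.2 t (1 : R)))) _ _ => //.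
by rewrite /dot /cst /GRing.scale /=; ring.
Qed.

Let XdX t : is_derive t (1 : R) X (dX t). Proof. exact: solution_derive_dot. Qed.
Let YdY t : is_derive t (1 : R) Y (dY t). Proof. exact: solution_derive_dot. Qed.

Lemma proj_solutionE t : proj (c t) = chart (X t, Y t).
Proof. by rewrite /chart -/(frame _) frame_dot. Qed.

Lemma solution_dX_le1 t : `|dX t| <= 1.
Proof.
have := field_sqr (proj (c t)); rewrite -/(vf (c t)) -/(dX t) -/(dY t) => h.
by rewrite ler_norml; have := sqr_ge0 (dY t); move=> ?; apply/andP; split; nra.
Qed.

Lemma solution_X_dist s t : `|X s - X t| <= `|s - t|.
Proof.
rewrite -[leRHS]mul1r.
exact: (derive_bounded_lipschitz XdX solution_dX_le1).
Qed.

(** The label of the bump curve through [c t], a first integral of [V] as long as the arc is in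
    [W]. *)
Let K t := Y t / bump 1 sigma (X t).

Let KE t : Y t = bump (K t) sigma (X t).
Proof. by rewrite bumpE divfK// gt_eqF// bump1_gt0. Qed.

Let dK t := (dY t + X t / sigma ^+ 2 * Y t * dX t) / bump 1 sigma (X t).

Let KdK t : is_derive t (1 : R) K (dK t).
Proof.
have hb1 := is_derive1_comp (is_derive_bump 1 (X t) sigma_neq0) (XdX t).
have n0 : bump 1 sigma (X t) != 0 by rewrite gt_eqF// bump1_gt0.
have hV := is_deriveV (f := bump 1 sigma \o X) n0 hb1.
apply: is_derive_congr (is_deriveM (YdY t) hV) _ _ => //.
rewrite /dK /GRing.scale /=; field.
by rewrite n0 sigma_neq0.
Qed.

Let dK0 t : `|X t| <= a -> `|K t| <= b -> dK t = 0.
Proof.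
move=> Xa Kb.
have Wt : W (X t, Y t).
  split=> //=; rewrite KE bumpE normrM (gtr0_norm (bump1_gt0 _)) [leRHS]bumpE.
  by rewrite ler_wpM2r// ltW// bump1_gt0.
have /= := field_slope Wt; rewrite -proj_solutionE -/(vf (c t)) -/(dX t) -/(dY t).
by rewrite /dK => ->; rewrite mulNr mulNr addNr mul0r.
Qed.

(** At unit speed the arc cannot pass the sides [x = +-a] within time [eps], and the constancy of
    the label keeps it below the upper and above the lower boundary of [W]. Negative times are
    treated by reversing the curve. *)
Lemma solution_follows_bump : `|X 0| + eps <= a -> `|K 0| < b ->
  forall t, - eps <= t <= eps ->
    [/\ `|X t| <= a, W (X t, Y t) & Y t = bump (K 0) sigma (X t)].
Proof.
move=> X0 K0 t te.
have Xa s : - eps <= s <= eps -> `|X s| <= a.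
  move=> se; have := solution_X_dist s 0; rewrite subr0.
  have : `|s| <= eps by rewrite ler_norml.
  have := ler_normD (X 0) (X s - X 0); rewrite addrC subrK.
  by lra.
have KN s : is_derive s (1 : R) (fun r => K (- r)) (- dK (- s)).
  apply: is_derive_congr (is_derive1_comp (f := K) (g := fun r => -1 * r + 0)
    (KdK _) (is_derive_affine s (-1) 0)) _ _.
  - by move=> r /=; rewrite addr0 mulN1r.
  - by rewrite addr0 mulN1r mulrN1.
have Kt : K t = K 0.
  case/andP: te => t1 t2; have [t0|t0] := leP 0 t.
    apply: (constant_below_level (T := eps) KdK _ K0); last by apply/andP; split.
    by move=> s /andP[s0 s1]; apply: dK0; apply: Xa; apply/andP; split; lra.
  have := @constant_below_level _ (fun r => K (- r)) (fun s => - dK (- s)) eps b KN.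
  rewrite oppr0 => /(_ _ K0 (- t)); rewrite opprK; apply; last first.
    by apply/andP; split; lra.
  move=> s /andP[s0 s1] hs; rewrite dK0 ?oppr0//.
  by apply: Xa; apply/andP; split; lra.
split; [exact: Xa | | by rewrite KE Kt].
split=> /=; first exact: Xa.
rewrite KE Kt bumpE normrM (gtr0_norm (bump1_gt0 _)) [leRHS]bumpE.
by rewrite ler_wpM2r// ltW// bump1_gt0.
Qed.

End Coordinates.

(** [V] may run along the segment in either direction, so the arc parameter moves [x] forwards or
    backwards. *)
Definition stable_sign : R := Num.sg (dot (V (chart (0, 0))) (e_s R)).

Lemma chart_ray_continuous (z : R * R) :
  continuous (fun t : R => dot (V (chart (t * z.1, t * z.2))) (e_s R)).
Proof.
have [/(_ 0%N)[c1 _] /(_ 0%N)[c2 _]] := V_smooth.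
have cp : continuous (fun t : R => t *: frame z).
  by move=> t; apply: cvgZr_tmp; exact: cvg_id.
have e t : chart (t * z.1, t * z.2) = proj (t *: frame z).
  by rewrite /chart /frame /= scalerDr !scalerA.
have -> : (fun t : R => dot (V (chart (t * z.1, t * z.2))) (e_s R)) =
    fun t => (V (proj (t *: frame z))).1 * (e_s R).1 +
             (V (proj (t *: frame z))).2 * (e_s R).2.
  by apply/funext => t; rewrite e.
have k1 : continuous (fun t : R => (V (proj (t *: frame z))).1).
  move=> t; apply: (@continuous_comp _ _ _ (fun t : R => t *: frame z)
    (fun w => (V (proj w)).1)); [exact: cp | exact: c1].
have k2 : continuous (fun t : R => (V (proj (t *: frame z))).2).
  move=> t; apply: (@continuous_comp _ _ _ (fun t : R => t *: frame z)
    (fun w => (V (proj w)).2)); [exact: cp | exact: c2].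
move=> t; apply: cvgD; apply: cvgM; try exact: cvg_cst.
- exact: k1.
- exact: k2.
Qed.

Lemma bump1_le (x y : R) : `|x| <= `|y| -> bump 1 sigma y <= bump 1 sigma x.
Proof.
move=> xy; rewrite /bump !mul1r ler_expR lerN2 ler_pM2r; last first.
  by rewrite invr_gt0 mulr_gt0// exprn_gt0.
by rewrite -(real_normK (num_real x)) -(real_normK (num_real y)) ler_pXn2r ?nnegrE.
Qed.

Lemma W_ray z t : W z -> 0 <= t <= 1 -> W (t * z.1, t * z.2).
Proof.
case: z => x y [/= Wx Wy] /andP[t0 t1].
have tx : `|t * x| <= `|x| by rewrite normrM ger0_norm//; have := normr_ge0 x; nra.
have ty : `|t * y| <= `|y| by rewrite normrM ger0_norm//; have := normr_ge0 y; nra.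
split=> /=; first exact: le_trans tx Wx.
apply: le_trans ty (le_trans Wy _); rewrite bumpE [leRHS]bumpE.
by rewrite ler_wpM2l ?(ltW hb)// bump1_le.
Qed.

(** [W] is star-shaped about the fixed point: a change of sign would produce, on the ray to [z], a
    zero of the stable component. *)
Lemma field_es_sign z : W z -> 0 < stable_sign * dot (V (chart z)) (e_s R).
Proof.
move=> Wz; pose g (t : R) := dot (V (chart (t * z.1, t * z.2))) (e_s R).
have g0E : g 0 = dot (V (chart (0, 0))) (e_s R) by rewrite /g !mul0r.
have g1E : g 1 = dot (V (chart z)) (e_s R) by rewrite /g !mul1r; case: (z).
have gn0 t : 0 <= t <= 1 -> g t != 0.
  by move=> t01; apply: field_es_neq0; exact: W_ray.
rewrite /stable_sign -g0E -g1E ltNge; apply/negP => h.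
have cg : {within `[0, 1], continuous g}.
  by apply: continuous_subspaceT; exact: chart_ray_continuous.
have hv : Num.min (g 0) (g 1) <= 0 <= Num.max (g 0) (g 1).
  have z01 : 0 <= (0 : R) <= 1 by rewrite lexx /=.
  case: (ltgtP (g 0) 0) h (gn0 0 z01) => [h0|h0|h0] h; last by move=> /eqP.
  - move: h; rewrite ltr0_sg// mulN1r oppr_le0 => h _.
    by rewrite ge_min le_max h (ltW h0) orbT.
  - move: h; rewrite gtr0_sg// mul1r => h _.
    by rewrite ge_min le_max h (ltW h0) orbT.
have [c] := IVT ler01 cg hv.
by rewrite in_itv /= => /gn0 /eqP.
Qed.

Variable (F : R.-pker torus R ~> torus R).
Hypothesis ha : a = eps / (1 - cat_mu R).
Hypothesis U_embeds : {in W &, injective (@chart R)}.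
Hypothesis F_perturb : random_perturbation (@cat_map R) V eps F.

Local Notation mu := (cat_mu R).
Local Notation lambda := (cat_lambda R).

(** The reason for the value of [a]: contraction by [mu] followed by a spread of [eps] maps
    [[-a, a]] exactly onto itself. *)
Lemma eps_mu_a : mu * a + eps = a.
Proof.
rewrite ha; have /andP[m0 m1] := cat_mu_bounds R.
by field; apply/eqP; lra.
Qed.

Lemma a_gt0 : 0 < a.
Proof.
by have /andP[m0 m1] := cat_mu_bounds R; rewrite ha divr_gt0// subr_gt0; lra.
Qed.

Lemma W_axis x : `|x| <= a -> W (x, 0).
Proof.
by split=> //=; rewrite normr0 bumpE mulr_ge0// ltW// bump1_gt0.
Qed.

Lemma stable_signE : stable_sign = 1 \/ stable_sign = -1.
Proof.
have W0 : W (0, 0) by apply: W_axis; rewrite normr0 ltW// a_gt0.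
have := field_es_sign W0; rewrite /stable_sign.
by case: sgrP; [rewrite mul0r ltxx | left | right].
Qed.

Lemma eps_itv : - eps < eps. Proof. by rewrite gtrN. Qed.

(** Chosen so that after the expansion by [lambda] the label of the arc is at most [b / 2] in
    absolute value. *)
Definition strip_height : R := b * bump 1 sigma a / (2 * lambda).

Lemma strip_height_gt0 : 0 < strip_height.
Proof.
have /andP[l0 l1] := cat_lambda_bounds R.
apply: divr_gt0; last lra.
by apply: mulr_gt0 => //; exact: bump1_gt0.
Qed.

Lemma perturbation_curve z : exists c : R -> R * R,
  [/\ solution vf c, c 0 = frame (mu * z.1, lambda * z.2) &
   forall A, measurable A -> F (chart z) A = arc_uniform eps (@proj R \o c) A].
Proof.
have [c ic hc] := F_perturb (chart z).
have [] := ic; rewrite cat_map_chart => /proj_eq_lat[m [n e]] _.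
exists (fun t => c t + lat R (- m) (- n)); split.
- exact: solution_lat (integral_curve_solution ic).
- by rewrite e -addrA; congr pair; rewrite /= mulrNz subrr addr0.
- move=> A mA; rewrite hc//; congr arc_uniform.
  by apply/funext => t /=; rewrite proj_lat.
Qed.

(* Near the segment the arc never leaves [W], and is not closed because [X] is
   monotone along it. *)
Lemma near_segment_kernel x y : `|x| <= a -> `|y| <= strip_height ->
  exists xi : R -> R, exists gamma : R -> torus R,
  [/\ continuous gamma,
      forall t, - eps <= t <= eps -> `|xi t| <= a /\
       `|xi t - (mu * x + stable_sign * t)| <= a / sigma ^+ 2 * eps * lambda
           / bump 1 sigma a * `|y|,
      forall t, - eps <= t <= eps -> gamma t =
        chart (xi t, bump (lambda * y / bump 1 sigma (mu * x)) sigma (xi t)) &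
      forall A, measurable A ->
        F (chart (x, y)) A = uniform_prob eps_itv (gamma @^-1` A)].
Proof.
move=> xa yd.
have /andP[m0 m1] := cat_mu_bounds R; have /andP[l0 l1] := cat_lambda_bounds R.
have a0 := a_gt0.
have [c [sc c0 Fc]] := perturbation_curve (x, y).
pose X t := dot (c t) (e_s R); pose Y t := dot (c t) (e_u R).
have X0 : X 0 = mu * x by rewrite /X c0 dot_frame_es.
have Y0 : Y 0 = lambda * y by rewrite /Y c0 dot_frame_eu.
pose K0 := lambda * y / bump 1 sigma (mu * x).
have bx := bump1_gt0 (mu * x); have ba := bump1_gt0 a.
have bxa : bump 1 sigma a <= bump 1 sigma (mu * x).
  have amu : `|mu| = mu by rewrite ger0_norm; lra.
  apply: bump1_le; rewrite normrM amu (gtr0_norm a0).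
  by have := normr_ge0 x; nra.
have K0le : `|K0| <= lambda / bump 1 sigma a * `|y|.
  have al : `|lambda| = lambda by rewrite ger0_norm; lra.
  rewrite /K0 normrM normfV (gtr0_norm bx) (normrM lambda) al.
  rewrite mulrAC; apply: ler_wpM2r => //; apply: ler_wpM2l; first lra.
  by rewrite lef_pV2 ?posrE.
have K0b : `|K0| < b.
  apply: le_lt_trans K0le _.
  apply: (@le_lt_trans _ _ (lambda / bump 1 sigma a * strip_height)).
    by apply: ler_wpM2l => //; rewrite divr_ge0 ?ltW//; lra.
  have -> : lambda / bump 1 sigma a * strip_height = b / 2.
    by rewrite /strip_height; field; rewrite !gt_eqF//; lra.
  by have := hb; lra.
have X0a : `|X 0| + eps <= a.
  rewrite X0 normrM (_ : `|mu| = mu); last by rewrite ger0_norm; lra.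
  by have := eps_mu_a; have := normr_ge0 x; nra.
have K0b' : `|Y 0 / bump 1 sigma (X 0)| < b by rewrite X0 Y0.
have follow := solution_follows_bump sc X0a K0b'.
rewrite -/(X 0) -/(Y 0) X0 Y0 -/K0 in follow.
have XdX := solution_derive_dot sc (e_s R).
have Wc t : - eps <= t <= eps -> W (X t, Y t) by move=> /follow[].
have projE t : proj (c t) = chart (X t, Y t) by exact: proj_solutionE.
have signX t : - eps <= t <= eps -> 0 < stable_sign * dot (vf (c t)) (e_s R).
  by move=> /Wc /field_es_sign; rewrite -projE.
exists X, (@proj R \o c); split.
- move=> t; apply: continuous_comp; last exact: proj_continuous.
  exact: (@solution_curve_continuous _ _ _ sc t).
- move=> t te; split; first by have [] := follow t te.
  have hd s : - eps <= s <= eps ->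
      `|dot (vf (c s)) (e_s R) - stable_sign|
        <= a / sigma ^+ 2 * lambda / bump 1 sigma a * `|y|.
    move=> se; set dX := dot _ _; pose dY := dot (vf (c s)) (e_u R).
    have sq : dX ^+ 2 + dY ^+ 2 = 1 by exact: field_sqr.
    have dYE : dY = - (X s / sigma ^+ 2) * Y s * dX.
      by have := field_slope (Wc s se); rewrite -projE.
    have dXle : `|dX| <= 1 by exact: solution_dX_le1.
    have [Xa _ YE] : [/\ `|X s| <= a, W (X s, Y s) & Y s = bump K0 sigma (X s)].
      exact: follow.
    have Yle : `|Y s| <= `|K0|.
      rewrite YE bumpE normrM -[leRHS]mulr1 ler_wpM2l//.
      rewrite gtr0_norm ?bump1_gt0// /bump mul1r -[leRHS]expR0 ler_expR oppr_le0.
      by rewrite divr_ge0 ?sqr_ge0// mulr_ge0// sqr_ge0.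
    have s2 : 0 < sigma ^+ 2 by rewrite exprn_gt0.
    have dYle : `|dY| <= a / sigma ^+ 2 * `|K0|.
      rewrite dYE normrM (normrM _ (Y s)) normrN (normrM (X s)) normfV (gtr0_norm s2).
      have XY0 : 0 <= `|X s| / sigma ^+ 2 by rewrite divr_ge0// ltW.
      rewrite -[leRHS]mulr1; apply: ler_pM => //; first by rewrite mulr_ge0.
      by apply: ler_pM => //; rewrite ler_pM2r ?invr_gt0.
    (* [1 - |dX| <= 1 - dX^2 = dY^2 <= |dY|], and [dX] has the sign [stable_sign]. *)
    apply: (@le_trans _ _ `|dY|); last first.
      apply: le_trans dYle _.
      have -> : a / sigma ^+ 2 * lambda / bump 1 sigma a * `|y| =
          a / sigma ^+ 2 * (lambda / bump 1 sigma a * `|y|) by ring.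
      by apply: ler_wpM2l K0le; rewrite divr_ge0// ltW.
    have dY1 : `|dY| <= 1.
      by rewrite ler_norml; have := sqr_ge0 dX; move=> ?; apply/andP; split; nra.
    have dYn : `|dY| ^+ 2 = dY ^+ 2 by rewrite real_normK// num_real.
    have := signX s se; rewrite -/dX => sX.
    have dXn := ler_norm dX; have dXn' := ler_norm (- dX); rewrite normrN in dXn'.
    have dY0 := normr_ge0 dY.
    case: stable_signE sX => ->; rewrite ?mul1r ?mulN1r => sX;
      rewrite ler_norml; apply/andP; split; nra.
  pose g s := X s - stable_sign * s.
  have gd s : is_derive s (1 : R) g (dot (vf (c s)) (e_s R) - stable_sign).
    apply: is_derive_congr (is_deriveB (XdX s)
      (is_derive_affine s stable_sign 0)) _ _ => //.
    by move=> r; rewrite /g -[stable_sign * r]addr0.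
  have zI : - eps <= 0 <= eps by apply/andP; split; lra.
  have := derive_bounded_segment gd hd te zI.
  rewrite /g X0 subr0 mulr0 subr0 => h.
  rewrite opprD addrA -addrAC; apply: le_trans h _.
  have te' : `|t| <= eps by rewrite ler_norml.
  have B0 : 0 <= a / sigma ^+ 2 * lambda / bump 1 sigma a * `|y|.
    by rewrite !mulr_ge0 ?invr_ge0 ?sqr_ge0 ?(ltW ba) ?(ltW a0)//; lra.
  apply: le_trans (ler_wpM2l B0 te') _.
  by rewrite le_eqVlt; apply/orP; left; apply/eqP; ring.
- by move=> t te; have [_ _ <-] := follow t te; rewrite /= projE.
- move=> A mA; rewrite Fc// uniform_probE; last exact: (gamma_measurable sc).
  have fvE : first_visits eps (@proj R \o c) = `[- eps, eps]%classic.
    apply/seteqP; split; first by move=> t [].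
    move=> t; rewrite /= in_itv /= => te; split; first by rewrite in_itv.
    move=> s s1 st; rewrite /= !projE => /U_embeds; rewrite !inE => e.
    have se : - eps <= s <= eps by apply/andP; split; lra.
    have [] := e (Wc s se) (Wc t te) => eX _.
    have df0 r : - eps <= r <= eps -> dot (vf (c r)) (e_s R) != 0.
      by move=> /Wc /field_es_neq0; rewrite -projE.
    case/andP: te => t1 t2.
    exact: (derive_neq0_inj XdX df0 s1 st t2 eX).
  rewrite /arc_uniform fvE; congr (_ * (_^-1)%:E)%E.
  by rewrite lebesgue_measure_itv /= lte_fin eps_itv.
Qed.
End NearSegment.

(** * Averages over a uniformly distributed arc parameter *)

Section UniformAverages.
Variable R : realType.
Variables (e : R) (ee : - e < e).
Local Notation I := (`[- e, e]%classic : set R).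

(** [uniform_prob] registered again as a measure on [R] itself, so that curves [R -> torus R] can be
    composed with it. *)
Definition uniform_law (A : set R) : \bar R := uniform_prob ee A.

HB.instance Definition _ := isMeasure.Build _ R R uniform_law
  (measure0 (uniform_prob ee)) (measure_ge0 (uniform_prob ee))
  (@measure_semi_sigma_additive _ _ _ (uniform_prob ee)).
HB.instance Definition _ := Measure_isProbability.Build _ R R uniform_law
  (probability_setT (uniform_prob ee)).

Lemma integral_uniform_law (f : R -> \bar R) : measurable_fun setT f ->
  (forall x, 0 <= f x)%E ->
  (\int[uniform_law]_x f x =
   (e - - e)^-1%:E * \int[lebesgue_measure]_(x in I) f x)%E.
Proof.
move=> mf f0; rewrite -(integral_uniform ee mf f0).
have mid : measurable_fun setT (id : measurableTypeR R -> R).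
  by move=> _ B mB; rewrite setTI.
transitivity (\int[pushforward (uniform_prob ee)
    (id : measurableTypeR R -> R)]_x f x)%E.
  by apply: eq_measure_integral => A mA _.
by rewrite ge0_integral_pushforward.
Qed.

Local Notation U := uniform_law.
Implicit Types (f h : R -> R).

Lemma uniform_prob_itvC : U (~` I) = 0%E.
Proof.
rewrite /uniform_law /= uniform_probE; last exact: measurableC.
by rewrite setICr measure0 mul0e.
Qed.

Lemma Rintegral_uniform_itv f : bmf f -> \int[U]_t f t = \int[U]_(t in I) f t.
Proof.
move=> bf; have mIC : measurable (~` I) by exact: measurableC.
by rewrite (Rintegral_null measurableT mIC bf uniform_prob_itvC) setTD setCK.
Qed.

Lemma le_Rintegral_uniform f h : bmf f -> bmf h ->
  (forall t, - e <= t <= e -> f t <= h t) -> \int[U]_t f t <= \int[U]_t h t.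
Proof.
move=> bf bh fh; rewrite !Rintegral_uniform_itv//.
have mI : measurable I by [].
by apply: le_Rintegral => //; exact: bmf_integrable.
Qed.

Lemma Rintegral_uniform_cst c : \int[U]_t c = c.
Proof. by rewrite Rintegral_cst// (congr1 fine (probability_setT U)) mulr1. Qed.

Let e0 : 0 < e.
Proof. by have := ee; rewrite -subr_gt0 opprK -mulr2n pmulrn_lgt0. Qed.

(** The indicator makes the square bounded on the whole line. *)
Lemma bmf_sqr_affine m s : s = 1 \/ s = -1 ->
  bmf (fun t : R => \1_I t * (m + s * t) ^+ 2).
Proof.
move=> s1; split.
  apply: measurable_funM; first exact: measurable_indic.
  apply: measurable_funX; apply: measurable_funD; first exact: measurable_cst.
  by apply: measurable_funM; [exact: measurable_cst | exact: measurable_id].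
exists ((`|m| + e) ^+ 2) => t; rewrite indicE.
have [|_] := boolP (t \in I); last by rewrite mul0r normr0 sqr_ge0.
rewrite inE /= in_itv /= => te; rewrite mul1r normrX.
rewrite ler_pXn2r ?nnegrE ?addr_ge0// ?(ltW e0)//.
rewrite (le_trans (ler_normD _ _))// lerD2l normrM.
by case: s1 => ->; rewrite ?normrN normr1 mul1r ler_norml.
Qed.

Lemma uniform_second_moment m s : s = 1 \/ s = -1 ->
  \int[U]_t (\1_I t * (m + s * t) ^+ 2) = m ^+ 2 + e ^+ 2 / 3.
Proof.
move=> s1; have [mq _] := bmf_sqr_affine m s1.
rewrite /Rintegral integral_uniform_law; last 2 first.
- exact/measurable_EFinP.
- by move=> t; rewrite lee_fin mulr_ge0 ?sqr_ge0// indicE; case: (_ \in _).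
pose q (t : R) := (m + s * t) ^+ 2.
pose Q (t : R) := s * (m + s * t) ^+ 3 / 3.
have s2 : s * s = 1 by case: s1 => ->; ring.
have Qq t : is_derive t (1 : R) Q (q t).
  have h := is_derive_affine t s m.
  apply: is_derive_congr (is_deriveM (is_derive_cst (s / 3) t (1 : R))
    (is_deriveM h (is_deriveM h h))) _ _.
    move=> r; rewrite -[LHS]/(s / 3 * ((s * r + m) * ((s * r + m) * (s * r + m)))).
    by rewrite /Q; ring.
  rewrite /cst ?mulrfctE /GRing.scale /= /q.
  transitivity ((s * s) * (m + s * t) ^+ 2); last by rewrite s2 mul1r.
  by field.
have cq : continuous q.
  by move=> t; apply: (@is_derive_continuous _ q t (2 * s * (m + s * t)));
    have h := is_derive_affine t s m; apply: is_derive_congr (is_deriveM h h) _ _;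
    [move=> r; rewrite -[LHS]/((s * r + m) * (s * r + m)) /q; ring
    | rewrite /GRing.scale /=; ring].
have cQ : continuous Q by move=> t; exact: is_derive_continuous (Qq t).
have -> : (\int[lebesgue_measure]_(x in I) (\1_I x * (m + s * x) ^+ 2)%:E =
    \int[lebesgue_measure]_(x in I) (q x)%:E)%E.
  by apply: eq_integral => t tI; rewrite indicE tI mul1r.
rewrite (@continuous_FTC2 _ q Q (- e) e) //; first last.
- by move=> t _; rewrite derive1E; exact: derive_val.
- split.
  + by move=> t _; exact: ex_derive.
  + by apply: cvg_at_right_filter; exact: cQ.
  + by apply: cvg_at_left_filter; exact: cQ.
- exact: continuous_subspaceT.
rewrite -EFinB -EFinM /= /Q opprK.
have s3 : s ^+ 2 = 1 by rewrite expr2.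
transitivity ((s ^+ 2) * m ^+ 2 + (s ^+ 2) ^+ 2 * (e ^+ 2 / 3)).
  by rewrite -mulr2n -mulr_natl; field; rewrite gt_eqF.
by rewrite s3; ring.
Qed.

End UniformAverages.

(** * The Markov operator near the segment *)

Section NearSegmentAverages.
Variable R : realType.
Variables (eps b sigma a : R) (V : torus R -> R * R).
Hypothesis heps : 0 < eps.
Hypothesis hb : 0 < b.
Hypothesis hsigma : 0 < sigma.
Hypothesis V_smooth : smooth_field V.
Hypothesis V_unit : unit_field V.
Hypothesis V_W : tangent_to_bumps V sigma (bump_region a b sigma).
Variable (F : R.-pker torus R ~> torus R).
Hypothesis ha : a = eps / (1 - cat_mu R).
Hypothesis U_embeds : {in bump_region a b sigma &, injective (@chart R)}.
Hypothesis F_perturb : random_perturbation (@cat_map R) V eps F.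

Local Notation mu := (cat_mu R).
Local Notation lambda := (cat_lambda R).
Local Notation d0 := (strip_height b sigma a).
Local Notation s0 := (stable_sign V).
Local Notation U := (uniform_law (eps_itv heps)).
Local Notation Cerr := (a / sigma ^+ 2 * eps * lambda / bump 1 sigma a).

Lemma bmf_curve (g : torus R -> R) (gamma : R -> torus R) : continuous gamma ->
  bmf g -> bmf (g \o gamma).
Proof.
move=> cg [mg [M gM]]; split; last by exists M => t; exact: gM.
apply: measurableT_comp => //; move=> _ A mA; rewrite setTI.
exact: continuous_curve_measurable.
Qed.

Lemma near_segment_kint x y : `|x| <= a -> `|y| <= d0 ->
  exists xi : R -> R, exists gamma : R -> torus R,
  [/\ continuous gamma,
      forall t, - eps <= t <= eps -> `|xi t| <= a /\
       `|xi t - (mu * x + s0 * t)| <= Cerr * `|y|,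
      forall t, - eps <= t <= eps -> gamma t =
        chart (xi t, bump (lambda * y / bump 1 sigma (mu * x)) sigma (xi t)) &
      forall g, bmf g -> kint F g (chart (x, y)) = \int[U]_t g (gamma t)].
Proof.
move=> xa yd.
have [xi [gamma [cg hxi hgamma hF]]] := near_segment_kernel heps hb hsigma
  V_smooth V_unit V_W ha U_embeds F_perturb xa yd.
exists xi, gamma; split=> // g bg.
have mgamma : measurable_fun setT gamma.
  by move=> _ A mA; rewrite setTI; exact: continuous_curve_measurable.
have bgg := bmf_curve cg bg.
rewrite /kint /Rintegral; congr fine.
transitivity (\int[pushforward U gamma]_p (g p)%:E)%E.
  by apply: eq_measure_integral => A mA _; exact: hF.
rewrite integral_pushforward//.
- by apply/measurable_EFinP; case: bg.
- by rewrite preimage_setT; exact: (bmf_integrable _ measurableT bgg).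
Qed.

(** Continuity at the points of the segment, uniform in their position. Elsewhere arcs may close up
    and no continuity of the iterates is claimed. *)
Definition near_segment_continuous (g : torus R -> R) :=
  forall e : R, 0 < e -> exists2 d : R, 0 < d & forall x x' y : R,
    `|x| <= a -> `|x'| <= a -> `|x - x'| <= d -> `|y| <= d ->
    `|g (chart (x, y)) - g (chart (x', 0))| <= e.

Lemma chart_continuous : continuous (@chart R).
Proof.
move=> z; apply: continuous_comp; last exact: proj_continuous.
apply: cvgD; apply: cvgZr_tmp; [exact: cvg_fst | exact: cvg_snd].
Qed.

Lemma continuous_near_segment g : continuous g -> near_segment_continuous g.
Proof.
move=> cg e e0; pose G z := g (chart z).
have cG : continuous G.
  by move=> z; apply: continuous_comp; [exact: chart_continuous | exact: cg].
pose P d x' := forall x y, `|x - x'| <= d -> `|y| <= d ->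
  `|G (x, y) - G (x', 0)| <= e.
have cpt : compact (`[- a, a] : set R) by exact: segment_compact.
have /compact_near_coveringP/(_ R (0 : R)^'+ P _) H := cpt.
have : \forall d \near (0 : R)^'+, `[- a, a]%classic `<=` P d.
  apply: H => x0 _.
  have e2 : 0 < e / 2 by lra.
  have /cvgrPdist_lt/(_ _ e2)/nbhs_ballP[r /= r0 hr] := cG (x0, 0).
  exists (ball x0 (r / 2), [set d | d < r / 2]).
    split=> /=; first by apply: nbhsx_ballx; rewrite divr_gt0.
    by apply: nbhs_right_lt; rewrite divr_gt0.
  move=> [x' d] /= [hx' hd] x y hx hy.
  rewrite /ball /= in hx'.
  have h1 : ball (x0, 0) r (x', (0 : R)).
    by split; rewrite /ball /= ?subrr ?normr0//; lra.
  have h2 : ball (x0, 0) r (x, y).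
    split; rewrite /ball /= ?sub0r ?normrN; last by lra.
    have := ler_normD (x0 - x') (x' - x); rewrite addrA subrK (distrC x' x).
    by lra.
  move/hr : h1 => /= h1; move/hr : h2 => /= h2.
  have -> : G (x, y) - G (x', 0) = (G (x0, 0) - G (x', 0)) - (G (x0, 0) - G (x, y)).
    by ring.
  by rewrite (le_trans (ler_normB _ _))//; lra.
move=> near_d.
have [d [dp hd]] : exists d, 0 < d /\ `[- a, a]%classic `<=` P d.
  near (0 : R)^'+ => d; exists d; split; near: d => //.
  exact: nbhs_right_gt.
exists d => // x x' y _ xa' xx yd; apply: hd => //.
by rewrite /= in_itv /= -ler_norml.
Unshelve. all: by end_near. Qed.

(** The arcs from [(x, y)] and [(x', 0)] are coupled by their common parameter [t]. The second stays
    on the axis; the horizontal gap is at most [mu |x - x'| + Cerr |y|], and the height of the first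
    at most [B |y|]. *)
Lemma kint_near_segment g : bmf g -> near_segment_continuous g ->
  near_segment_continuous (kint F g).
Proof.
move=> bg ng e e0; have [d dp hd] := ng e e0.
have /andP[m0 m1] := cat_mu_bounds R; have /andP[l0 l1] := cat_lambda_bounds R.
have a0 := a_gt0 heps ha; have ba := bump1_gt0 sigma a.
have C0 : 0 <= Cerr.
  by rewrite !mulr_ge0 ?invr_ge0 ?sqr_ge0 ?(ltW a0) ?(ltW heps) ?(ltW ba)//; lra.
pose B := lambda / bump 1 sigma a.
have B0 : 0 <= B by rewrite divr_ge0 ?(ltW ba)//; lra.
have dh0 := strip_height_gt0 sigma a hb : 0 < d0.
pose D := 1 + Cerr + B.
have D0 : 0 < D by rewrite /D; lra.
exists (Num.min d0 (d / D)); first by rewrite lt_min dh0 divr_gt0.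
move=> x x' y xa xa' xx; rewrite le_min => /andP[y1 y2].
move: xx; rewrite le_min => /andP[_ xx].
have z1 : `|0 : R| <= d0 by rewrite normr0 ltW.
have [xi [gamma [cg hxi hgamma ->//]]] := near_segment_kint xa y1.
have [xi' [gamma' [cg' hxi' hgamma' ->//]]] := near_segment_kint xa' z1.
have bb := bmf_curve cg bg; have bb' := bmf_curve cg' bg.
have yD : D * `|y| <= d by rewrite mulrC -ler_pdivlMr.
have xD : D * `|x - x'| <= d by rewrite mulrC -ler_pdivlMr.
have y0 := normr_ge0 y; have x0 := normr_ge0 (x - x').
have key t : - eps <= t <= eps -> `|g (gamma t) - g (gamma' t)| <= e.
  move=> te; rewrite hgamma// hgamma'//.
  rewrite mulr0 mul0r [bump 0 _ _]bumpE mul0r.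
  have [h1 h2] := hxi t te; have [h3 h4] := hxi' t te.
  move: h4; rewrite normr0 mulr0 => h4.
  apply: hd => //.
  - have -> : xi t - xi' t = (xi t - (mu * x + s0 * t)) -
      (xi' t - (mu * x' + s0 * t)) + mu * (x - x') by ring.
    apply: le_trans (ler_normD _ _) _.
    have := ler_normB (xi t - (mu * x + s0 * t)) (xi' t - (mu * x' + s0 * t)).
    have amu : `|mu| = mu by rewrite ger0_norm; lra.
    rewrite normrM amu => h5; move: xD yD; rewrite /D; nra.
  - rewrite bumpE normrM (gtr0_norm (bump1_gt0 _ _)).
    have bx := bump1_gt0 sigma (mu * x).
    have b1 : bump 1 sigma (xi t) <= 1.
      rewrite /bump mul1r -[leRHS]expR0 ler_expR oppr_le0.
      by rewrite divr_ge0 ?sqr_ge0// mulr_ge0// sqr_ge0.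
    have bxa : bump 1 sigma a <= bump 1 sigma (mu * x).
      have amu : `|mu| = mu by rewrite ger0_norm; lra.
      apply: bump1_le => //; rewrite normrM amu (gtr0_norm a0).
      by have := normr_ge0 x; nra.
    apply: (@le_trans _ _ (B * `|y| * 1)); last first.
      by rewrite mulr1; move: yD; rewrite /D; nra.
    apply: ler_pM => //; first by rewrite ltW// bump1_gt0.
    have al : `|lambda| = lambda by rewrite ger0_norm; lra.
    rewrite normrM normfV (gtr0_norm bx) (normrM lambda) al /B mulrAC.
    apply: ler_wpM2r => //; apply: ler_wpM2l; first lra.
    by rewrite lef_pV2 ?posrE.
rewrite -RintegralB//; try exact: bmf_integrable.
have bD := bmfB bb bb'.
rewrite ler_norml; apply/andP; split.
- rewrite -[leLHS](Rintegral_uniform_cst (eps_itv heps)).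
  apply: le_Rintegral_uniform => //; first exact: bmf_cst.
  by move=> t /key; rewrite ler_norml => /andP[].
- rewrite -[leRHS](Rintegral_uniform_cst (eps_itv heps)).
  apply: le_Rintegral_uniform => //; first exact: bmf_cst.
  by move=> t /key; rewrite ler_norml => /andP[].
Qed.

End NearSegmentAverages.

(** * Separation and measurability on the torus *)

Section TorusTopology.
Variable R : realType.

Lemma lattice_invariant_continuous (G : R * R -> R) : continuous G ->
  (forall z m n, G (z + lat R m n) = G z) ->
  continuous (fun p : torus R => G (repr p)).
Proof.
move=> cG pG; apply: (@repr_comp_continuous _ _ _ G cG).
move=> x y /eqP e; apply/eqP.
have /proj_eq_lat[m [n ->]] : proj x = proj y := e.
exact: pG.
Qed.

Lemma circle_dist_continuous : continuous (@circle_dist R).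
Proof.
move=> x; have h := is_derive1_comp (f := cos) (g := fun r : R => 2 * pi * r + 0)
  (is_derive_cos _) (is_derive_affine x (2 * pi) 0).
suff h' : is_derive x (1 : R) (@circle_dist R) (0 - - sin (2 * pi * x + 0) * (2 * pi)).
  exact: is_derive_continuous h'.
apply: is_derive_congr (is_deriveB (is_derive_cst (1 : R) x (1 : R)) h) _ _ => //.
by move=> r; rewrite /circle_dist -[2 * pi * r]addr0.
Qed.

Lemma Tdist_continuous (w : R * R) :
  continuous (fun p : torus R => Tdist (repr p) w).
Proof.
apply: (lattice_invariant_continuous (G := fun z => Tdist z w)); last first.
  by move=> z m n; exact: Tdist_lat.
move=> z; apply: cvgD.
- apply: (@continuous_comp _ _ _ (fun z : R * R => z.1 - w.1) (@circle_dist R)).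
    by apply: cvgB; [exact: cvg_fst | exact: cvg_cst].
  exact: circle_dist_continuous.
- apply: (@continuous_comp _ _ _ (fun z : R * R => z.2 - w.2) (@circle_dist R)).
    by apply: cvgB; [exact: cvg_snd | exact: cvg_cst].
  exact: circle_dist_continuous.
Qed.

(** [Tdist] to a fixed point is continuous on the torus and vanishes at that point only. *)
Lemma torus_hausdorff : hausdorff_space (torus R).
Proof.
move=> p q pq; apply: contrapT => npq.
pose g (r : torus R) := Tdist (repr r) (repr q).
have cg : continuous g := @Tdist_continuous (repr q).
have gq : g q = 0 by rewrite /g Tdist_refl.
have gp : 0 < g p.
  rewrite lt_neqAle Tdist_ge0 andbT; apply/eqP => /esym/Tdist_eq0.
  by rewrite !proj_repr.
have e0 : 0 < g p / 2 by lra.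
have /cvgrPdist_lt/(_ _ e0) h1 := cg p.
have /cvgrPdist_lt/(_ _ e0) h2 := cg q.
have [r [/= r1 r2]] := pq _ _ h1 h2.
have := ler_norm (g p - g r); have := ler_norm (- (g q - g r)).
by rewrite normrN; move: r1 r2; rewrite gq; lra.
Qed.

Lemma torus_closed_measurable (A : set (torus R)) : closed A -> measurable A.
Proof.
move=> cA; rewrite -[A]setCK; apply: measurableC.
by apply: sub_sigma_algebra; exact: closed_openC.
Qed.

Lemma chart_box_measurable (K1 K2 : set R) : compact K1 -> compact K2 ->
  measurable (@chart R @` (K1 `*` K2)).
Proof.
move=> c1 c2; apply: torus_closed_measurable.
apply: compact_closed; first exact: torus_hausdorff.
apply: continuous_compact; last exact: compact_setX.
by apply: continuous_subspaceT => z; exact: chart_continuous.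
Qed.

Lemma torus_continuous_measurable (g : torus R -> R) : continuous g ->
  measurable_fun setT g.
Proof.
move=> cg; apply: (measurability _ (RGenOpens.measurableE R)).
move=> _ [_ [x [y ->]] <-]; rewrite setTI; apply: sub_sigma_algebra.
by move/continuousP : cg; apply; exact: interval_open.
Qed.

Lemma lebesgue_affine (m s : R) (E : set R) : s = 1 \/ s = -1 -> measurable E ->
  lebesgue_measure ((fun t => m + s * t) @^-1` E) = lebesgue_measure E.
Proof.
move=> s1 mE; apply/esym.
pose f : measurableTypeR R -> measurableTypeR R := fun t => m + s * t.
have mf : measurable_fun setT f.
  apply: (@measurable_funD _ _ R setT (fun=> m) (fun t => s * t)).
    exact: measurable_cst.
  by apply: measurable_funM; [exact: measurable_cst | exact: measurable_id].
have H X : ocitv X -> lebesgue_measure X = pushforward lebesgue_measure f X.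
  move=> [[x y] _ <-] /=; rewrite /pushforward.
  case: s1 => sE.
  - have -> : f @^-1` `]x, y] = `]x - m, y - m]%classic.
      by apply/seteqP; split=> t; rewrite /f sE /= !in_itv /= => /andP[? ?];
        apply/andP; split; lra.
    rewrite !lebesgue_measure_itv /= !lte_fin ltrD2r -!EFinB.
    by case: ifP => // _; congr EFin; ring.
  - have -> : f @^-1` `]x, y] = `[m - y, m - x[%classic.
      by apply/seteqP; split=> t; rewrite /f sE /= !in_itv /= => /andP[? ?];
        apply/andP; split; lra.
    rewrite !lebesgue_measure_itv /= !lte_fin ltrD2l ltrN2 -!EFinB.
    by case: ifP => // _; congr EFin; ring.
exact: (lebesgue_measure_unique H).
Qed.

End TorusTopology.

(** [exp u <= 1 / (1 - u)], and [(1 + u + 2 u^2) (1 - u) = 1 + u^2 (1 - 2 u) >= 1]. *)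
Lemma expR_le_quad (R : realType) (u : R) : u <= 1 / 2 ->
  expR u <= 1 + u + 2 * u ^+ 2.
Proof.
move=> u2; have := expR_ge1Dx (- u); rewrite expRN => h.
have u1 : 0 < 1 - u by lra.
apply: (@le_trans _ _ (1 - u)^-1).
  rewrite -[leLHS]invrK lef_pV2 ?posrE ?invr_gt0 ?expR_gt0//.
rewrite -[leLHS]mul1r ler_pdivrMr//.
have := sqr_ge0 u; nra.
Qed.

(** * The Lyapunov function and its drift *)

Section Lyapunov.
Variable R : realType.
Variables (eps b sigma a : R) (V : torus R -> R * R).
Hypothesis heps : 0 < eps.
Hypothesis hb : 0 < b.
Hypothesis hsigma : 0 < sigma.
Hypothesis V_smooth : smooth_field V.
Hypothesis V_unit : unit_field V.
Hypothesis V_W : tangent_to_bumps V sigma (bump_region a b sigma).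
Variable (F : R.-pker torus R ~> torus R).
Hypothesis ha : a = eps / (1 - cat_mu R).
Hypothesis U_embeds : {in bump_region a b sigma &, injective (@chart R)}.
Hypothesis F_perturb : random_perturbation (@cat_map R) V eps F.

Local Notation mu := (cat_mu R).
Local Notation lambda := (cat_lambda R).
Local Notation d0 := (strip_height b sigma a).
Local Notation s0 := (stable_sign V).
Local Notation U := (uniform_law (eps_itv heps)).
Local Notation Cerr := (a / sigma ^+ 2 * eps * lambda / bump 1 sigma a).
Local Notation I := (`[- eps, eps]%classic : set R).

Let a0 : 0 < a. Proof. exact: a_gt0 heps ha. Qed.
Let ba0 : 0 < bump 1 sigma a. Proof. exact: bump1_gt0. Qed.

Lemma box_W x y : `|x| <= a -> `|y| <= d0 -> bump_region a b sigma (x, y).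
Proof.
move=> xa yd; split=> //=; apply: le_trans yd _; rewrite bumpE /strip_height.
have /andP[l0 l1] := cat_lambda_bounds R.
have bxa : bump 1 sigma a <= bump 1 sigma x.
  by apply: bump1_le => //; rewrite (gtr0_norm a0).
apply: (@le_trans _ _ (b * bump 1 sigma a)); last first.
  by apply: ler_wpM2l => //; exact: ltW.
rewrite ler_pdivrMr; last lra.
have : 0 < b * bump 1 sigma a by rewrite mulr_gt0.
by nra.
Qed.

Section Height.
Variable d : R.
Hypothesis d_gt0 : 0 < d.
Hypothesis d_le : d <= d0.

Let near_box p (z : R * R) := [/\ `|z.1| <= a, `|z.2| <= d & chart z = p].

(* The distance to the segment in the box of height [d], and [d] elsewhere: the
   default value of [xget] has second coordinate [d]. *)
Definition height (p : torus R) : R := `|(xget (0, d) [set z | near_box p z]).2|.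

Lemma height_chart x y : `|x| <= a -> `|y| <= d -> height (chart (x, y)) = `|y|.
Proof.
move=> xa yd; rewrite /height.
have [z1 z2 ez] : near_box (chart (x, y))
    (xget (0, d) [set z | near_box (chart (x, y)) z]).
  exact: (@xgetPex _ (0, d) [set z | near_box (chart (x, y)) z] (ex_intro _ (x, y) _)).
have W1 : (x, y) \in bump_region a b sigma.
  by rewrite inE; apply: box_W => //; exact: le_trans d_le.
have W2 : xget (0, d) [set z | near_box (chart (x, y)) z] \in bump_region a b sigma.
  rewrite inE; move: z1 z2; case: (xget _ _) => x' y' /= z1 z2.
  by apply: box_W => //; exact: le_trans d_le.
by rewrite (U_embeds W2 W1 ez).
Qed.

Lemma heightP p : (exists x y, [/\ `|x| <= a, `|y| <= d & p = chart (x, y)]) \/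
  height p = d.
Proof.
have [[[x y] [h1 h2 h3]]|np] := pselect (exists z, near_box p z).
  by left; exists x, y.
right; rewrite /height xgetPN; first by rewrite /= gtr0_norm.
by move=> z hz; apply: np; exists z.
Qed.

Lemma height_ge0 p : 0 <= height p.
Proof. by rewrite /height. Qed.

Lemma height_le p : height p <= d.
Proof.
by have [[x [y [xa yd ->]]]|->//] := heightP p; rewrite height_chart.
Qed.

Lemma height_chart_le x y : `|x| <= a -> height (chart (x, y)) <= `|y|.
Proof.
move=> xa; have [yd|yd] := leP `|y| d; first by rewrite height_chart.
exact: le_trans (height_le _) (ltW yd).
Qed.

Lemma height_eq0 p : height p = 0 <-> stable_segment a p.
Proof.
split.
  have [[x [y [xa yd ->]]]|->] := heightP p; last by move=> e; move: d_gt0; rewrite e ltxx.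
  rewrite height_chart// => /normr0_eq0 ->; exists x => //.
  by rewrite /= in_itv /= -ler_norml.
move=> [x]; rewrite /= in_itv /= -ler_norml => xa <-.
by rewrite height_chart ?normr0 ?(ltW d_gt0).
Qed.

(** The sublevel sets below [d] are images of compact boxes, hence closed. *)
Lemma height_measurable : measurable_fun setT height.
Proof.
apply: (measurability _ (RGenOInfty.measurableE R)).
move=> _ [_ [r ->] <-]; rewrite setTI.
have -> : height @^-1` `]r, +oo[ = ~` [set p | height p <= r].
  apply/seteqP; split=> p; rewrite /= in_itv /= andbT.
    by move=> h /(lt_le_trans h); rewrite ltxx.
  by move=> /negP; rewrite -ltNge.
apply: measurableC.
have [r0|r0] := ltP r 0.
  rewrite [X in measurable X](_ : _ = set0) //.
  by apply/seteqP; split=> p //= h; have := height_ge0 p; lra.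
have [dr|rd] := leP d r.
  rewrite [X in measurable X](_ : _ = setT) //.
  by apply/seteqP; split=> p //= _; exact: le_trans (height_le p) dr.
rewrite [X in measurable X](_ : _ = @chart R @` (`[- a, a] `*` `[- r, r])).
  by apply: chart_box_measurable; exact: segment_compact.
apply/seteqP; split=> p /=.
  have [[x [y [xa yd ->]]]|->] := heightP p; last by move=> /(lt_le_trans rd); rewrite ltxx.
  by rewrite height_chart// => yr; exists (x, y) => //; split;
    rewrite /= in_itv /= -ler_norml.
move=> [[x y] [/=]]; rewrite !in_itv /= -!ler_norml => xa yr <-.
by apply: le_trans yr; exact: height_chart_le.
Qed.

Variable s : R.
Hypothesis s_gt0 : 0 < s.

(** Dividing by [d] gives the value 1, the maximum, at every point off the box. *)
Definition lyapunov p : R := (height p / d) `^ s.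

Lemma lyapunov01 p : 0 <= lyapunov p <= 1.
Proof.
rewrite powR_ge0 /= -[leRHS](congr1 (@^~ s) (powR1 R)).
apply: ge0_ler_powR; rewrite ?nnegrE ?ler01 ?(ltW s_gt0) ?divr_ge0 ?height_ge0 ?(ltW d_gt0)//.
by rewrite ler_pdivrMr// mul1r height_le.
Qed.

Lemma bmf_lyapunov : bmf lyapunov.
Proof.
split.
  apply: (measurableT_comp (measurable_powR s)).
  by apply: measurable_funM; [exact: height_measurable | exact: measurable_cst].
by exists 1 => p; have /andP[h0 h1] := lyapunov01 p; rewrite ger0_norm.
Qed.

Lemma lyapunov_eq0 p : lyapunov p = 0 <-> stable_segment a p.
Proof.
rewrite -height_eq0; split; last first.
  by move=> h; rewrite /lyapunov h mul0r powR0// gt_eqF.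
move=> /powR_eq0_eq0 /eqP; rewrite mulf_eq0 invr_eq0 (gt_eqF d_gt0) orbF.
by move=> /eqP.
Qed.

(** Close to the segment, [q] is the foot of [p] and [e] suffices. Elsewhere [lyapunov] is at least
    [l > 0], so a multiple of it exceeds the trivial bound [2 M]. *)
Lemma near_segment_lyapunov (g : torus R -> R) : bmf g ->
  near_segment_continuous a g -> forall e, 0 < e -> exists2 K, 0 <= K &
  forall p, exists2 q, lyapunov q = 0 & `|g p - g q| <= e + K * lyapunov p.
Proof.
move=> [_ [M gM]] ng e e0; have [r r0 hr] := ng e e0.
pose r' := Num.min r d.
have r'0 : 0 < r' by rewrite lt_min r0.
pose l := (r' / d) `^ s.
have l0 : 0 < l by rewrite powR_gt0// divr_gt0.
have M0 : 0 <= M := le_trans (normr_ge0 _) (gM (chart (0, 0))).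
exists (2 * M / l); first by rewrite divr_ge0 ?(ltW l0)// mulr_ge0.
move=> p; have /andP[Lp0 _] := lyapunov01 p.
have far : r' <= height p -> exists2 q, lyapunov q = 0 &
    `|g p - g q| <= e + 2 * M / l * lyapunov p.
  move=> hp; exists (chart (0, 0)).
    apply/lyapunov_eq0; exists 0 => //.
    by rewrite /= in_itv /= oppr_le0 (ltW a0).
  have lL : l <= lyapunov p.
    apply: ge0_ler_powR; rewrite ?nnegrE ?divr_ge0 ?height_ge0 ?(ltW s_gt0)
      ?(ltW d_gt0) ?(ltW r'0)//.
    by rewrite ler_pM2r ?invr_gt0.
  have : 2 * M <= 2 * M / l * lyapunov p.
    by rewrite mulrAC ler_pdivlMr//; apply: ler_wpM2l => //; rewrite mulr_ge0.
  have := ler_normB (g p) (g (chart (0, 0))).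
  by have := gM p; have := gM (chart (0, 0)); lra.
have [[x [y [xa yd pE]]]|hp] := heightP p; last first.
  by apply: far; rewrite hp ge_min lexx orbT.
have [yr|ry] := leP `|y| r; last first.
  by apply: far; rewrite pE height_chart// ge_min (ltW ry).
exists (chart (x, 0)).
  by apply/lyapunov_eq0; exists x => //; rewrite /= in_itv /= -ler_norml.
have := hr x x y xa xa; rewrite subrr normr0 -pE => /(_ (ltW r0) yr) h.
by apply: le_trans h _; rewrite lerDl mulr_ge0// divr_ge0 ?(ltW l0)// mulr_ge0.
Qed.

End Height.

Hypothesis sigma_small : 6 * sigma ^+ 2 * ln lambda < eps ^+ 2.

(* Along the arc from a point with first coordinate [x], the logarithm of the
   height grows by [ln lambda + ((mu x)^2 - xi^2) / (2 sigma^2)], whose mean is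
   close to [ln lambda - eps^2 / (6 sigma^2) < 0]; a small power [s] of the
   height therefore contracts on average. *)
Lemma lyapunov_drift : exists d s rho,
  [/\ 0 < d <= d0, 0 < s, 0 <= rho < 1 &
   forall x y, `|x| <= a -> `|y| <= d ->
     kint F (lyapunov d s) (chart (x, y)) <= rho * lyapunov d s (chart (x, y))].
Proof.
have /andP[m0 m1] := cat_mu_bounds R; have /andP[l0 l1] := cat_lambda_bounds R.
have sig2 : 0 < 2 * sigma ^+ 2 by rewrite mulr_gt0// exprn_gt0.
have dh0 := strip_height_gt0 sigma a hb : 0 < d0.
have C0 : 0 <= Cerr.
  by rewrite !mulr_ge0 ?invr_ge0 ?sqr_ge0 ?(ltW a0) ?(ltW heps) ?(ltW ba0)//; lra.
(* The mean rate at which the logarithm of the height decreases for the ideal motion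
   [mu x + s0 t]. *)
pose kappa := eps ^+ 2 / 3 / (2 * sigma ^+ 2) - ln lambda.
have k0 : 0 < kappa.
  by rewrite subr_gt0 ltr_pdivlMr// ltr_pdivlMr//; move: sigma_small; lra.
have ln0 : 0 <= ln lambda by apply: ln_ge0; lra.
(* [E |y|] bounds the error in the logarithm due to replacing the true position [xi t] by the ideal
   one; [d] is chosen to make it at most [kappa / 4]. *)
pose E := Cerr * (2 * a) / (2 * sigma ^+ 2).
have E0 : 0 <= E by rewrite divr_ge0 ?(ltW sig2)// mulr_ge0// mulr_ge0// ltW.
pose d := Num.min d0 (kappa / 4 / (1 + E)).
have d_gt0 : 0 < d by rewrite lt_min dh0 !divr_gt0//; lra.
have d_le : d <= d0 by rewrite ge_min lexx.
pose delta := E * d.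
have delta0 : 0 <= delta by rewrite mulr_ge0// ltW.
have delta_le : delta <= kappa / 4.
  have : d <= kappa / 4 / (1 + E) by rewrite ge_min lexx orbT.
  rewrite ler_pdivlMr; last lra.
  by rewrite /delta; move: d_gt0; nra.
pose M := ln lambda + a ^+ 2 / (2 * sigma ^+ 2) + kappa.
have a2 : 0 <= a ^+ 2 / (2 * sigma ^+ 2) by rewrite divr_ge0 ?sqr_ge0// ltW.
have kM : kappa <= M by rewrite /M; lra.
have M0 : 0 < M by lra.
(* [M] bounds the logarithmic growth. With this [s] the quadratic term [2 (s M)^2] equals
   [s kappa / 4]; as [delta] costs at most another [s kappa / 4], half of [s kappa] remains for
   [rho]. *)
pose s := kappa / (8 * M ^+ 2).
have s_gt0 : 0 < s by rewrite divr_gt0// mulr_gt0// exprn_gt0.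
have sM2 : s * M ^+ 2 = kappa / 8.
  by rewrite /s; field; rewrite gt_eqF.
have sM : s * M <= 1 / 8.
  have : s * M * M <= 1 / 8 * M by rewrite -mulrA -expr2 sM2; lra.
  by rewrite ler_pM2r.
pose rho := 1 - s * kappa / 2.
have rho01 : 0 <= rho < 1.
  have : s * kappa <= s * M by rewrite ler_pM2l.
  have : 0 < s * kappa by rewrite mulr_gt0.
  by rewrite /rho => ? ?; apply/andP; split; lra.
exists d, s, rho; split=> //; first by rewrite d_gt0.
move=> x y xa yd.
have yd0 := le_trans yd d_le.
have [xi [gamma [cg hxi hgamma hF]]] := near_segment_kint heps hb hsigma V_smooth
  V_unit V_W ha U_embeds F_perturb xa yd0.
have bL := bmf_lyapunov d_gt0 d_le s_gt0.
rewrite hF//.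
set Lz := lyapunov d s (chart (x, y)).
have LzE : Lz = (`|y| / d) `^ s by rewrite /Lz /lyapunov height_chart.
have Lz0 : 0 <= Lz by rewrite LzE powR_ge0.
set m := mu * x.
have ma : `|m| + eps <= a.
  have amu : `|mu| = mu by rewrite ger0_norm; lra.
  rewrite normrM amu; have := eps_mu_a ha; have := normr_ge0 x; nra.
have s01 := stable_signE heps hb hsigma V_smooth V_unit V_W ha.
pose q (t : R) := \1_I t * (m + s0 * t) ^+ 2.
have bq : bmf q := bmf_sqr_affine (eps_itv heps) m s01.
(* [A - B (m + s0 t)^2] is the quadratic bound for the exponential. In its mean the second moment
   [m^2 + eps^2 / 3] cancels the [m^2] in [A], so the rate does not depend on [x]. *)
pose A := 1 + s * (ln lambda + delta + m ^+ 2 / (2 * sigma ^+ 2)) + 2 * (s * M) ^+ 2.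
pose B := s / (2 * sigma ^+ 2).
pose h (t : R) := Lz * A + (- (Lz * B)) * q t.
have bh : bmf h by apply: bmfD; [exact: bmf_cst | exact: bmfZ].
apply: (@le_trans _ _ (\int[U]_t h t)); last first.
  rewrite RintegralD//; last 2 first.
  - exact: (bmf_integrable _ measurableT (bmf_cst _ (Lz * A))).
  - by apply: bmf_integrable => //; exact: bmfZ.
  rewrite Rintegral_uniform_cst RintegralZl//; last exact: bmf_integrable.
  rewrite uniform_second_moment//.
  have -> : Lz * A + - (Lz * B) * (m ^+ 2 + eps ^+ 2 / 3) =
      (1 + s * (delta - kappa) + 2 * (s * (s * M ^+ 2))) * Lz.
    by rewrite /A /B /kappa; ring.
  apply: ler_wpM2r => //; rewrite sM2 /rho.
  by move: delta_le s_gt0; nra.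
have bLg := bmf_curve cg bL.
apply: le_Rintegral_uniform => // t te.
have [xia xierr] := hxi t te; rewrite -/m in xierr.
have tI : t \in I by rewrite inE /= in_itv.
have tabs : `|t| <= eps by rewrite ler_norml.
have st : `|s0 * t| = `|t|.
  by rewrite normrM; case: s01 => ->; rewrite ?normrN normr1 mul1r.
have mta : `|m + s0 * t| <= a.
  by rewrite (le_trans (ler_normD _ _))// st; lra.
(* [phi] is the exact logarithmic growth and [psi] that of the ideal motion. *)
pose phi := ln lambda + (m ^+ 2 - xi t ^+ 2) / (2 * sigma ^+ 2).
pose psi := ln lambda + (m ^+ 2 - (m + s0 * t) ^+ 2) / (2 * sigma ^+ 2).
have sqdiff : (m + s0 * t) ^+ 2 - xi t ^+ 2 <= Cerr * d * (2 * a).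
  have -> : (m + s0 * t) ^+ 2 - xi t ^+ 2 =
      (m + s0 * t - xi t) * (m + s0 * t + xi t) by ring.
  apply: le_trans (ler_norm _) _; rewrite normrM; apply: ler_pM => //.
    by rewrite distrC; apply: le_trans xierr _; exact: ler_wpM2l.
  by rewrite (le_trans (ler_normD _ _))//; lra.
have phi_le : phi <= psi + delta.
  have -> : delta = Cerr * d * (2 * a) / (2 * sigma ^+ 2).
    by rewrite /delta /E; ring.
  rewrite /phi /psi -addrA lerD2l -mulrDl ler_pM2r ?invr_gt0//.
  by lra.
have psi_le : `|psi + delta| <= M.
  have m2 : m ^+ 2 <= a ^+ 2.
    rewrite -(real_normK (num_real m)) ler_pXn2r ?nnegrE ?(ltW a0)//.
    by move: ma; lra.
  have mt2 : (m + s0 * t) ^+ 2 <= a ^+ 2.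
    by rewrite -(real_normK (num_real (_ + _))) ler_pXn2r ?nnegrE ?(ltW a0).
  have h1 : (m ^+ 2 - (m + s0 * t) ^+ 2) / (2 * sigma ^+ 2) <= a ^+ 2 / (2 * sigma ^+ 2).
    by rewrite ler_pM2r ?invr_gt0//; have := sqr_ge0 (m + s0 * t); lra.
  have h2 : - (a ^+ 2 / (2 * sigma ^+ 2)) <= (m ^+ 2 - (m + s0 * t) ^+ 2) / (2 * sigma ^+ 2).
    by rewrite -mulNr ler_pM2r ?invr_gt0//; have := sqr_ge0 m; lra.
  by rewrite ler_norml /psi /M; apply/andP; split; lra.
have Lle : lyapunov d s (gamma t) <= Lz * expR (s * (psi + delta)).
  rewrite hgamma//.
  have [bm bx] : 0 < bump 1 sigma m /\ 0 < bump 1 sigma (xi t) by rewrite !bump1_gt0.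
  have eY : `|bump (lambda * y / bump 1 sigma m) sigma (xi t)| = `|y| * expR phi.
    have -> : expR phi = lambda * (bump 1 sigma (xi t) / bump 1 sigma m).
      rewrite /phi expRD lnK ?posrE; last lra.
      congr (_ * _); rewrite /bump !mul1r -expRN -expRD opprK; congr expR.
      by field; rewrite gt_eqF.
    have al : `|lambda| = lambda by rewrite ger0_norm; lra.
    rewrite bumpE normrM (gtr0_norm bx) normrM normfV (gtr0_norm bm) (normrM lambda) al.
    by field; rewrite gt_eqF.
  apply: (@le_trans _ _ ((`|y| / d * expR phi) `^ s)).
    have n1 : 0 <= height d (chart (xi t,
        bump (lambda * y / bump 1 sigma m) sigma (xi t))) / d.
      by apply: divr_ge0; [exact: height_ge0 | exact: ltW].
    have n2 : 0 <= `|y| / d * expR phi.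
      by apply: mulr_ge0; [apply: divr_ge0 => //; exact: ltW | exact: expR_ge0].
    apply: ge0_ler_powR; rewrite ?nnegrE//; first exact: ltW.
    have -> : `|y| / d * expR phi = `|y| * expR phi / d by ring.
    by rewrite -eY ler_pM2r ?invr_gt0//; exact: height_chart_le.
  rewrite powRM ?expR_ge0 ?divr_ge0 ?(ltW d_gt0)// LzE.
  apply: ler_wpM2l; first exact: powR_ge0.
  by rewrite {1}/powR gt_eqF ?expR_gt0// expRK ler_expR ler_pM2l.
apply: le_trans Lle _.
have -> : h t = Lz * (A - B * (m + s0 * t) ^+ 2).
  by rewrite /h /q indicE tI mul1r; ring.
apply: ler_wpM2l => //.
have sp : s * (psi + delta) <= 1 / 2.
  apply: (@le_trans _ _ (s * M)); last by lra.
  by rewrite ler_pM2l//; move: psi_le; rewrite ler_norml => /andP[].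
apply: le_trans (expR_le_quad sp) _.
have sq : (psi + delta) ^+ 2 <= M ^+ 2.
  by rewrite -(real_normK (num_real (_ + _))) ler_pXn2r ?nnegrE ?(ltW M0).
have -> : A - B * (m + s0 * t) ^+ 2 = 1 + s * (psi + delta) + 2 * (s ^+ 2 * M ^+ 2).
  by rewrite /A /B /psi; ring.
by rewrite lerD2l ler_pM2l// exprMn ler_pM2l// exprn_gt0.
Qed.

End Lyapunov.

(** * The Doeblin condition on the segment *)

Section Core.
Variable R : realType.
Variables (eps b sigma a : R) (V : torus R -> R * R).
Hypothesis heps : 0 < eps.
Hypothesis hb : 0 < b.
Hypothesis hsigma : 0 < sigma.
Hypothesis V_smooth : smooth_field V.
Hypothesis V_unit : unit_field V.
Hypothesis V_W : tangent_to_bumps V sigma (bump_region a b sigma).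
Variable (F : R.-pker torus R ~> torus R).
Hypothesis ha : a = eps / (1 - cat_mu R).
Hypothesis U_embeds : {in bump_region a b sigma &, injective (@chart R)}.
Hypothesis F_perturb : random_perturbation (@cat_map R) V eps F.

Local Notation mu := (cat_mu R).
Local Notation lambda := (cat_lambda R).
Local Notation d0 := (strip_height b sigma a).
Local Notation s0 := (stable_sign V).
Local Notation U := (uniform_law (eps_itv heps)).
Local Notation Cerr := (a / sigma ^+ 2 * eps * lambda / bump 1 sigma a).
Local Notation I := (`[- eps, eps]%classic : set R).

Let a0 : 0 < a. Proof. exact: a_gt0 heps ha. Qed.

Definition axis_chart (u : R) : torus R := chart (u, 0).

(** This is [eps - mu a], because [eps = (1 - mu) a]. *)
Definition core_radius : R := (1 - 2 * mu) * a.

Local Notation core_itv := (`[- core_radius, core_radius]%classic : set R).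

Definition core : set (torus R) := @chart R @` (`[- core_radius, core_radius] `*` [set 0]).

Lemma core_measurable : measurable core.
Proof.
apply: chart_box_measurable; first exact: segment_compact.
exact: compact_set1.
Qed.

(* The law on [core] of one step from [chart (x, 0)] is the image of Lebesgue
   measure on an interval that always covers [core]. *)
Lemma kernel_core x A : `|x| <= a -> measurable A -> A `<=` core ->
  F (chart (x, 0)) A = (lebesgue_measure (core_itv `&` axis_chart @^-1` A) *
    ((eps - - eps)%R^-1)%:E)%E.
Proof.
move=> xa mA AJ.
have /andP[m0 m1] := cat_mu_bounds R.
have dh0 := strip_height_gt0 sigma a hb : 0 < d0.
have s01 := stable_signE heps hb hsigma V_smooth V_unit V_W ha.
have z1 : `|0 : R| <= d0 by rewrite normr0 ltW.
have [xi [gamma [cg hxi hgamma hF]]] := near_segment_kernel heps hb hsigma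
  V_smooth V_unit V_W ha U_embeds F_perturb xa z1.
rewrite hF// uniform_probE; last exact: continuous_curve_measurable.
congr (_ * _)%E.
have cl : continuous axis_chart.
  move=> u; apply: (@continuous_comp _ _ _ (fun u : R => u *: e_s R + 0 *: e_u R)
    (@proj R)); last exact: proj_continuous.
  by apply: cvgD; [apply: cvgZr_tmp; exact: cvg_id | exact: cvg_cst].
have mE : measurable (core_itv `&` axis_chart @^-1` A).
  by apply: measurableI => //; exact: continuous_curve_measurable.
rewrite -(lebesgue_affine (mu * x) s01 mE); congr (lebesgue_measure _).
have mx : `|mu * x| <= mu * a.
  have amu : `|mu| = mu by rewrite ger0_norm; lra.
  by rewrite normrM amu; apply: ler_wpM2l => //; lra.
have ea := eps_mu_a ha.
have st t : `|s0 * t| = `|t|.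
  by rewrite normrM; case: s01 => ->; rewrite ?normrN normr1 mul1r.
have ma : mu * a <= a by rewrite ler_piMl ?(ltW a0)//; lra.
have gE t : - eps <= t <= eps ->
    gamma t = chart (mu * x + s0 * t, 0) /\ `|mu * x + s0 * t| <= a.
  move=> te; have [h1 h2] := hxi t te; move: h2; rewrite normr0 mulr0 => h2.
  have e : xi t = mu * x + s0 * t by apply/subr0_eq/normr0_eq0/le_anti; rewrite h2 normr_ge0.
  by rewrite -e; split=> //; rewrite hgamma// mulr0 mul0r bumpE mul0r.
apply/seteqP; split=> t /=.
  rewrite in_itv /= => -[te At]; have [gt ta] := gE t te.
  rewrite gt in At; split=> //.
  have [[u v] [/= uj v0] e] := AJ _ At.
  move: uj; rewrite v0 in e; rewrite !in_itv /= -!ler_norml => uj.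
  have ua : `|u| <= a.
    by apply: le_trans uj _; rewrite /core_radius ler_piMl ?(ltW a0)//; lra.
  have W1 : (u, 0 : R) \in bump_region a b sigma.
    by rewrite inE; apply: (box_W heps hb hsigma ha) => //; rewrite normr0 ltW.
  have W2 : (mu * x + s0 * t, 0 : R) \in bump_region a b sigma.
    by rewrite inE; apply: (box_W heps hb hsigma ha) => //; rewrite normr0 ltW.
  by have [<-] := U_embeds W1 W2 e.
rewrite !in_itv /= -!ler_norml => -[uj At].
have te : `|t| <= eps.
  rewrite -st; have := ler_normB (mu * x + s0 * t) (mu * x).
  by rewrite addrAC subrr add0r; move: uj; rewrite /core_radius; lra.
have te' : - eps <= t <= eps by rewrite -ler_norml.
by split=> //; have [-> _] := gE t te'.
Qed.

Lemma kernel_core_mass x : `|x| <= a ->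
  F (chart (x, 0)) core = (core_radius / eps)%:E.
Proof.
move=> xa; have /andP[m0 m1] := cat_mu_bounds R.
have j0 : 0 < core_radius by rewrite mulr_gt0//; lra.
rewrite kernel_core//; last exact: core_measurable.
have -> : core_itv `&` axis_chart @^-1` core = core_itv.
  by apply/seteqP; split=> u; [case | move=> uj; split=> //; exists (u, 0)].
rewrite lebesgue_measure_itv /= lte_fin gtrN// -EFinB -EFinM; congr EFin.
have -> : core_radius - - core_radius = 2 * core_radius by ring.
have -> : eps - - eps = 2 * eps by ring.
by field; rewrite gt_eqF.
Qed.

End Core.

(** * Induction along an interval *)

Section RealInduction.
Variable R : realType.

Lemma real_induction (P : R -> Prop) (T : R) : P 0 ->
  (forall t, 0 < t <= T -> (forall s, 0 <= s < t -> P s) -> P t) ->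
  (forall t, 0 <= t <= T -> P t ->
    exists2 r, 0 < r & forall s, t <= s < t + r -> s <= T -> P s) ->
  forall t, 0 <= t <= T -> P t.
Proof.
move=> P0 Pl Pr t1 t1T; apply: contrapT => nPt1.
pose E := [set t | 0 <= t <= T /\ ~ P t].
have hE : has_inf E by split; [exists t1 | exists 0 => t [/andP[]]].
have i0 : 0 <= inf E by apply: lb_le_inf; [exact: hE.1 | move=> t [/andP[]]].
have iE t : E t -> inf E <= t by move=> Et; apply: ge_inf => //; exact: hE.2.
set i := inf E in i0 iE.
have iT : i <= T by have /iE := conj t1T nPt1 : E t1; case/andP: t1T; lra.
have below s : 0 <= s < i -> P s.
  move=> /andP[s0 si]; apply: contrapT => nPs.
  have : E s by split=> //; apply/andP; split; lra.
  by move/iE; lra.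
have Pi : P i.
  have [i_gt0|i_le0] := ltP 0 i; first by apply: Pl => //; rewrite i_gt0.
  by have -> : i = 0 by lra.
have iI : 0 <= i <= T by rewrite i0.
have [r r0 hr] := Pr i iI Pi.
have [t2 Et2 t2r] := inf_adherent r0 hE; rewrite -/i in t2r.
have [/andP[_ t2T] nP2] := Et2.
by apply: nP2; apply: hr => //; rewrite iE.
Qed.

Lemma nonneg_left_limit (g : R -> R) (t : R) : continuous g -> 0 < t ->
  (forall s, 0 <= s < t -> 0 <= g s) -> 0 <= g t.
Proof.
move=> cg t0 hg; rewrite leNgt; apply/negP => gt0.
have d0 : 0 < - g t by lra.
have /cvgrPdist_lt/(_ _ d0)/nbhs_ballP[r /= r0 hr] := cg t.
pose s := Num.max 0 (t - r / 2).
have s0 : 0 <= s by rewrite le_max lexx.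
have st : s < t by rewrite gt_max t0 /=; lra.
have sr : t - r / 2 <= s by rewrite le_max lexx orbT.
have /hr /= h : ball t r s by rewrite /ball /= ger0_norm ?subr_ge0 ?ltW//; lra.
have gs : 0 <= g s by apply: hg; rewrite s0.
by have := ler_norm (- (g t - g s)); rewrite normrN; lra.
Qed.

Lemma nonneg_preimage_closed (T : topologicalType) (f : T -> R) :
  continuous f -> closed [set z | 0 <= f z].
Proof.
move=> cf; apply: (@preimage_closed _ _ f [set x | 0 <= x]).
  by move=> z _; exact: cf.
exact: closed_ge.
Qed.

End RealInduction.

(** * Lifting horizontal segments into an embedded region *)

Section BumpRegions.
Variable R : realType.
Variables (w h sigma : R).
Hypothesis hsigma : 0 < sigma.
Hypothesis h_ge0 : 0 <= h.

Local Notation D := (bump_region w h sigma).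

Lemma bump_continuous (K : R) : continuous (bump K sigma).
Proof.
have s0 : sigma != 0 by rewrite gt_eqF.
by move=> x; exact: is_derive_continuous (is_derive_bump K x s0).
Qed.

Lemma bump_region_far_compact (z0 : R * R) (r : R) :
  compact [set z | D z /\ r <= `|z.1 - z0.1| + `|z.2 - z0.2|].
Proof.
apply: (@subclosed_compact _ _ (`[- w, w] `*` `[- h, h])); last 2 first.
- by apply: compact_setX; exact: segment_compact.
- move=> z [[z1 z2] _]; split; rewrite /= in_itv /= -ler_norml//.
  apply: le_trans z2 _; rewrite /bump -[leRHS]mulr1 ler_wpM2l//.
  rewrite -[leRHS]expR0 ler_expR oppr_le0.
  by rewrite divr_ge0 ?sqr_ge0// mulr_ge0// sqr_ge0.
have -> : [set z | D z /\ r <= `|z.1 - z0.1| + `|z.2 - z0.2|] =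
  [set z | 0 <= w - `|z.1|] `&` [set z | 0 <= bump h sigma z.1 - `|z.2|] `&`
  [set z : R * R | 0 <= `|z.1 - z0.1| + `|z.2 - z0.2| - r].
  apply/seteqP; split=> z /=; rewrite !subr_ge0; first by move=> [[? ?] ?].
  by move=> [[? ?] ?].
have c1 : continuous (fun z : R * R => z.1) by move=> z; exact: cvg_fst.
have c2 : continuous (fun z : R * R => z.2) by move=> z; exact: cvg_snd.
have n1 : continuous (fun z : R * R => `|z.1|).
  by move=> z; apply: cvg_norm; exact: c1.
have n2 : continuous (fun z : R * R => `|z.2|).
  by move=> z; apply: cvg_norm; exact: c2.
have n3 : continuous (fun z : R * R => `|z.1 - z0.1|).
  by move=> z; apply: cvg_norm; apply: cvgB; [exact: c1 | exact: cvg_cst].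
have n4 : continuous (fun z : R * R => `|z.2 - z0.2|).
  by move=> z; apply: cvg_norm; apply: cvgB; [exact: c2 | exact: cvg_cst].
have cb : continuous (fun z : R * R => bump h sigma z.1).
  move=> z; apply: (@continuous_comp _ _ _ (fun z : R * R => z.1) (bump h sigma)).
    exact: c1.
  exact: bump_continuous.
apply: closedI; first apply: closedI.
- apply: (nonneg_preimage_closed (f := fun z : R * R => w - `|z.1|)) => z.
  by apply: cvgB; [exact: cvg_cst | exact: n1].
- apply: (nonneg_preimage_closed (f := fun z : R * R => bump h sigma z.1 - `|z.2|)) => z.
  by apply: cvgB; [exact: cb | exact: n2].
- apply: (nonneg_preimage_closed
    (f := fun z : R * R => `|z.1 - z0.1| + `|z.2 - z0.2| - r)) => z.
  by apply: cvgB; [apply: cvgD; [exact: n3 | exact: n4] | exact: cvg_cst].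
Qed.

Lemma frameB (z z' : R * R) : frame (z - z') = frame z - frame z'.
Proof. by have := frameD (z - z') z'; rewrite subrK => ->; rewrite addrK. Qed.

Lemma chart_eq_frame (z z' : R * R) : chart z = chart z' ->
  exists m n, frame z = frame z' + lat R m n.
Proof. exact: proj_eq_lat. Qed.

(** [frame] is an isometry, and a nonzero lattice vector has length at least 1. *)
Lemma short_lattice_vector (z : R * R) m n : frame z = lat R m n ->
  `|z.1| + `|z.2| < 1 -> z = 0.
Proof.
move=> e z1.
have sq : dot (lat R m n) (lat R m n) < 1.
  rewrite -e dot_sqr_frame dot_frame_es dot_frame_eu.
  rewrite -(real_normK (num_real z.1)) -(real_normK (num_real z.2)).
  by have := normr_ge0 z.1; have := normr_ge0 z.2; nra.
have int0 (k : int) : (k%:~R : R) ^+ 2 < 1 -> k = 0.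
  move=> k1; have : (`|k|%:~R : R) < 1.
    rewrite intr_norm -(@ltr_pXn2r _ 2) ?nnegrE// expr1n real_normK// num_real.
  rewrite -[1]/(1%:~R) ltr_int => k2.
  by apply/eqP; rewrite -normr_eq0; have := normr_ge0 k; lia.
have m0 : m = 0 by apply: int0; move: sq; rewrite /dot /= -!expr2; have := sqr_ge0 (n%:~R : R); lra.
have n0 : n = 0 by apply: int0; move: sq; rewrite /dot /= -!expr2; have := sqr_ge0 (m%:~R : R); lra.
have fz : frame z = 0 by rewrite e m0 n0.
have e1 : z.1 = 0 by rewrite -(dot_frame_es z) fz /dot /= !mul0r addr0.
have e2 : z.2 = 0 by rewrite -(dot_frame_eu z) fz /dot /= !mul0r addr0.
by rewrite [z]surjective_pairing e1 e2.
Qed.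

Hypothesis D_embeds : {in D &, injective (@chart R)}.

(* The part of the region away from [z0] is compact and its image misses
   [chart z0], so near [z0] the lattice translate is the trivial one. *)
Lemma bump_region_local_lift (z0 : R * R) : D z0 ->
  exists2 r, 0 < r & forall z, `|z.1 - z0.1| < r -> `|z.2 - z0.2| < r ->
    (@chart R @` D) (chart z) -> D z.
Proof.
move=> D0; pose K := [set z | D z /\ 1 / 2 <= `|z.1 - z0.1| + `|z.2 - z0.2|].
have cK : closed (@chart R @` K).
  apply: compact_closed; first exact: torus_hausdorff.
  apply: continuous_compact; last exact: bump_region_far_compact.
  by apply: continuous_subspaceT => z; exact: chart_continuous.
have oK : open (~` (@chart R @` K)) by exact: closed_openC.
have n0 : (~` (@chart R @` K)) (chart z0).
  move=> [z [Dz zr] e].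
  have ez : z = z0 by apply: D_embeds; rewrite ?inE.
  by move: zr; rewrite ez !subrr !normr0 addr0; lra.
have : nbhs z0 (@chart R @^-1` (~` (@chart R @` K))).
  by apply: chart_continuous; exact: open_nbhs_nbhs.
move=> /nbhs_ballP[r /= r0 hr].
(* With [1 / 2] in [K] and [1 / 4] per coordinate here, [z' - z] has coordinates of total size below
   1. *)
exists (Num.min r (1 / 4)); first by rewrite lt_min r0 /=; lra.
move=> z; rewrite !lt_min => /andP[z1 z1'] /andP[z2 z2'] [z' Dz' ez'].
have nK : ~ (@chart R @` K) (chart z).
  by apply: hr; split; rewrite /ball /= distrC.
have near' : `|z'.1 - z0.1| + `|z'.2 - z0.2| < 1 / 2.
  rewrite ltNge; apply/negP => le; apply: nK; exists z' => //.
have [m [n e]] := chart_eq_frame ez'.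
have : z' - z = 0.
  apply: (@short_lattice_vector _ m n).
    by rewrite frameB e addrC addKr.
  rewrite /=.
  have h1 := ler_normB (z'.1 - z0.1) (z.1 - z0.1).
  have h2 := ler_normB (z'.2 - z0.2) (z.2 - z0.2).
  rewrite opprB addrA subrK in h1; rewrite opprB addrA subrK in h2.
  lra.
by move=> /subr0_eq <-.
Qed.

(** Each point of the segment has some representative in [D], possibly a different lattice
    translate; real induction shows that the continuous lift stays in [D]. Limits use that [D] is
    closed, continuation uses [bump_region_local_lift]. *)
Lemma horizontal_lift (u : R -> R) (y T : R) : continuous u ->
  D (u 0, y) ->
  (forall t, 0 <= t <= T -> (@chart R @` D) (chart (u t, y))) ->
  forall t, 0 <= t <= T -> D (u t, y).
Proof.
move=> cu D0 ch; apply: real_induction => //.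
- move=> t /andP[t0 tT] hs; split => /=.
    rewrite -subr_ge0; apply: (nonneg_left_limit (g := fun t => w - `|u t|)) => //.
      by move=> s; apply: cvgB; [exact: cvg_cst | apply: cvg_norm; exact: cu].
    by move=> s /hs[]; rewrite subr_ge0.
  rewrite -subr_ge0; apply: (nonneg_left_limit (g := fun t => bump h sigma (u t) - `|y|)) => //.
    move=> s; apply: cvgB; last exact: cvg_cst.
    apply: (@continuous_comp _ _ _ u (bump h sigma)); first exact: cu.
    exact: bump_continuous.
  by move=> s /hs[]; rewrite subr_ge0.
- move=> t tI Dt; have [r r0 hr] := bump_region_local_lift Dt.
  have /cvgrPdist_lt/(_ _ r0)/nbhs_ballP[r' /= r'0 hr'] := cu t.
  exists r' => // s /andP[ts sr] sT; apply: hr => /=.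
  + rewrite distrC; apply: hr'; rewrite /ball /= distrC ger0_norm; lra.
  + by rewrite subrr normr0.
  + by apply: ch; case/andP: tI => ? ?; apply/andP; split; lra.
Qed.

End BumpRegions.

(** * Every point reaches the neighbourhood of the segment *)

Section Reaching.
Variable R : realType.
Variables (eps b beta sigma a : R) (V : torus R -> R * R).
Hypothesis heps : 0 < eps.
Hypothesis hb : 0 < b.
Hypothesis hbeta : 0 < beta.
Hypothesis hsigma : 0 < sigma.
Hypothesis V_smooth : smooth_field V.
Hypothesis V_unit : unit_field V.
Hypothesis V_W : tangent_to_bumps V sigma (bump_region a b sigma).
Variable (F : R.-pker torus R ~> torus R).
Hypothesis ha : a = eps / (1 - cat_mu R).
Hypothesis F_perturb : random_perturbation (@cat_map R) V eps F.

Local Notation mu := (cat_mu R).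
Local Notation lambda := (cat_lambda R).
Local Notation vf := (lift_field V).
Local Notation D := (bump_region (a + beta / 2) (b + beta) sigma).

Hypothesis beta_lt : beta < eps / 7.
Hypothesis beta_le : beta <= (lambda - 1) * b.
Hypothesis sigma_small : 6 * sigma ^+ 2 * ln lambda < eps ^+ 2.
Hypothesis D_embeds : {in D &, injective (@chart R)}.
Hypothesis V_out : forall p, ~ (@chart R @` D) p -> dot (V p) (e_u R) != 0.

Variable L : torus R -> R.
Hypothesis bL : bmf L.
Hypothesis L01 : forall p, 0 <= L p <= 1.
Hypothesis kL : forall p, kint F L p <= L p.
Hypothesis L_near : exists r th, [/\ 0 < r, th < 1 &
  forall x y, `|x| <= a -> `|y| <= r -> L (chart (x, y)) <= th].

(** An open condition, with a bound valid on a whole neighbourhood: it can be pulled back along arcs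
    and made uniform by compactness. *)
Definition reaching (z : R * R) := exists r th n, [/\ 0 < r, th < 1 &
  forall z', `|z'.1 - z.1| < r -> `|z'.2 - z.2| < r ->
    iter n (kint F) L (chart z') <= th].

Definition coords (w : R * R) : R * R := (dot w (e_s R), dot w (e_u R)).

Lemma chart_coords w : chart (coords w) = proj w.
Proof. by rewrite /chart -/(frame _) frame_dot. Qed.

Lemma iter_kint01 n p : 0 <= iter n (kint F) L p <= 1.
Proof.
elim: n p => [|n IH] p; first exact: L01.
by apply: kint_bounds => //; exact: iter_bmf_kint.
Qed.

Lemma iter_kint_mono n p : iter n.+1 (kint F) L p <= iter n (kint F) L p.
Proof.
elim: n p => [|n IH] p; first exact: kL.
rewrite -[leLHS]/(kint F (iter n.+1 (kint F) L) p).
rewrite -[leRHS]/(kint F (iter n (kint F) L) p).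
by apply: le_kint => //; exact: iter_bmf_kint.
Qed.

(** The condition depends on the point of the torus only, so any lattice translate may be used. *)
Lemma reaching_chart z z1 : chart z = chart z1 -> reaching z -> reaching z1.
Proof.
move=> e [r [th [n [r0 th1 h]]]]; exists r, th, n; split=> // z' h1 h2.
have [m [k e']] := chart_eq_frame e.
have -> : chart z' = chart (z' - z1 + z).
  rewrite /chart -/(frame _) -/(frame _) frameD frameB e' addrA subrK.
  by rewrite proj_lat.
by apply: h; rewrite /= addrK.
Qed.

Lemma dist2_coords w w' : dist2 w w' = dist2 (coords w) (coords w').
Proof.
rewrite /dist2 /coords /= -!dotBl -dot_sqr_frame.
by rewrite /dot /= !expr2.
Qed.

Lemma field_coord_le1 p : `|dot (V p) (e_s R)| <= 1 /\ `|dot (V p) (e_u R)| <= 1.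
Proof.
have := field_sqr V_unit p; set x := dot _ _; set y := dot _ _ => h.
by split; rewrite ler_norml; have := sqr_ge0 x; have := sqr_ge0 y => ? ?;
  apply/andP; split; nra.
Qed.

Lemma solution_coord_dist c s t : solution vf c ->
  `|(coords (c s)).1 - (coords (c t)).1| <= `|s - t| /\
  `|(coords (c s)).2 - (coords (c t)).2| <= `|s - t|.
Proof.
move=> sc; split; rewrite -[leRHS]mul1r /coords /=.
- apply: (derive_bounded_lipschitz (solution_derive_dot sc (e_s R))) => u.
  by case: (field_coord_le1 (proj (c u))).
- apply: (derive_bounded_lipschitz (solution_derive_dot sc (e_u R))) => u.
  by case: (field_coord_le1 (proj (c u))).
Qed.

Lemma sqr_lt_norm (x r : R) : 0 < r -> x ^+ 2 < r ^+ 2 -> `|x| < r.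
Proof.
move=> r0; rewrite -(real_normK (num_real x)).
by rewrite ltr_pXn2r ?nnegrE// ltW.
Qed.

Lemma curve_perturbation (r : R) : 0 < r -> exists2 rho, 0 < rho &
  forall z z' c c' u, solution vf c -> solution vf c' ->
    c 0 = frame (mu * z.1, lambda * z.2) ->
    c' 0 = frame (mu * z'.1, lambda * z'.2) ->
    `|z'.1 - z.1| < rho -> `|z'.2 - z.2| < rho -> - eps <= u <= eps ->
    `|(coords (c' u)).1 - (coords (c u)).1| < r /\
    `|(coords (c' u)).2 - (coords (c u)).2| < r.
Proof.
move=> r0; have [K K0 lK] := lift_field_lipschitz V_smooth.
have /andP[m0 m1] := cat_mu_bounds R; have /andP[l0 l1] := cat_lambda_bounds R.
(* The Gronwall factor at time [eps], times 9, a common bound for [mu^2] and [lambda^2]. *)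
pose C := expR (4 * K * eps) * 9.
have C0 : 0 < C by rewrite mulr_gt0// expR_gt0.
have C1 : 0 < 1 + C by lra.
pose rho := r / (2 * (1 + C)).
have rho0 : 0 < rho by rewrite divr_gt0// mulr_gt0.
exists rho => // z z' c c' u sc sc' c0 c'0 z1 z2 ue.
have g := solution_gronwall u lK K0 sc' sc.
have du : `|u| <= eps by rewrite ler_norml.
have e1 : expR (4 * K * `|u|) <= expR (4 * K * eps).
  by rewrite ler_expR; apply: ler_wpM2l => //; rewrite mulr_ge0.
have z1s : (z'.1 - z.1) ^+ 2 < rho ^+ 2.
  by rewrite -(real_normK (num_real (_ - _))) ltr_pXn2r ?nnegrE// ltW.
have z2s : (z'.2 - z.2) ^+ 2 < rho ^+ 2.
  by rewrite -(real_normK (num_real (_ - _))) ltr_pXn2r ?nnegrE// ltW.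
have d0 : dist2 (c' 0) (c 0) <= 9 * (2 * rho ^+ 2).
  rewrite dist2_coords c0 c'0 /coords !dot_frame_es !dot_frame_eu /dist2 /=.
  rewrite -!mulrBr (exprMn _ mu) (exprMn _ lambda).
  have mu2 : mu ^+ 2 <= 9 by nra.
  have la2 : lambda ^+ 2 <= 9 by nra.
  have p1 := sqr_ge0 (z'.1 - z.1); have p2 := sqr_ge0 (z'.2 - z.2).
  have q1 : mu ^+ 2 * (z'.1 - z.1) ^+ 2 <= 9 * rho ^+ 2.
    by apply: ler_pM => //; [exact: sqr_ge0 | exact: ltW].
  have q2 : lambda ^+ 2 * (z'.2 - z.2) ^+ 2 <= 9 * rho ^+ 2.
    by apply: ler_pM => //; [exact: sqr_ge0 | exact: ltW].
  have -> : 9 * (2 * rho ^+ 2) = 9 * rho ^+ 2 + 9 * rho ^+ 2 by ring.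
  exact: lerD.
have du2 : dist2 (c' u) (c u) < r ^+ 2.
  apply: (@le_lt_trans _ _ (C * (2 * rho ^+ 2))).
    apply: le_trans g _.
    have -> : C * (2 * rho ^+ 2) = expR (4 * K * eps) * (9 * (2 * rho ^+ 2)).
      by rewrite /C; ring.
    apply: ler_pM; [exact: expR_ge0 | | exact: e1 | exact: d0].
    by rewrite /dist2 addr_ge0// sqr_ge0.
  have rE : r ^+ 2 = (2 * (1 + C)) ^+ 2 * rho ^+ 2.
    by rewrite -exprMn; congr (_ ^+ 2); rewrite /rho; field; rewrite gt_eqF.
  have r2 : 0 < rho ^+ 2 by rewrite exprn_gt0.
  rewrite rE mulrA ltr_pM2r//.
  by have := C0; nra.
move: du2; rewrite dist2_coords /dist2 => du2.
have p1 := sqr_ge0 ((coords (c' u)).1 - (coords (c u)).1).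
have p2 := sqr_ge0 ((coords (c' u)).2 - (coords (c u)).2).
by split; apply: sqr_lt_norm => //; lra.
Qed.

Lemma subinterval (t r : R) : - eps <= t <= eps -> 0 < r -> exists t1 t2,
  [/\ - eps <= t1, t2 <= eps, t2 - t1 = Num.min r eps &
   forall u, t1 < u < t2 -> `|u - t| < r].
Proof.
move=> /andP[h1 h2] r0; set l := Num.min r eps.
have l_r : l <= r by rewrite ge_min lexx.
have l_e : l <= eps by rewrite ge_min lexx orbT.
have [t0|t0] := leP t 0.
  exists t, (t + l); split; [by [] | lra | by rewrite addrAC subrr add0r |].
  by move=> u /andP[u1 u2]; rewrite ger0_norm; lra.
exists (t - l), t; split; [lra | by [] | by rewrite opprB addrCA subrr addr0 |].
by move=> u /andP[u1 u2]; rewrite ler0_norm; lra.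
Qed.

(** Arcs from nearby points stay near [c t] during a parameter interval of fixed length, which
    [arc_uniform_lower] turns into a probability of at least [q]. The iterate of [L] is at most [th]
    there and at most 1 elsewhere, whence the bound [1 - (1 - th) q]. *)
Lemma reaching_step z c t : solution vf c ->
  c 0 = frame (mu * z.1, lambda * z.2) -> - eps <= t <= eps ->
  reaching (coords (c t)) -> reaching z.
Proof.
move=> sc c0 te [r [th [n [r0 th1 h]]]].
have r2 : 0 < r / 2 by rewrite divr_gt0.
have [rho rho0 hrho] := curve_perturbation r2.
have [t1 [t2 [e1 e2 t21 tu]]] := subinterval te r2.
have l0 : 0 < t2 - t1 by rewrite t21 lt_min r2.
have t12 : t1 < t2 by rewrite -subr_gt0.
pose q := (t2 - t1) / (4 * eps).
have q0 : 0 < q by rewrite divr_gt0// mulr_gt0.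
exists rho, (1 - (1 - th) * q), n.+1; split=> //.
  by rewrite gtrDl oppr_lt0 mulr_gt0// subr_gt0.
move=> z' z1 z2.
have [c' [sc' c'0 Fc']] := perturbation_curve F_perturb z'.
pose G := iter n (kint F) L.
have bG : bmf G := iter_bmf_kint F n bL.
pose A : set (torus R) := G @^-1` `]-oo, th]%classic.
have mA : measurable A by rewrite -[A]setTI; apply: bG.1.
have hA u : t1 < u < t2 -> A (proj (c' u)).
  move=> u12; have ue : - eps <= u <= eps.
    by case/andP: u12 => ? ?; apply/andP; split; lra.
  rewrite /A /= in_itv /= -chart_coords; apply: h.
  - have [d1 _] := hrho z z' c c' u sc sc' c0 c'0 z1 z2 ue.
    have [d2 _] := solution_coord_dist u t sc; have := tu u u12.
    have := ler_normD ((coords (c' u)).1 - (coords (c u)).1)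
      ((coords (c u)).1 - (coords (c t)).1).
    by rewrite addrA subrK; lra.
  - have [_ d1] := hrho z z' c c' u sc sc' c0 c'0 z1 z2 ue.
    have [_ d2] := solution_coord_dist u t sc; have := tu u u12.
    have := ler_normD ((coords (c' u)).2 - (coords (c u)).2)
      ((coords (c u)).2 - (coords (c t)).2).
    by rewrite addrA subrK; lra.
have mass : arc_uniform eps (@proj R \o c') setT = 1%E.
  by rewrite -Fc'// prob_kernel.
have := arc_uniform_lower V_smooth sc' heps mass mA e1 t12 e2 hA.
rewrite -Fc'// -/q => hq.
have fq : q <= fine (kmeas F (chart z') A).
  by rewrite -lee_fin fineK// fin_num_measure.
have bI := bmf_indic R mA.
have bH : bmf (fun p => 1 - (1 - th) * (\1_A p : R)).
  by apply: bmfB; [exact: bmf_cst | exact: bmfZ].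
apply: (@le_trans _ _ (kint F (fun p => 1 - (1 - th) * (\1_A p : R)) (chart z'))).
  apply: le_kint => // p; have /andP[_ g1] := iter_kint01 n p.
  rewrite indicE; have [pA|_] := boolP (p \in A); last by rewrite mulr0 subr0.
  rewrite mulr1 opprB addrC subrK.
  by move: pA; rewrite inE /A /= in_itv.
rewrite kintB//; [|exact: bmf_cst|exact: bmfZ].
rewrite kint_cst kintZ// /kint Rintegral_indic//.
by rewrite lerD2l lerN2; apply: ler_wpM2l => //; rewrite subr_ge0 ltW.
Qed.

Let a0 : 0 < a. Proof. exact: a_gt0 heps ha. Qed.

Lemma reaching_self z : reaching (mu * z.1, lambda * z.2) -> reaching z.
Proof.
move=> h; have [c [sc c0 _]] := perturbation_curve F_perturb z.
apply: (@reaching_step z c 0) => //; first by rewrite oppr_le0 !(ltW heps).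
by rewrite c0 /coords dot_frame_es dot_frame_eu.
Qed.

(** The parameter 0 of each arc is the unperturbed image, so the contraction by [mu] can be followed
    until [|x| < a], where [L_near] applies. *)
Lemma reaching_axis x : reaching (x, 0).
Proof.
have /andP[m0 m1] := cat_mu_bounds R.
have [n] : exists n, mu ^+ n * `|x| < a.
  by apply: expr_small => //; apply/andP; split; lra.
elim: n x => [|n IH] x hx.
  rewrite expr0 mul1r in hx.
  have [r [th [r0 th1 h]]] := L_near.
  exists (Num.min r (a - `|x|)), th, 0; split=> //.
    by rewrite lt_min r0 subr_gt0.
  move=> [x' y'] /=; rewrite subr0 !lt_min => /andP[_ h1] /andP[h2 _].
  apply: h; last exact: ltW.
  by have := ler_normD x (x' - x); rewrite addrC subrK; lra.
apply: reaching_self => /=; rewrite mulr0; apply: IH.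
have amu : `|mu| = mu by rewrite ger0_norm; lra.
by rewrite normrM amu mulrA -exprSr.
Qed.

Lemma IVT_between (f : R -> R) s t v : continuous f -> f s < v < f t ->
  exists2 u, Num.min s t <= u <= Num.max s t & f u = v.
Proof.
move=> cf /andP[h1 h2]; have [st|ts] := leP s t.
  have hv : Num.min (f s) (f t) <= v <= Num.max (f s) (f t).
    by rewrite ge_min le_max (ltW h1) (ltW h2) orbT.
  have [u] := IVT st (continuous_subspaceT cf) hv.
  by rewrite in_itv /= => uI e; exists u.
have hv : Num.min (f t) (f s) <= v <= Num.max (f t) (f s).
  by rewrite ge_min le_max (ltW h1) (ltW h2) orbT.
have [u] := IVT (ltW ts) (continuous_subspaceT cf) hv.
by rewrite in_itv /= => uI e; exists u.
Qed.

(* If the unstable coordinate varies along the arc then it takes the unstable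
   component of some lattice vector, so that the arc meets the stable manifold
   of the fixed point. *)
Lemma reaching_nonconstant z c s t : solution vf c ->
  c 0 = frame (mu * z.1, lambda * z.2) -> - eps <= s <= eps -> - eps <= t <= eps ->
  (coords (c s)).2 < (coords (c t)).2 -> reaching z.
Proof.
move=> sc c0 se te st.
have [m [n hmn]] := lattice_unstable_dense st.
have cY : continuous (fun u => (coords (c u)).2).
  by move=> u; exact: is_derive_continuous (solution_derive_dot sc (e_u R) u).
have [u uI e] := IVT_between cY hmn.
apply: (@reaching_step z c u) => //.
  move: uI; rewrite ge_min le_max.
  by case/andP: se => ? ?; case/andP: te => ? ?; case/andP => /orP[?|?] /orP[?|?];
    apply/andP; split; lra.
apply: (@reaching_chart (dot (c u - lat R m n) (e_s R), 0)); last exact: reaching_axis.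
have -> : (dot (c u - lat R m n) (e_s R), 0) = coords (c u - lat R m n).
  by rewrite /coords [dot _ (e_u R)]dotBl -e subrr.
by rewrite !chart_coords -[in RHS](subrK (lat R m n) (c u)) proj_lat.
Qed.

Lemma derive_neq0_nonconstant (f : R -> R) (df t : R) : is_derive t (1 : R) f df ->
  df != 0 -> forall r, 0 < r -> exists2 u, `|u - t| < r & f u != f t.
Proof.
move=> fdf df0 r r0; apply: contrapT => H.
have cst : forall u, `|u - t| < r -> f u = f t.
  by move=> u ur; apply/eqP; apply: contrapT => /negP ne; apply: H; exists u.
move: df0; rewrite -(@derive_val _ _ _ _ _ _ _ fdf).
have -> : 'D_1 f t = 0; last by rewrite eqxx.
apply/cvg_lim => //.
apply: (@cvg_trans _ ((fun=> 0 : R) @ (0 : R)^')); last exact: cvg_cst.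
apply: near_eq_cvg; near=> h; rewrite /= [X in f X](_ : _ = h + t); last by rewrite [h *: 1]mulr1.
rewrite cst ?subrr ?scaler0// addrK; near: h.
exact: (@dnbhs0_lt _ _ r r0).
Unshelve. all: by end_near. Qed.

(** A flat arc has zero unstable speed, so by [V_out] it lies in the image of [D] and is a stable
    segment [y = y0] run through at unit speed. It is long enough to reach far out, where [D] is so
    thin that [y0] fits into [W] at a point [x1 != 0]. There the slope [- (x1 / sigma^2) y0] must be
    0, so [y0 = 0] and the arc lies on the stable manifold. *)
Lemma flat_arc_on_axis z c : solution vf c ->
  c 0 = frame (mu * z.1, lambda * z.2) ->
  (forall s t, - eps <= s <= eps -> - eps <= t <= eps ->
    (coords (c s)).2 <= (coords (c t)).2) -> reaching z.
Proof.
move=> sc c0 mono.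
pose X t := (coords (c t)).1; pose Y t := (coords (c t)).2.
have Yc s t : - eps <= s <= eps -> - eps <= t <= eps -> Y s = Y t.
  by move=> se te; apply/le_anti; rewrite !mono.
have dY0 t : - eps < t < eps -> dot (vf (c t)) (e_u R) = 0.
  move=> /andP[t1 t2]; apply/eqP; apply: contrapT => /negP ne.
  have r0 : 0 < Num.min (t + eps) (eps - t).
    by rewrite lt_min; apply/andP; split; lra.
  have [u] := derive_neq0_nonconstant (solution_derive_dot sc (e_u R) t) ne r0.
  rewrite lt_min !ltr_norml => /andP[/andP[u1 u2] /andP[u3 u4]].
  by move/eqP; apply; apply: Yc; apply/andP; split; lra.
have inD t : - eps < t < eps -> (@chart R @` D) (proj (c t)).
  move=> te; apply: contrapT => nD; have := V_out nD.
  by rewrite -[dot _ _]/(dot (vf (c t)) (e_u R)) dY0// eqxx.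
have dX1 t : - eps < t < eps -> `|dot (vf (c t)) (e_s R)| = 1.
  move=> te; have := field_sqr V_unit (proj (c t)).
  rewrite -/(vf (c t)) dY0// expr0n addr0 => /eqP.
  by rewrite sqrf_eq1 => /orP[]/eqP ->; rewrite ?normrN normr1.
have z0 : - eps < 0 < eps by rewrite oppr_lt0 heps.
have [[x0 y0] D0 e0] := inD 0 z0.
pose u t := x0 + (X t - X 0).
(* The derivative of the height is controlled at interior parameters only, so a slightly shorter
   closed interval is used. *)
pose eta := 19 / 20 * eps.
have etaI t : - eta <= t <= eta -> - eps < t < eps.
  by rewrite /eta => /andP[? ?]; apply/andP; split; lra.
have chu t : - eps < t < eps -> chart (u t, y0) = proj (c t).
  move=> te; rewrite -chart_coords.
  have te' : - eps <= t <= eps by case/andP: te => *; apply/andP; split; lra.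
  have z0' : - eps <= 0 <= eps by apply/andP; split; lra.
  have -> : coords (c t) = coords (c 0) + (X t - X 0, 0).
    rewrite [LHS]surjective_pairing; congr pair => /=.
      by rewrite addrC subrK.
    by rewrite addr0; exact: Yc.
  have -> : (u t, y0) = (x0, y0) + (X t - X 0, 0).
    by congr pair; rewrite /= addr0.
  move: e0; rewrite -chart_coords => /chart_eq_frame[m [n e]].
  by rewrite /chart -/(frame _) -/(frame _) !frameD e addrAC proj_lat.
have cX : continuous X.
  by move=> t; exact: is_derive_continuous (solution_derive_dot sc (e_s R) t).
have cu : continuous u.
  by move=> t; apply: cvgD; [exact: cvg_cst | apply: cvgB; [exact: cX | exact: cvg_cst]].
have cuN : continuous (fun t => u (- t)).
  move=> t; apply: (@continuous_comp _ _ _ (-%R : R -> R) u); last exact: cu.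
  exact: oppr_continuous.
have u0 : u 0 = x0 by rewrite /u subrr addr0.
have hb' : 0 <= b + beta by rewrite addr_ge0// ltW.
have uD t : - eta <= t <= eta -> D (u t, y0).
  move=> /andP[t1 t2]; have [t0|t0] := leP 0 t.
    apply: (horizontal_lift hsigma hb' D_embeds cu (T := eta)).
    - by rewrite u0.
    - move=> s /andP[s1 s2]; have sI : - eps < s < eps.
        by apply: etaI; apply/andP; split; lra.
      by rewrite chu//; exact: inD.
    - by rewrite t0.
  have := @horizontal_lift _ _ _ _ hsigma hb' D_embeds (fun t => u (- t)) y0 eta cuN.
  rewrite oppr0 u0 => /(_ D0) h; rewrite -(opprK t); apply: h.
  - move=> s /andP[s1 s2]; have sI : - eps < - s < eps.
      by apply: etaI; apply/andP; split; lra.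
    by rewrite chu//; exact: inD.
  - by apply/andP; split; lra.
have eta0 : 0 < eta by rewrite /eta; lra.
have width : `|u eta - u (- eta)| = 2 * eta.
  have ee : - eta <= eta by lra.
  have cX' : {within `[- eta, eta], continuous X} by exact: continuous_subspaceT.
  have [t /[!in_itv]/= tI ht] := MVT_segment ee
    (fun t _ => solution_derive_dot sc (e_s R) t) cX'.
  have -> : u eta - u (- eta) = X eta - X (- eta) by rewrite /u; ring.
  rewrite -[X eta - _]/(dot (c eta) (e_s R) - dot (c (- eta)) (e_s R)) ht.
  rewrite normrM dX1; last exact: etaI.
  by rewrite mul1r gtr0_norm; lra.
have Ieta : - eta <= eta <= eta by apply/andP; split; lra.
have INeta : - eta <= - eta <= eta by apply/andP; split; lra.
have [w1 v1] := uD eta Ieta; have [w2 v2] := uD (- eta) INeta.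
rewrite /= in w1 v1 w2 v2.
have /andP[m0 m1] := cat_mu_bounds R; have /andP[l0 l1] := cat_lambda_bounds R.
have a_le : a <= 5 / 3 * eps.
  by rewrite ha ler_pdivrMr ?subr_gt0; [nra | lra].
(* A segment of length [2 eta] inside [|x| <= a + beta / 2 < 7/4 eps] extends beyond [3/20 eps] on
   both sides of 0, so it passes over [x1]. *)
pose x1 := eps / 10.
have x1E : x1 = eps / 10 by [].
have etaE : eta = 19 / 20 * eps by [].
have bl := beta_lt; have he := heps.
have [t1 t1I ut1] : exists2 t, - eta <= t <= eta & u t = x1.
  move: width w1 w2; rewrite !ler_norml => width /andP[p1 p2] /andP[p3 p4].
  have [uu|uu] := leP (u (- eta)) (u eta).
    rewrite ger0_norm ?subr_ge0// in width.
    have : u (- eta) < x1 < u eta.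
      by 
        apply/andP; split; lra.
    move=> /(IVT_between cu)[t tI e]; exists t => //.
    have nn : - eta <= eta by lra.
    by move: tI; rewrite min_l// max_r.
  rewrite ltr0_norm ?subr_lt0// in width.
  have : u eta < x1 < u (- eta).
    by 
      apply/andP; split; lra.
  move=> /(IVT_between cu)[t tI e]; exists t => //.
  have nn : - eta <= eta by lra.
  by move: tI; rewrite min_r// max_l.
(* The ends are [2 eta] apart, so one of them is at distance at least [eta] from 0. *)
have [t2 uabs v3] : exists2 t, eta <= `|u t| & `|y0| <= bump (b + beta) sigma (u t).
  have [h|h] := leP eta `|u eta|; first by exists eta.
  exists (- eta) => //.
  by have := ler_normB (u eta) (u (- eta)); rewrite width; lra.
have s2 : 0 < 2 * sigma ^+ 2 by rewrite mulr_gt0// exprn_gt0.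
(* [b + beta <= lambda b], and from [x1] to [eta] the Gaussian factor drops at least by [lambda],
   because [2 sigma^2 ln lambda < eps^2 / 3 <= eta^2 - x1^2]. *)
have y0b : `|y0| <= bump b sigma x1.
  apply: le_trans v3 _.
  have lb : b + beta <= lambda * b by move: beta_le; lra.
  apply: (@le_trans _ _ (lambda * b * expR (- (eta ^+ 2 / (2 * sigma ^+ 2))))).
    apply: ler_pM => //; try exact: expR_ge0.
    rewrite ler_expR lerN2 ler_pM2r ?invr_gt0//.
    by rewrite -(real_normK (num_real (u t2))) ler_pXn2r ?nnegrE// ltW.
  have {1}-> : lambda = expR (ln lambda) by rewrite lnK// posrE; lra.
  rewrite /bump mulrAC [X in _ <= X]mulrC ler_wpM2r ?(ltW hb)// -expRD ler_expR.
  have : ln lambda <= (eta ^+ 2 - x1 ^+ 2) / (2 * sigma ^+ 2).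
    rewrite ler_pdivlMr// /eta /x1.
    have e2 : 0 < eps ^+ 2 by rewrite exprn_gt0.
    by have := sigma_small; lra.
  by rewrite mulrBl; lra.
have x1a : `|x1| <= a.
  have ea : eps <= a by rewrite ha ler_pdivlMr ?subr_gt0; [nra | lra].
  by rewrite gtr0_norm /x1; lra.
have Wx : bump_region a b sigma (x1, y0) by split.
have t1e := etaI _ t1I.
have := field_slope hsigma V_W Wx.
rewrite /= -ut1 chu// -/(vf (c t1)) dY0// ut1 => /esym/eqP.
have dX0 : dot (vf (c t1)) (e_s R) != 0 by rewrite -normr_gt0 dX1.
have x1n : x1 / sigma ^+ 2 != 0.
  by rewrite mulf_neq0 ?invr_eq0 ?expf_neq0// ?gt_eqF// /x1; lra.
rewrite mulf_eq0 (negbTE dX0) orbF mulf_eq0 oppr_eq0 (negbTE x1n) /= => /eqP y00.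
apply: (@reaching_step z c 0) => //; first by rewrite oppr_le0 !(ltW heps).
apply: (@reaching_chart (x0, 0)); last exact: reaching_axis.
by rewrite -[in LHS]y00 e0 chart_coords.
Qed.

Lemma reaching_all z : reaching z.
Proof.
have [c [sc c0 _]] := perturbation_curve F_perturb z.
have [h|h] := pselect (forall s t, - eps <= s <= eps -> - eps <= t <= eps ->
  (coords (c s)).2 <= (coords (c t)).2); first exact: flat_arc_on_axis sc c0 h.
have [s [t [se te ts]]] : exists s t, [/\ - eps <= s <= eps, - eps <= t <= eps &
    (coords (c t)).2 < (coords (c s)).2].
  apply: contrapT => H; apply: h => s t se te; rewrite leNgt; apply/negP => ts.
  by apply: H; exists s, t.
exact: reaching_nonconstant sc c0 te se ts.
Qed.

Lemma uniform_reaching : exists n th, th < 1 /\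
  forall p, iter n (kint F) L p <= th.
Proof.
(* One index carries both the number of steps and the gap to 1, so a single compactness argument
   suffices; the iterates decrease with [N], so larger [N] only weakens [P]. *)
pose P (N : nat) (w : R * R) := iter N (kint F) L (proj w) <= 1 - N.+1%:R^-1.
have /compact_near_coveringP/(_ nat \oo P _) H := @compact_unit_square R.
have : \forall N \near \oo, `[0, 1] `*` `[0, 1] `<=` P N.
  apply: H => w _; have [r [th [n [r0 th1 h]]]] := reaching_all (coords w).
  have cd (e : R * R) : continuous (fun w : R * R => dot w e).
    move=> x; apply: cvgD; apply: cvgM; try exact: cvg_cst.
    - exact: cvg_fst.
    - exact: cvg_snd.
  have /cvgrPdist_lt/(_ _ r0) n1 := cd (e_s R) w.
  have /cvgrPdist_lt/(_ _ r0) n2 := cd (e_u R) w.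
  have th0 : 0 < 1 - th by lra.
  have [N0 hN0] : exists N0, forall N, (N0 <= N)%N -> th <= 1 - N.+1%:R^-1.
    exists (Num.truncn (1 - th)^-1) => N hN.
    have h1 := truncnS_gt (1 - th)^-1.
    have h2 : (1 - th)^-1 < N.+1%:R by apply: lt_le_trans h1 _; rewrite ler_nat.
    have : N.+1%:R^-1 < 1 - th by rewrite invf_plt ?posrE// ltr0n.
    by move=> /ltW h3; rewrite lerBrDr addrC -lerBrDr.
  exists ([set w' | `|dot w (e_s R) - dot w' (e_s R)| < r /\
                    `|dot w (e_u R) - dot w' (e_u R)| < r],
          [set N | (maxn n N0 <= N)%N]).
    split=> /=; last by exists (maxn n N0).
    by apply: filterS2 n1 n2 => w' /=.
  move=> [w' N] /= [[w1 w2] hN]; rewrite /P.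
  have [nN N0N] : (n <= N)%N /\ (N0 <= N)%N by move: hN; rewrite geq_max => /andP.
  apply: le_trans (hN0 N N0N); rewrite -chart_coords.
  apply: (@le_trans _ _ (iter n (kint F) L (chart (coords w')))).
    rewrite -(subnK nN); elim: (N - n)%N => [//|j IH].
    by apply: le_trans (iter_kint_mono _ _) IH.
  by apply: h; rewrite distrC.
move=> [N _ /(_ N (leqnn N)) hN].
exists N, (1 - N.+1%:R^-1); split; first by rewrite gtrDl oppr_lt0 invr_gt0 ltr0n.
move=> p; have [m [n hz]] := unit_square_rep (repr p).
by rewrite -(proj_repr p) -(proj_lat (repr p) m n); exact: hN.
Qed.

End Reaching.

(** * Integrals against the means of the iterates *)

Section CesaroMeans.
Context d (T : measurableType d) (R : realType).
Variables (k : R.-pker T ~> T) (nu : probability T R).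

Lemma cesaro_mean_setT n : cesaro_mean k nu n setT = 1%E.
Proof.
transitivity ((n.+1%:R^-1)%:E *
  \sum_(i < n.+1) (iter i (push k) nu : probability T R) setT)%E; first by [].
rewrite (eq_bigr (fun=> (1 : R)%:E)); last by move=> i _; exact: probability_setT.
rewrite sumEFin sumr_const card_ord -EFinM; congr EFin.
by rewrite mulVf// pnatr_eq0.
Qed.

Lemma Rintegral_cesaro_mean n (g : T -> R) : bmf g ->
  \int[cesaro_mean k nu n]_x g x =
  n.+1%:R^-1 * \sum_(i < n.+1) \int[iter i (push k) nu]_x g x.
Proof.
move=> bg; have [mg [M gM]] := bg.
have gM0 y : 0 <= g y + M by have := gM y; rewrite ler_norml; lra.
have bgM : bmf (fun y => g y + M) by apply: bmfD => //; exact: bmf_cst.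
have int_c h : bmf h -> (cesaro_mean k nu n).-integrable setT (EFin \o h).
  move=> [mh [N hN]]; apply: measurable_bounded_integrable => //.
    by rewrite [X in (X < _)%E]cesaro_mean_setT ltry.
  exists N; split; first exact: num_real.
  by move=> x Nx y _; exact: (le_trans (hN y) (ltW Nx)).
have cst_p (m : probability T R) : \int[m]_x M = M.
  by rewrite Rintegral_cst// (congr1 fine (probability_setT m)) mulr1.
have cst_c : \int[cesaro_mean k nu n]_x M = M.
  by rewrite Rintegral_cst// (congr1 fine (cesaro_mean_setT n)) mulr1.
apply: (@addIr _ M).
rewrite -{1}cst_c -RintegralD//; [|exact: int_c|exact: (int_c _ (bmf_cst _ M))].
rewrite {1}/Rintegral /cesaro_mean ge0_integral_mscale//; last 2 first.
- by apply/measurable_EFinP; case: bgM.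
- by move=> x _; rewrite lee_fin.
rewrite ge0_integral_measure_sum//; last 2 first.
- by move=> x _; rewrite lee_fin.
- by apply/measurable_EFinP; case: bgM.
have E i : (\int[iter i (push k) nu]_x (g x + M)%:E =
    (\int[iter i (push k) nu]_x g x + M)%:E)%E.
  have ig := bmf_integrable (iter i (push k) nu) measurableT bgM.
  rewrite -[LHS]fineK; last exact: integrable_fin_num.
  congr EFin; rewrite -[LHS]/(\int[iter i (push k) nu]_x (g x + M)).
  rewrite RintegralD// ?cst_p//; first exact: bmf_integrable.
  exact: (bmf_integrable _ measurableT (bmf_cst _ M)).
under eq_bigr do rewrite E.
rewrite sumEFin -EFinM /= big_split /= sumr_const card_ord mulrDr.
by rewrite -[M *+ _]mulr_natl mulKf// pnatr_eq0.
Qed.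

End CesaroMeans.

(** * The segment as a zero set of volume 0 *)

Section StableSegment.
Variable R : realType.
Variable a : R.
Hypothesis a_ge0 : 0 <= a.

Lemma lipschitz_continuous_line (f : R -> R) (K : R) : 0 <= K ->
  (forall x y, `|f x - f y| <= K * `|x - y|) -> continuous f.
Proof.
move=> K0 fK x; apply/cvgrPdist_lt => e e0; apply/nbhs_ballP.
have K1 : 0 < K + 1 by lra.
exists (e / (K + 1)); first by rewrite /= divr_gt0.
move=> y; rewrite /ball /= ltr_pdivlMr// => xy.
by apply: le_lt_trans (fK x y) _; have := normr_ge0 (x - y); nra.
Qed.

Lemma lipschitz_continuous_plane (f : R * R -> R) (K : R) : 0 <= K ->
  (forall z w, `|f z - f w| <= K * (`|z.1 - w.1| + `|z.2 - w.2|)) -> continuous f.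
Proof.
move=> K0 fK x; apply/cvgrPdist_lt => e e0.
have K1 : 0 < K + 1 by lra.
have r0 : 0 < e / (2 * (K + 1)) by rewrite divr_gt0// mulr_gt0.
apply: filterS (nbhsx_ballx x _ r0) => y [] /=; rewrite /ball /= !ltr_pdivlMr ?mulr_gt0// => h1 h2.
apply: le_lt_trans (fK x y) _.
by have := normr_ge0 (x.1 - y.1); have := normr_ge0 (x.2 - y.2); nra.
Qed.

(** The minimum over the segment of the Lipschitz functions [Tdist z (w u)] is again Lipschitz and
    periodic. It serves as the test function that detects mass off the segment, and it gives
    measurability. *)
Lemma segment_distance : exists G : torus R -> R,
  [/\ continuous G, forall p, 0 <= G p & forall p, G p = 0 <-> stable_segment a p].
Proof.
pose w (u : R) : R * R := frame (u, 0).
have p0 : 0 <= 2 * pi :> R by rewrite mulr_ge0// ltW// pi_gt0.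
have wE u v : `|(w u).1 - (w v).1| = `|(e_s R).1| * `|u - v| /\
              `|(w u).2 - (w v).2| = `|(e_s R).2| * `|u - v|.
  rewrite /w /frame /= !scale0r !addr0 /= -!normrM.
  by split; congr (`|_|); rewrite /GRing.scale /=; ring.
have cw z : continuous (fun u => Tdist z (w u)).
  apply: (@lipschitz_continuous_line _
    (2 * pi * (`|(e_s R).1| + `|(e_s R).2|))); first by rewrite mulr_ge0// addr_ge0.
  move=> u v; apply: le_trans (Tdist_lip _ _ _ _) _.
  have [-> ->] := wE u v; rewrite !subrr !normr0 !add0r -mulrDl mulrA.
  exact: lexx.
have min z : exists u, `|u| <= a /\ forall v, `|v| <= a -> Tdist z (w u) <= Tdist z (w v).
  have aa : - a <= a by have := a_ge0; lra.
  have [u uI hu] := EVT_min aa (continuous_subspaceT (cw z)).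
  exists u; split; first by move: uI; rewrite in_itv /= -ler_norml.
  by move=> v va; apply: hu; rewrite in_itv /= -ler_norml.
have [U hU] := choice min.
pose G z := Tdist z (w (U z)).
have G_le z v : `|v| <= a -> G z <= Tdist z (w v) by move=> va; apply: (hU z).2.
have Glip z z' : `|G z - G z'| <= 2 * pi * (`|z.1 - z'.1| + `|z.2 - z'.2|).
  have half x y : G x - G y <= 2 * pi * (`|x.1 - y.1| + `|x.2 - y.2|).
    have h1 := G_le x (U y) (hU y).1.
    have := Tdist_lip x y (w (U y)) (w (U y)).
    rewrite !subrr !normr0 !addr0 => h2.
    by have := ler_norm (Tdist x (w (U y)) - Tdist y (w (U y))); rewrite /G in h1 *; lra.
  rewrite ler_norml; apply/andP; split; last exact: half.
  by have := half z' z; rewrite (distrC z'.1) (distrC z'.2); lra.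
have Glat z m n : G (z + lat R m n) = G z.
  apply/le_anti/andP; split.
    by rewrite [leRHS]/G -(Tdist_lat _ _ m n); apply: G_le; exact: (hU z).1.
  rewrite [leRHS]/G Tdist_lat; apply: G_le; exact: (hU _).1.
exists (fun p => G (repr p)); split.
- apply: (lattice_invariant_continuous (G := G)) => //.
  exact: lipschitz_continuous_plane Glip.
- by move=> p; exact: Tdist_ge0.
- move=> p; split.
    move=> /Tdist_eq0; rewrite proj_repr => ->; exists (U (repr p)) => //.
    by rewrite /= in_itv /= -ler_norml; exact: (hU _).1.
  move=> [u]; rewrite /= in_itv /= -ler_norml => ua pE.
  apply/le_anti; rewrite Tdist_ge0 andbT.
  apply: le_trans (G_le _ _ ua) _.
  have : proj (repr p) = proj (w u) by rewrite proj_repr -pE.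
  by move=> /proj_eq_lat[m [n ->]]; rewrite Tdist_lat Tdist_refl.
Qed.

Lemma segment_measurable : measurable (stable_segment a).
Proof.
have [G [cG _ G0]] := segment_distance.
have -> : stable_segment a = setT `&` G @^-1` [set 0].
  by rewrite setTI; apply/seteqP; split=> p /G0.
exact: (torus_continuous_measurable cG).
Qed.

Lemma e_s1_neq0 : (e_s R).1 != 0.
Proof. by rewrite e_sE /= invr_eq0 gt_eqF// norm_e_gt0. Qed.

(** The stable direction is not vertical, so on a vertical line each lattice translate of the
    segment has at most one point: vertical slices are countable. *)
Lemma segment_volume : riemannian_volume (stable_segment a) = 0%E.
Proof.
rewrite /riemannian_volume /product_measure1.
apply: integral0_eq => x _ /=; apply: countable_lebesgue_measure0.
pose f (mn : int * int) : R :=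
  (x - mn.1%:~R) / (e_s R).1 * (e_s R).2 + mn.2%:~R.
apply: (@sub_countable _ _ _ (f @` setT)); last first.
  by apply: card_le_trans (card_image_le _ _) _; exact: countableP.
apply: subset_card_le => y; rewrite /xsection /= inE => -[_ [u _ /= e]].
have /proj_eq_lat[m [n]] : proj (x, y) = proj (frame (u, 0)) by rewrite -e.
rewrite /frame /= scale0r addr0 => -[e1 e2].
exists (m, n) => //; rewrite /f /= e1 e2 addrK /GRing.scale /= mulfK//.
exact: e_s1_neq0.
Qed.

End StableSegment.

(** * Assembly of the theorem *)

Lemma torus_continuous_bmf (R : realType) (g : torus R -> R) :
  continuous g -> bmf g.
Proof.
move=> cg; split; first exact: torus_continuous_measurable.
have cG : continuous (fun z => g (proj z)).
  by move=> z; apply: continuous_comp; [exact: proj_continuous | exact: cg].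
have [|K [_ hK]] := periodic_bounded cG; first by move=> z m n; rewrite proj_lat.
by exists K => p; rewrite -(proj_repr p).
Qed.

Lemma sub_bump_region (R : realType) (w w' h h' sigma : R) : w <= w' -> h <= h' ->
  bump_region w h sigma `<=` bump_region w' h' sigma.
Proof.
move=> ww hh z [z1 z2]; split; first exact: le_trans ww.
by apply: le_trans z2 _; rewrite /bump ler_wpM2r// expR_ge0.
Qed.

Theorem theorem2 (R : realType) (eps b beta sigma a phi : R)
    (heps : 0 < eps) (hb : 0 < b) (hbeta : 0 < beta) (hsigma : 0 < sigma)
    (ha : a = eps / (1 - cat_mu R))
    (hphi : 0 < phi < pi / 2)
    (B1 : 3 * (sigma * Num.sqrt (4 * ln (cat_lambda R) / (1 - cat_mu R ^+ 2))
               + b) < eps)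
    (B2 : beta < eps / 7 /\ beta <= (cat_lambda R - 1) * b)
    (B3 : eps * sin phi / (1 - cat_mu R)
          + (b + beta) * expR (- ((a + beta) ^+ 2 / (2 * sigma ^+ 2))) * tan phi
          < beta / 4)
    (U_embeds : {in bump_region (a + beta) (b + beta) sigma &,
                 injective (@chart R)})
    (V : torus R -> R * R)
    (V_smooth : smooth_field V) (V_unit : unit_field V)
    (V_W : tangent_to_bumps V sigma (bump_region a b sigma))
    (V_out : constant_unstable_angle V phi
       (~` (@chart R @` bump_region (a + beta / 2) (b + beta) sigma)))
    (F : R.-pker torus R ~> torus R)
    (F_perturb : random_perturbation (@cat_map R) V eps F) :
  exists mu0 : probability (torus R) R,
    [/\ invariant_law F mu0,
        forall m : probability (torus R) R, invariant_law F m ->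
          forall A, measurable A -> m A = mu0 A,
        singular_to_volume mu0,
        supported_on mu0 (stable_segment a) &
        forall nu : probability (torus R) R,
          (forall m : probability (torus R) R,
             weak_limit_point (fun n => iter n (push F) nu) m ->
             supported_on m (stable_segment a)) /\
          weak_cvg (cesaro_mean F nu) mu0].
Proof.
have [B2a B2b] := B2.
have /andP[m0 m1] := cat_mu_bounds R; have /andP[l0 l1] := cat_lambda_bounds R.
have a0 := a_gt0 heps ha.
have W_embeds : {in bump_region a b sigma &, injective (@chart R)}.
  move=> x y /set_mem xW /set_mem yW; apply: U_embeds; rewrite inE.
    by apply: sub_bump_region xW; lra.
  by apply: sub_bump_region yW; lra.
have D_embeds : {in bump_region (a + beta / 2) (b + beta) sigma &,
    injective (@chart R)}.
  move=> x y /set_mem xW /set_mem yW; apply: U_embeds; rewrite inE.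
    by apply: sub_bump_region xW; lra.
  by apply: sub_bump_region yW; lra.
(* Squaring (B1) gives [9 sigma^2 q < eps^2] with [q >= 4 ln lambda]. *)
have sigma_small : 6 * sigma ^+ 2 * ln (cat_lambda R) < eps ^+ 2.
  have ln0 : 0 <= ln (cat_lambda R) by apply: ln_ge0; lra.
  have mu1 : 0 < 1 - cat_mu R ^+ 2 by nra.
  set q := 4 * ln (cat_lambda R) / (1 - cat_mu R ^+ 2) in B1.
  have q0 : 0 <= q by rewrite divr_ge0 ?(ltW mu1)// mulr_ge0.
  have qE : 4 * ln (cat_lambda R) = q * (1 - cat_mu R ^+ 2).
    by rewrite /q divfK// gt_eqF.
  have r0 := sqrtr_ge0 q; have rE : Num.sqrt q ^+ 2 = q by rewrite sqr_sqrtr.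
  have sr0 : 0 <= 3 * (sigma * Num.sqrt q) by rewrite !mulr_ge0// ltW.
  have : (3 * (sigma * Num.sqrt q)) ^+ 2 < eps ^+ 2.
    by rewrite ltr_pXn2r ?nnegrE ?(ltW heps)//; lra.
  rewrite !exprMn rE => h.
  have : 4 * ln (cat_lambda R) <= q.
    by rewrite qE ler_piMr//; have := sqr_ge0 (cat_mu R); lra.
  have s2 : 0 < sigma ^+ 2 by rewrite exprn_gt0.
  move=> h4; have : sigma ^+ 2 * (4 * ln (cat_lambda R)) <= sigma ^+ 2 * q.
    by rewrite ler_pM2l.
  have : 0 <= sigma ^+ 2 * q by rewrite mulr_ge0// ltW.
  by lra.
have V_out' p : ~ (@chart R @` bump_region (a + beta / 2) (b + beta) sigma) p ->
    dot (V p) (e_u R) != 0.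
  move=> np; rewrite -normr_gt0 V_out//; apply: cos_gt0_pihalf.
  by case/andP: hphi => p0 ->; rewrite andbT (lt_trans _ p0)// oppr_lt0 divr_gt0// pi_gt0.
have [d [s [rho [/andP[d0 dle] s0 rho01 drift]]]] := lyapunov_drift heps hb hsigma
  V_smooth V_unit V_W ha W_embeds F_perturb sigma_small.
pose L := lyapunov a d s.
have bL : bmf L := bmf_lyapunov heps hb hsigma ha W_embeds d0 dle s0.
have L01 p : 0 <= L p <= 1 by exact: (lyapunov01 heps hb hsigma ha W_embeds d0 dle s0).
have L0 p : L p = 0 <-> stable_segment a p.
  exact: (lyapunov_eq0 heps hb hsigma ha W_embeds d0 dle s0).
have far p : height a d p = d -> L p = 1.
  by rewrite /L /lyapunov => ->; rewrite divff ?gt_eqF// powR1.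
have kL p : kint F L p <= L p.
  have [[x [y [xa yd ->]]]|/far ->] := heightP a d0 p; last first.
    by have /andP[_] := kint_bounds F p bL L01.
  apply: le_trans (drift x y xa yd) _; rewrite -[leRHS]mul1r.
  case/andP: rho01 => _ r1; apply: ler_wpM2r; last exact: ltW.
  by have /andP[] := L01 (chart (x, y)).
have L_near : exists r th, [/\ 0 < r, th < 1 &
    forall x y, `|x| <= a -> `|y| <= r -> L (chart (x, y)) <= th].
  exists (d / 2), ((1 / 2) `^ s); split; first by rewrite divr_gt0.
    rewrite -[ltRHS](congr1 (@^~ s) (powR1 R)).
    by apply: gt0_ltr_powR; rewrite ?nnegrE//; lra.
  move=> x y xa yd; rewrite /L /lyapunov (height_chart heps hb hsigma ha W_embeds dle)//;
    last by lra.
  apply: ge0_ler_powR; rewrite ?nnegrE ?divr_ge0 ?(ltW s0) ?(ltW d0)//.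
  by rewrite ler_pdivrMr//; lra.
have [n [th [th1 hth]]] := uniform_reaching heps hb hbeta hsigma V_smooth V_unit V_W
  ha F_perturb B2a B2b sigma_small D_embeds V_out' bL L01 kL L_near.
have mono j p : iter j.+1 (kint F) L p <= iter 1 (kint F) L p.
  elim: j => [//|j IH]; exact: le_trans (iter_kint_mono bL kL j.+1 p) IH.
pose rho' := Num.max rho th.
have rho'01 : 0 <= rho' < 1.
  by case/andP: rho01 => r1 r2; rewrite le_max r1 gt_max r2.
(* The extra step guarantees one application of the drift when [p] is in the box, even for [n = 0];
   off the box [L p = 1] and the bound [th] is reached after [n] steps. *)
have knL p : iter n.+1 (kint F) L p <= rho' * L p.
  have [[x [y [xa yd ->]]]|/far ->] := heightP a d0 p; last first.
    rewrite mulr1; apply: le_trans (iter_kint_mono bL kL n p) _.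
    by rewrite (le_trans (hth p))// le_max lexx orbT.
  apply: le_trans (mono n _) _; apply: le_trans (drift x y xa yd) _.
  apply: ler_wpM2r; last by rewrite le_max lexx.
  by have /andP[] := L01 (chart (x, y)).
have seg p : [set p | L p = 0] p -> exists2 x, `|x| <= a & p = chart (x, 0).
  by move=> /L0[x]; rewrite /= in_itv /= -ler_norml => xa <-; exists x.
have a00 : `|0 : R| <= a by rewrite normr0 ltW.
have Sp0 : [set p | L p = 0] (chart (0, 0)).
  by apply/L0; exists 0 => //; rewrite /= in_itv /= -ler_norml.
have mJ := core_measurable a.
have alpha01 : 0 < core_radius a / eps <= 1.
  have ea := eps_mu_a ha.
  have mua : 0 < cat_mu R * a by rewrite mulr_gt0//; lra.
  rewrite divr_gt0//=; last by rewrite mulr_gt0//; lra.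
  by rewrite ler_pdivrMr// mul1r /core_radius; lra.
have kJ p : [set p | L p = 0] p -> F p (core a) = (core_radius a / eps)%:E.
  move=> /seg[x xa ->].
  exact: (kernel_core_mass heps hb hsigma V_smooth V_unit V_W ha W_embeds F_perturb xa).
have kJS p A : [set p | L p = 0] p -> measurable A -> A `<=` core a ->
    F p A = F (chart (0, 0)) A.
  move=> /seg[x xa ->] mA AJ.
  have kc := kernel_core heps hb hsigma V_smooth V_unit V_W ha W_embeds F_perturb.
  by rewrite (kc x)// (kc 0).
have [mu0 mu0_inv] : exists mu0 : probability (torus R) R, invariant_law F mu0.
  exact: (ex_intro _ _ (regeneration_invariant bL L01 kL Sp0 mJ alpha01 kJ kJS)).
have supp (m : probability (torus R) R) : invariant_law F m ->
    supported_on m (stable_segment a).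
  move=> mi; rewrite /supported_on.
  have -> : stable_segment a = [set p | L p = 0] by apply/seteqP; split=> p /L0.
  exact: (invariant_concentrated bL L01 rho'01 knL mi).
have mS := segment_measurable (ltW a0).
have near_L (g : torus R -> R) (j : nat) (e : R) : continuous g -> 0 < e ->
    exists2 K, 0 <= K & forall p, exists2 q, [set p | L p = 0] q &
      `|iter j (kint F) g p - iter j (kint F) g q| <= e + K * L p.
  move=> cg e0; have bg := torus_continuous_bmf cg.
  apply: (near_segment_lyapunov heps hb hsigma ha W_embeds d0 dle s0) => //.
    exact: iter_bmf_kint.
  elim: j => [|j IH]; first exact: continuous_near_segment.
  apply: (kint_near_segment heps hb hsigma V_smooth V_unit V_W ha W_embeds F_perturb) => //.
  exact: iter_bmf_kint.
(* The iterates themselves converge weakly, which yields both the claim on limit points and, by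
   averaging, the convergence of the means. *)
have weak (nu : probability (torus R) R) (g : torus R -> R) : continuous g ->
    \int[iter n (push F) nu]_x g x @[n --> \oo] --> \int[mu0]_x g x.
  move=> cg; apply: (push_iter_cvg bL L01 kL rho'01 knL mJ alpha01 kJ kJS) => //.
    exact: torus_continuous_bmf.
  by move=> j e e0; exact: near_L.
exists mu0; split=> //.
- move=> m mi A mA.
  exact: (invariant_unique bL L01 kL rho'01 knL Sp0 mJ alpha01 kJ kJS mi mu0_inv mA).
- exists (stable_segment a); first exact: mS.
  by split; [exact: segment_volume | exact: supp].
- exact: supp.
- move=> nu; split.
  + move=> m [h hh mh]; have [G [cG G_ge0 G0]] := segment_distance (ltW a0).
    have bG := torus_continuous_bmf cG.
    have hinf : h @ \oo --> \oo.
      have hge i : (i <= h i)%N.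
        by elim: i => // i IH; apply: leq_ltn_trans IH _; apply: hh.
      by move=> A [N _ NA]; exists N => // i /= Ni; apply: NA; exact: leq_trans (hge i).
    have lim1 : \int[iter (h i) (push F) nu]_x G x @[i --> \oo] --> \int[mu0]_x G x.
      exact: (cvg_comp _ _ hinf (weak nu G cG)).
    (* A limit point gives the test function [G] the same mean as [mu0], namely 0, and [G] is
       positive off the segment. *)
    have e : \int[m]_x G x = \int[mu0]_x G x.
      exact: (cvg_unique _ (mh G cG) lim1).
    have z0 : \int[mu0]_x G x <= 0.
      rewrite (Rintegral_null measurableT (measurableC mS) bG (supp _ mu0_inv)).
      rewrite setTD setCK (@eq_Rintegral _ _ _ _ _ (fun=> 0)); last first.
        by move=> p; rewrite inE => /G0.
      by rewrite Rintegral_cst// mul0r.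
    rewrite -e in z0; have := Rintegral_ge0_eq0 bG G_ge0 z0.
    rewrite /supported_on; congr (m _ = _); apply/seteqP; split=> p /=.
      by move=> /eqP Gp Sp; apply: Gp; apply/G0.
    by move=> nS; apply/eqP => /G0.
  + move=> g cg.
    have := cesaro (weak nu g cg).
    apply: cvg_trans; apply: near_eq_cvg; apply: nearW => j.
    rewrite Rintegral_cesaro_mean; last exact: torus_continuous_bmf.
    by rewrite /arithmetic_mean /= /series /= big_mkord.
Qed.
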